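(* Let $q>0$ and let $E$ be a quasi-Banach sequence space. The following assertions are equivalent: (i) $E\in Int(\ell^0,\ell^q)$; (ii) $E\in Int(\ell^p,\ell^q)$ for each $p\in(0,\sigma_E)$; (iii) $E\in Int(\ell^0,\ell^q)$ and $E\in Int(\ell^p,\ell^\infty)$ for each $p\in(0,\sigma_E)$.
   Context: All sequences are real, with coordinate-wise operations; a quasi-Banach sequence space is a quasi-Banach space consisting of real sequences. For $0<p<\infty$, $\|x\|_{\ell^p}=(\sum_k|x_k|^p)^{1/p}$; $\ell^\infty$ has the sup norm; $\ell^0$ is the linear space of eventually zero sequences equipped with $\|x\|_{\ell^0}:=\mathrm{card}\{k:x_k\ne0\}$ (a group quasi-norm generating the discrete topology). A map $T$ is bounded on $X$ if $\sup_{x\ne0}\|Tx\|_X/\|x\|_X<\infty$. For $0\le p<q\le\infty$ (so $\ell^p\subset\ell^q$), $\mathfrak{L}(\ell^p,\ell^q)$ is the set of bounded linear operators $T$ on $\ell^q$ whose restriction to $\ell^p$ is a bounded map of $\ell^p$ into itself. $Int(\ell^p,\ell^q)$ is the class of all quasi-Banach spaces $E$ with continuous inclusions $\ell^p\subset E\subset\ell^q$ such that every $T\in\mathfrak{L}(\ell^p,\ell^q)$ maps $E$ boundedly into $E$. $\sigma_E>0$ denotes the Aoki–Rolewicz index of $E$: a fixed number such that there is a subadditive functional on $E$ equivalent to $\|\cdot\|_E^{\sigma_E}$ (such a number exists by the Aoki–Rolewicz theorem). *)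

(* Defs.v *)
From mathcomp Require Import all_boot all_order all_algebra.
From mathcomp Require Import all_classical all_reals all_analysis.
Set Implicit Arguments.
Unset Strict Implicit.
Unset Printing Implicit Defensive.
Import Order.TTheory GRing.Theory Num.Theory.
Import numFieldNormedType.Exports.

Local Open Scope classical_set_scope.
Local Open Scope ring_scope.

(* A set of real sequences together with a size functional. No axiom is imposed
   here, so that both quasi-Banach sequence spaces and the group-quasi-normed
   space l^0 are instances. The values of [qnorm] off [carrier] are irrelevant. *)
Record seqSpace (R : realType) := SeqSpace {
  carrier : set (nat -> R);
  qnorm : (nat -> R) -> R }.

Definition linear_subspace (R : realType) (S : set (nat -> R)) : Prop :=
  S 0 /\ forall (a : R) (x y : nat -> R), S x -> S y -> S (a \*o x + y).

Definition quasi_norm_on (R : realType) (S : set (nat -> R))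
    (N : (nat -> R) -> R) : Prop :=
  [/\ forall x, S x -> 0 <= N x,
      forall x, S x -> N x = 0 -> x = 0,
      forall (a : R) x, S x -> N (a \*o x) = `|a| * N x
    & exists C : R, forall x y, S x -> S y -> N (x + y) <= C * (N x + N y)].

Definition complete_for (R : realType) (S : set (nat -> R))
    (N : (nat -> R) -> R) : Prop :=
  forall u : nat -> (nat -> R), (forall n, S (u n)) ->
    (forall e : R, 0 < e -> exists n0 : nat, forall m n : nat,
       (n0 <= m)%N -> (n0 <= n)%N -> N (u m - u n) < e) ->
    exists2 l, S l & (fun n => N (u n - l)) @ \oo --> (0 : R).

Definition quasi_banach (R : realType) (E : seqSpace R) : Prop :=
  [/\ linear_subspace (carrier E),
      quasi_norm_on (carrier E) (qnorm E)
    & complete_for (carrier E) (qnorm E)].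

(* For 0 < p <= +oo this is the L^p-norm for the counting measure on nat (the
   library's [Lnorm] at p = 0 is not the cardinality of the support). *)
Definition ell_norm (R : realType) (p : \bar R) (x : nat -> R) : \bar R :=
  if p == 0%E then counting [set k | x k != 0]
  else Lnorm (@counting nat R) p (EFin \o x).

Definition ell (R : realType) (p : \bar R) : seqSpace R :=
  SeqSpace [set x | (ell_norm p x < +oo)%E] (fun x => fine (ell_norm p x)).

(* Continuity is with respect to the topologies whose neighbourhoods of x are
   generated by the balls {y | |y - x| < e}; for l^0 it is the discrete one. *)
Definition continuous_inclusion (R : realType) (X Y : seqSpace R) : Prop :=
  carrier X `<=` carrier Y /\
  forall x, carrier X x -> forall e : R, 0 < e -> exists2 d : R, 0 < d &
    forall y, carrier X y -> qnorm X (y - x) < d -> qnorm Y (y - x) < e.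

Definition bounded_map (R : realType) (X : seqSpace R)
    (T : (nat -> R) -> (nat -> R)) : Prop :=
  (forall x, carrier X x -> carrier X (T x)) /\
  exists C : R, forall x, carrier X x -> x <> 0 ->
    qnorm X (T x) / qnorm X x <= C.

Definition linear_on (R : realType) (S : set (nat -> R))
    (T : (nat -> R) -> (nat -> R)) : Prop :=
  forall (a : R) (x y : nat -> R), S x -> S y ->
    T (a \*o x + y) = a \*o T x + T y.

(* An operator on l^q is represented by a total function on sequences, whose
   values off l^q are irrelevant. *)
Definition bounded_operators (R : realType) (p q : \bar R) :
    set ((nat -> R) -> (nat -> R)) :=
  [set T | [/\ linear_on (carrier (ell q)) T, bounded_map (ell q) T
             & bounded_map (ell p) T]].

(* The class Int(l^p, l^q), which is only defined for 0 <= p < q <= +oo. *)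
Definition Int (R : realType) (p q : \bar R) : set (seqSpace R) :=
  [set E | [/\ (0 <= p < q)%E, quasi_banach E,
               continuous_inclusion (ell p) E,
               continuous_inclusion E (ell q)
             & forall T, bounded_operators p q T -> bounded_map E T]].

(* s is an admissible value of the Aoki-Rolewicz index of E: some subadditive
   functional on E is equivalent to the s-th power of the quasi-norm. *)
Definition aoki_rolewicz_index (R : realType) (E : seqSpace R) (s : R) : Prop :=
  0 < s /\
  exists F : (nat -> R) -> R,
    (forall x y, carrier E x -> carrier E y -> F (x + y) <= F x + F y) /\
    exists c C : R, [/\ 0 < c, 0 < C &
      forall x, carrier E x ->
        c * (qnorm E x `^ s) <= F x <= C * (qnorm E x `^ s)].

(* Main.v *)
Require Import Defs.
From mathcomp Require Import all_boot all_order all_algebra.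
From mathcomp Require Import all_classical all_reals all_analysis.
From Stdlib Require Cantor.
From mathcomp Require Import ess_sup_inf.
From mathcomp Require Import ring lra zify.
Set Implicit Arguments.
Unset Strict Implicit.
Unset Printing Implicit Defensive.
Import Order.TTheory GRing.Theory Num.Theory.
Import numFieldNormedType.Exports.
Local Open Scope classical_set_scope.
Local Open Scope ring_scope.

(** A complete space E of class Int(l^0, l^q) enters the proof through three
    properties. First, the operators that contract both l^0 and l^q are
    uniformly bounded on E ([contractions_uniformly_bounded]): otherwise, worse
    and worse ones could be put side by side as diagonal blocks of one unbounded
    contraction. So E is symmetric up to a constant, and the question whether T x
    is in E depends only on decreasing rearrangements. Secondly, the index s of E
    controls sums: N copies of x, or N unit vectors, cost at most N^(1/s)
    ([N_sum_powR]), and a series in E converges as soon as the s-th powers of the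
    quasi-norms do ([N_series_powR]). Testing this on indicators gives s <= q
    ([index_le_exponent]), so that p < s implies p < q, and the unit vectors give
    the inclusion of l^p in E. Thirdly, E is contained in l^q.

    The heart of the matter is that an operator T bounded on l^p and on l^q, with
    p < s, is bounded on E. There are three cases.

    For q <= 1 ([bounded_interpolation_le1]) the columns of the matrix of T are
    bounded in l^p, so that the m-th largest entry of each column is at most a
    constant times m^(-1/p). Keeping only this entry of each column gives an
    operator S_m with at most one nonzero entry in each column, hence a contraction of l^0 and, as q <= 1,
    an operator on l^q whose norm is bounded by its largest entry. Thus the norm
    of S_m on E is O(m^(-1/p)), and the sum over m converges because s / p > 1.

    For 1 <= q < +oo ([bounded_interpolation_ge1]) such a splitting of the matrix
    is not available, and the argument depends on x, which may be taken
    nonincreasing. Cutting x at rank n and using T on l^p for the first n terms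
    and on l^q for the others bounds the l^q tails of the rearrangement of T x by
    those of a majorant w of the running l^p averages of x ([tail_image_le]). The
    majorant is a series of dilations of x by powers of 2, which converges in E
    since p < s ([averaging_majorant]). Finally, a sequence y whose tails are
    dominated by the tails of w is the image of w under a contraction of l^0 and
    l^q, up to a constant ([tail_transport]), whence T x is in E with the required
    bound.

    For q = +oo ([bounded_interpolation_infinite]) the same estimate of the
    rearrangement of T x is pointwise, provided that E is contained in c_0;
    otherwise E is l^oo with an equivalent quasi-norm.

    The converse implications concern T alone. An operator bounded on l^0 and l^q
    is bounded on l^p for small p, because its columns have boundedly many
    bounded entries ([bounded_operators_zero_p]), and an operator bounded on l^p
    and l^oo is bounded on l^q by Marcinkiewicz interpolation
    ([bounded_operators_p_inf]). *)

(** * The norms of the sequence spaces, through modulars *)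

Definition phi (R : realType) (r t : R) : R :=
  if r == 0 then (t != 0)%:R else `|t| `^ r.

(** The modular: the r-th power of the l^r quasi-norm for r > 0, and the size of
    the support for r = 0. *)
Definition mass (R : realType) (r : R) (x : nat -> R) : \bar R :=
  (\sum_(0 <= k <oo) (phi r (x k))%:E)%E.

Section modular.
Context {R : realType}.
Implicit Types (r t s : R) (x y : nat -> R).

Lemma phi_ge0 r t : 0 <= phi r t.
Proof. by rewrite /phi; case: ifP => _ //; rewrite ?powR_ge0. Qed.

Lemma phiE r t : 0 < r -> phi r t = `|t| `^ r.
Proof. by move=> r0; rewrite /phi gt_eqF. Qed.

Lemma phi00 r : phi r 0 = 0.
Proof.
rewrite /phi eqxx normr0; case: ifPn => // r0.
by rewrite powR0.
Qed.

Lemma phi_mono r s t : 0 <= r -> `|s| <= `|t| -> phi r s <= phi r t.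
Proof.
move=> r0 st; rewrite /phi; case: ifPn => _.
  rewrite ler_nat; have [t0|t0] := eqVneq t 0; last by case: (s != 0).
  by move: st; rewrite t0 normr0 normr_le0 => /eqP ->; rewrite eqxx.
by apply: ge0_ler_powR => //; rewrite nnegrE.
Qed.

Lemma phi_norm r t : phi r `|t| = phi r t.
Proof. by rewrite /phi normr_eq0 normr_id. Qed.

Lemma phiM r a t : 0 < r -> phi r (a * t) = `|a| `^ r * phi r t.
Proof. by move=> r0; rewrite !phiE// normrM powRM. Qed.

Lemma phi0M a t : phi 0 (a * t) <= phi 0 t.
Proof.
by rewrite /phi eqxx mulf_eq0 negb_or; case: (t != 0); rewrite ?andbF// andbT;
  case: (a != 0).
Qed.

Lemma phi0_le1 t : phi (0 : R) t <= 1.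
Proof. by rewrite /phi eqxx; case: (t != 0). Qed.

Lemma phi_eq0 r t : phi r t = 0 -> t = 0.
Proof.
rewrite /phi; case: ifPn => _.
  by case: eqP => //= _ /eqP; rewrite oner_eq0.
by move/powR_eq0_eq0 => /eqP; rewrite normr_eq0 => /eqP.
Qed.

Lemma ge0_ler_powRE r (a b : R) : 0 < r -> 0 <= a -> 0 <= b ->
  (a `^ r <= b `^ r) = (a <= b).
Proof.
move=> r0 a0 b0; apply/idP/idP => [|ab].
  by apply: contraTT; rewrite -!ltNge => ba; apply: gt0_ltr_powR.
by apply: ge0_ler_powR => //; rewrite ?nnegrE// ltW.
Qed.

Lemma powRVK r (a : R) : r != 0 -> 0 <= a -> (a `^ r^-1) `^ r = a.
Proof. by move=> r0 a0; rewrite -powRrM mulVf// powRr1. Qed.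

Lemma powRKV r (a : R) : r != 0 -> 0 <= a -> (a `^ r) `^ r^-1 = a.
Proof. by move=> r0 a0; rewrite -powRrM mulfV// powRr1. Qed.

Lemma mass_ge0 r x : (0 <= mass r x)%E.
Proof. by apply: nneseries_ge0 => k _ _; rewrite lee_fin phi_ge0. Qed.

Lemma mass_partial r x m n :
  ((\sum_(m <= k < n) phi r (x k))%:E <= mass r x)%E.
Proof.
rewrite -sumEFin.
apply: (@le_trans _ _ (\sum_(0 <= k < n) (phi r (x k))%:E)%E); last first.
  by apply: nneseries_lim_ge => k _ _; rewrite lee_fin phi_ge0.
have [mn|nm] := leqP m n.
  rewrite [leRHS](big_cat_nat _ mn)//= leeDr//.
  by apply: sume_ge0 => k _; rewrite lee_fin phi_ge0.
rewrite big_geq ?(ltnW nm)//.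
by apply: sume_ge0 => k _; rewrite lee_fin phi_ge0.
Qed.

Lemma mass_le r x (M : R) :
  (forall n, \sum_(0 <= k < n) phi r (x k) <= M) -> (mass r x <= M%:E)%E.
Proof.
move=> xM; apply: lime_le.
  by apply: is_cvg_nneseries => k _ _; rewrite lee_fin phi_ge0.
by apply: nearW => n; rewrite sumEFin lee_fin.
Qed.

Lemma mass_mono r x y : 0 <= r -> (forall k, `|x k| <= `|y k|) ->
  (mass r x <= mass r y)%E.
Proof.
move=> r0 xy; apply: lee_nneseries => k _; first by move=> _; rewrite lee_fin phi_ge0.
by rewrite lee_fin phi_mono.
Qed.

Lemma mass0 r : mass r (0 : nat -> R) = 0%E.
Proof. by apply: eseries0 => k _ _; rewrite phi00. Qed.

Lemma phi_le_mass r x k : ((phi r (x k))%:E <= mass r x)%E.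
Proof. by have := mass_partial r x k k.+1; rewrite big_nat1. Qed.

Lemma mass_fineK r x : (mass r x < +oo)%E -> (fine (mass r x))%:E = mass r x.
Proof. by move=> xoo; rewrite fineK// ge0_fin_numE// mass_ge0. Qed.

Lemma coord_le_mass r x k (M : R) : 0 < r -> 0 <= M ->
  (mass r x <= (M `^ r)%:E)%E -> `|x k| <= M.
Proof.
move=> r0 M0 xM; rewrite -(ge0_ler_powRE r0)//.
by rewrite -lee_fin -phiE// (le_trans (phi_le_mass _ _ _)).
Qed.

Lemma massM r a x : 0 < r -> mass r (a \*o x) = ((`|a| `^ r)%:E * mass r x)%E.
Proof.
move=> r0; rewrite /mass -nneseriesZl; last by move=> k _; rewrite lee_fin phi_ge0.
by apply: eq_eseriesr => k _; rewrite /= phiM// EFinM.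
Qed.

Lemma mass0M a x : (mass 0 (a \*o x) <= mass 0 x)%E.
Proof.
apply: lee_nneseries => k _; first by move=> _; rewrite lee_fin phi_ge0.
by rewrite lee_fin phi0M.
Qed.

Lemma ell_norm_mass0 x : ell_norm 0%E x = mass 0 x.
Proof.
rewrite /ell_norm eqxx.
have -> : counting [set k | x k != 0] =
    (\int[counting]_(k in setT) (\1_[set k | x k != 0] k)%:E)%E :> \bar R.
  by rewrite integral_indic// setIT.
rewrite ge0_integral_count; last by move=> k; rewrite lee_fin indicE.
apply: eq_eseriesr => k _; rewrite /phi eqxx indicE; congr (_%:R%:E).
by rewrite mem_setE.
Qed.

Lemma ell_norm_mass r x : 0 < r ->
  ell_norm r%:E x = (mass r x `^ r^-1)%E.
Proof.
move=> r0; rewrite /ell_norm eqe gt_eqF// Lnorm_counting//.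
by congr (_ `^ _)%E; apply: eq_eseriesr => k _; rewrite phiE.
Qed.

Lemma ell_norm_ge0 (q : \bar R) x : (0 <= ell_norm q x)%E.
Proof.
rewrite /ell_norm; case: ifP => _; last exact: Lnorm_ge0.
exact: (@measure_ge0 _ _ _ (@counting nat R)).
Qed.

Lemma ell_norm_inf_le x (M : \bar R) :
  (ell_norm +oo%E x <= M)%E <-> forall k, (`|x k|%:E <= M)%E.
Proof.
have poo : (0 < (@counting nat R) setT)%E.
  rewrite /counting; case: asboolP => [fT|_]; last exact: ltry.
  by have := infinite_nat fT.
rewrite /ell_norm /= unlock poo; split=> [/ess_supP [A [mA A0 sA]] k|xM].
  have A00 : A = set0.
    have : counting A = 0%E :> \bar R by exact: A0.
    rewrite /counting; case: ifPn => // /asboolP fA [] /eqP.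
    by rewrite pnatr_eq0 finmap.cardfs_eq0 => /eqP /(fset_set_set0 fA).
  apply: contrapT => Nk; have : A k by exact: (sA k).
  by rewrite A00.
by apply/ess_supP; apply: aeW => k; exact: xM.
Qed.

Lemma carrier_mass r x : 0 <= r ->
  carrier (ell r%:E) x <-> (mass r x < +oo)%E.
Proof.
rewrite le_eqVlt => /orP[/eqP <-|r0] /=; first by rewrite ell_norm_mass0.
rewrite ell_norm_mass//; split; last exact: poweR_lty.
by apply: lty_poweRy; rewrite gt_eqF ?invr_gt0.
Qed.

Lemma carrier_inf x :
  carrier (ell +oo%E) x <-> exists2 M : R, 0 <= M & forall k, `|x k| <= M.
Proof.
rewrite /=; split.
  have := ell_norm_ge0 +oo%E x.
  case E : (ell_norm +oo%E x) => [M| |]// M0 _; exists M => // k.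
  by rewrite -lee_fin; move: k; apply/ell_norm_inf_le; rewrite E.
move=> [M M0 xM]; apply: (@le_lt_trans _ _ M%:E); last exact: ltry.
by apply/ell_norm_inf_le => k; rewrite lee_fin.
Qed.

End modular.

Section bounded_on_ell.
Context {R : realType}.
Implicit Types (r : R) (x : nat -> R) (T : (nat -> R) -> (nat -> R)).

Let expo r : R := if r == 0 then 1 else r^-1.

Let expo_gt0 r : 0 <= r -> 0 < expo r.
Proof.
by move=> r0; rewrite /expo; case: ifPn => // ?; rewrite invr_gt0 lt_neqAle eq_sym r0 andbT.
Qed.

Let qnorm_ell r x : 0 <= r -> qnorm (ell r%:E) x = fine (mass r x) `^ expo r.
Proof.
rewrite le_eqVlt /expo => /orP[/eqP <-|r0] /=.
  by rewrite ell_norm_mass0 eqxx powRr1// fine_ge0// mass_ge0.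
by rewrite ell_norm_mass// fine_poweR gt_eqF.
Qed.

Lemma mass_gt0 r x : x <> 0 -> (0 < mass r x)%E.
Proof.
move=> x0; rewrite lt_neqAle mass_ge0 andbT eq_sym; apply/negP => /eqP m0.
apply: x0; apply/funext => k; apply: (@phi_eq0 _ r); apply/eqP.
by rewrite eq_le phi_ge0 andbT -lee_fin (le_trans (phi_le_mass _ _ _))// m0.
Qed.

Lemma bounded_map_massP r T : 0 <= r -> T 0 = 0 ->
  bounded_map (ell r%:E) T <->
  exists2 C : R, 0 <= C & forall x, (mass r x < +oo)%E ->
    (mass r (T x) <= C%:E * mass r x)%E.
Proof.
move=> r0 T0; have e0 := expo_gt0 r0; split.
  move=> [TE [C CT]]; pose D := Num.max C 0.
  have D0 : 0 <= D by rewrite le_max lexx orbT.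
  exists (D `^ (expo r)^-1); first exact: powR_ge0.
  move=> x xr; have [->|/eqP x0] := eqVneq x 0.
    by rewrite T0 mass0 mule0.
  have cx : carrier (ell r%:E) x by apply/carrier_mass.
  have Txr : (mass r (T x) < +oo)%E by apply/(carrier_mass _ r0); exact: TE.
  have xp : 0 < fine (mass r x) by rewrite fine_gt0// xr mass_gt0.
  have m0 : 0 <= fine (mass r (T x)) by rewrite fine_ge0// mass_ge0.
  rewrite -(mass_fineK xr) -(mass_fineK Txr) -EFinM lee_fin.
  rewrite -(ge0_ler_powRE e0)//; last by rewrite mulr_ge0 ?powR_ge0// ltW.
  rewrite powRM ?powR_ge0 ?(ltW xp)// powRVK//; last by rewrite gt_eqF.
  rewrite -ler_pdivrMr ?powR_gt0//.
  by have := CT x cx x0; rewrite !qnorm_ell// => h; rewrite (le_trans h)// le_max lexx.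
move=> [C C0 CT]; split.
  move=> x /(carrier_mass _ r0) xr; apply/(carrier_mass _ r0).
  by rewrite (le_lt_trans (CT x xr))// -(mass_fineK xr) -EFinM ltry.
exists (C `^ expo r) => x /(carrier_mass _ r0) xr x0.
have xp : 0 < fine (mass r x) by rewrite fine_gt0// xr mass_gt0.
have CTx := CT x xr.
have Txr : (mass r (T x) < +oo)%E.
  by rewrite (le_lt_trans CTx)// -(mass_fineK xr) -EFinM ltry.
rewrite !qnorm_ell// ler_pdivrMr ?powR_gt0// -powRM// ?(ltW xp)//.
rewrite ge0_ler_powRE// ?mulr_ge0// ?(ltW xp)// ?fine_ge0 ?mass_ge0//.
by rewrite -lee_fin EFinM !mass_fineK.
Qed.

Lemma ell_norm_fineK (q : \bar R) x : carrier (ell q) x ->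
  (fine (ell_norm q x))%:E = ell_norm q x.
Proof. by move=> xq; rewrite fineK// ge0_fin_numE// ell_norm_ge0. Qed.

Lemma bounded_map_infP T : T 0 = 0 ->
  bounded_map (ell +oo%E) T <->
  exists2 C : R, 0 <= C & forall x (M : R), (forall k, `|x k| <= M) ->
    forall k, `|T x k| <= C * M.
Proof.
move=> T0; split.
  move=> [TE [C CT]]; pose D := Num.max C 0.
  have D0 : 0 <= D by rewrite le_max lexx orbT.
  exists D => // x M xM k.
  have M0 : 0 <= M := le_trans (normr_ge0 _) (xM 0%N).
  have [->|/eqP x0] := eqVneq x 0; first by rewrite T0 normr0 mulr_ge0.
  have cx : carrier (ell +oo%E) x by apply/carrier_inf; exists M.
  have cTx := TE _ cx.
  have xp : 0 < fine (ell_norm +oo%E x).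
    rewrite lt_neqAle fine_ge0 ?ell_norm_ge0// andbT eq_sym; apply/negP => /eqP m0.
    apply: x0; apply/funext => j; apply/eqP; rewrite -normr_le0 -lee_fin.
    by move: j; apply/ell_norm_inf_le; rewrite -ell_norm_fineK// m0.
  have xfM : fine (ell_norm +oo%E x) <= M.
    by rewrite -lee_fin ell_norm_fineK//; apply/ell_norm_inf_le => j; rewrite lee_fin.
  apply: (@le_trans _ _ (D * fine (ell_norm +oo%E x))); last exact: ler_wpM2l.
  apply: (@le_trans _ _ (fine (ell_norm +oo%E (T x)))).
    rewrite -lee_fin; move: k; apply/ell_norm_inf_le.
    by rewrite ell_norm_fineK.
  rewrite -ler_pdivrMr//.
  by have := CT x cx x0; rewrite /= => h; rewrite (le_trans h)// le_max lexx.
move=> [C C0 CT]; split.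
  move=> x /carrier_inf [M M0 xM]; apply/carrier_inf.
  by exists (C * M); rewrite ?mulr_ge0//; exact: CT.
exists C => x cx x0 /=.
have xp : 0 < fine (ell_norm +oo%E x).
  rewrite lt_neqAle fine_ge0 ?ell_norm_ge0// andbT eq_sym; apply/negP => /eqP m0.
  apply: x0; apply/funext => j; apply/eqP; rewrite -normr_le0 -lee_fin.
  by move: j; apply/ell_norm_inf_le; rewrite -ell_norm_fineK// m0.
rewrite ler_pdivrMr//.
have xl k : `|x k| <= fine (ell_norm +oo%E x).
  by rewrite -lee_fin; move: k; apply/ell_norm_inf_le; rewrite ell_norm_fineK.
have : (ell_norm +oo%E (T x) <= (C * fine (ell_norm +oo%E x))%:E)%E.
  by apply/ell_norm_inf_le => k; rewrite lee_fin; exact: CT.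
have := ell_norm_ge0 +oo%E (T x).
by case: (ell_norm +oo%E (T x)).
Qed.

Lemma linear_on0 (q : \bar R) T : carrier (ell q) 0 ->
  linear_on (carrier (ell q)) T -> T 0 = 0.
Proof.
move=> c0 /(_ 1 0 0 c0 c0).
have -> : (1 : R) \*o (0 : nat -> R) + 0 = 0.
  by apply/funext => k; rewrite !fctE /= mulr0 addr0.
have -> : (1 : R) \*o T 0 = T 0 by apply/funext => k /=; rewrite mul1r.
by move/eqP; rewrite -subr_eq0 opprD addNKr oppr_eq0 => /eqP.
Qed.

Lemma carrier_ell0 (q : \bar R) : (0 <= q)%E -> carrier (ell q) (0 : nat -> R).
Proof.
case: q => [r| |]//; rewrite ?lee_fin => r0.
  by apply/carrier_mass => //; rewrite mass0 ltry.
by apply/carrier_inf; exists 0 => // k; rewrite normr0.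
Qed.

End bounded_on_ell.

(** * Quasi-Banach sequence spaces *)

Section nonneg_series.
Context {R : realType}.

Lemma tail_small (a : nat -> R) (A : R) : (forall k, 0 <= a k) ->
  (forall n, \sum_(0 <= k < n) a k <= A) ->
  forall e : R, 0 < e -> exists n0 : nat, forall n m, (n0 <= n)%N ->
    \sum_(n <= k < m) a k < e.
Proof.
move=> a0 aA e e0.
have nd : nondecreasing_seq (fun n => \sum_(0 <= k < n) a k).
  apply/nondecreasing_seqP => n; rewrite big_nat_recr//= lerDl//.
have cv : cvgn (fun n => \sum_(0 <= k < n) a k).
  apply: nondecreasing_is_cvgn => //; exists A => _ [n _ <-]; exact: aA.
have leL := nondecreasing_cvgn_le nd cv.
move/cvgrPdist_lt : cv => /(_ _ e0) [n0 _ n0P].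
exists n0 => n m n0n; have [nm|/ltnW mn] := leqP n m; last by rewrite big_geq.
have := n0P n n0n; have := leL n; have := leL m; rewrite (big_cat_nat _ nm)//=.
set L := limn _; set s := bigop _ _ _; set t := bigop _ _ _ => h1 h2.
by rewrite ger0_norm ?subr_ge0// => h3; lra.
Qed.

End nonneg_series.

Section quasi_banach_facts.
Context {R : realType} (E : seqSpace R) (hE : quasi_banach E).
Implicit Types (x y : nat -> R) (a : R).

Lemma E_lin a x y : carrier E x -> carrier E y -> carrier E (a \*o x + y).
Proof. by case: hE => -[_ +] _ _; apply. Qed.

Lemma E_zero : carrier E 0.
Proof. by case: hE => -[]. Qed.

Lemma E_scale a x : carrier E x -> carrier E (a \*o x).
Proof. by move=> xE; have := E_lin a xE E_zero; rewrite addr0. Qed.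

Lemma mull1 x : 1 \*o x = x.
Proof. by apply/funext => k /=; rewrite mul1r. Qed.

Lemma mullN1 x : (-1) \*o x = - x.
Proof. by apply/funext => k; rewrite fctE /= mulN1r. Qed.

Lemma E_add x y : carrier E x -> carrier E y -> carrier E (x + y).
Proof. by move=> xE yE; have := E_lin 1 xE yE; rewrite mull1. Qed.

Lemma E_sub x y : carrier E x -> carrier E y -> carrier E (x - y).
Proof. by move=> xE yE; rewrite addrC -mullN1; exact: E_lin. Qed.

Lemma E_sum (u : nat -> nat -> R) m n : (forall i, carrier E (u i)) ->
  carrier E (\sum_(m <= i < n) u i).
Proof.
by move=> uE; elim/big_rec: _ => [|i x _ xE]; [exact: E_zero|exact: E_add].
Qed.

Lemma N_ge0 x : carrier E x -> 0 <= qnorm E x.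
Proof. by case: hE => _ [+ _ _ _] _; apply. Qed.

Lemma N_scale a x : carrier E x -> qnorm E (a \*o x) = `|a| * qnorm E x.
Proof. by case: hE => _ [_ _ + _] _; apply. Qed.

Lemma N_zero : qnorm E 0 = 0.
Proof.
have := N_scale 0 E_zero; rewrite normr0 mul0r => <-; congr qnorm.
by apply/funext => k; rewrite /= mul0r.
Qed.

Lemma N_gt0 x : carrier E x -> x <> 0 -> 0 < qnorm E x.
Proof.
move=> xE x0; rewrite lt_neqAle N_ge0// andbT eq_sym; apply/eqP => Nx0.
by apply: x0; case: hE => _ [_ + _ _] _; apply.
Qed.

Lemma N_opp x : carrier E x -> qnorm E (- x) = qnorm E x.
Proof. by move=> xE; rewrite -mullN1 N_scale// normrN1 mul1r. Qed.

Lemma N_add : exists2 K : R, 1 <= K & forall x y, carrier E x -> carrier E y ->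
  qnorm E (x + y) <= K * (qnorm E x + qnorm E y).
Proof.
case: hE => _ [_ _ _ [C CP]] _; exists (Num.max C 1); first by rewrite le_max lexx orbT.
move=> x y xE yE; rewrite (le_trans (CP x y xE yE))//.
by rewrite ler_wpM2r ?addr_ge0 ?N_ge0// le_max lexx.
Qed.

Lemma bounded_mapE T : T 0 = 0 -> bounded_map E T ->
  exists2 C : R, 0 <= C & forall x, carrier E x ->
    carrier E (T x) /\ qnorm E (T x) <= C * qnorm E x.
Proof.
move=> T0 [TE [C CT]]; exists (Num.max C 0); first by rewrite le_max lexx orbT.
move=> x xE; split; first exact: TE.
have [->|/eqP x0] := eqVneq x 0; first by rewrite T0 N_zero mulr0.
rewrite -ler_pdivrMr ?N_gt0//.
by rewrite (le_trans (CT _ xE x0))// le_max lexx.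
Qed.

Lemma bounded_map_intro T (C : R) :
  (forall x, carrier E x -> carrier E (T x) /\ qnorm E (T x) <= C * qnorm E x) ->
  bounded_map E T.
Proof.
move=> TC; split=> [x /TC []//|]; exists C => x xE x0.
by rewrite ler_pdivrMr ?N_gt0//; have [] := TC x xE.
Qed.

(** The subadditive functional provided by the index makes the s-th power of the
    quasi-norm subadditive up to a constant that does not depend on the number of
    terms. *)
Lemma N_sum_powR (s : R) : aoki_rolewicz_index E s ->
  exists2 K : R, 0 < K & forall (u : nat -> nat -> R) m n,
    (forall i, carrier E (u i)) ->
    qnorm E (\sum_(m <= i < n) u i) `^ s <= K * \sum_(m <= i < n) qnorm E (u i) `^ s.
Proof.
move=> [s0 [F [Fadd [c [C [c0 C0 FP]]]]]]; exists (C / c); first exact: divr_gt0.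
move=> u m n uE; have [nm|mn] := leqP n m.
  by rewrite !big_geq// N_zero powR0 ?gt_eqF// mulr0.
rewrite mulrAC ler_pdivlMr// mulrC.
apply: (@le_trans _ _ (F (\sum_(m <= i < n) u i))).
  by have /FP/andP[] : carrier E (\sum_(m <= i < n) u i) by exact: E_sum.
apply: (@le_trans _ _ (\sum_(m <= i < n) F (u i))); last first.
  by rewrite mulr_sumr ler_sum// => i _; have /FP/andP[] := uE i.
rewrite -(subnKC mn); elim: (n - m.+1)%N => [|d IH].
  by rewrite addn0 !big_nat1.
rewrite addnS !(big_nat_recr (m.+1 + d))/= ?(leq_trans (leqnSn m)) ?leq_addr//.
by rewrite (le_trans (Fadd _ _ _ _)) ?lerD2r//; exact: E_sum.
Qed.

End quasi_banach_facts.

Section included_space.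
Context {R : realType} (E : seqSpace R) (hE : quasi_banach E).
Context (q : \bar R) (q0 : (0 < q)%E) (EQ : continuous_inclusion E (ell q)).

Lemma ell_normM (a : R) (x : nat -> R) :
  ell_norm q (a \*o x) = (`|a|%:E * ell_norm q x)%E.
Proof.
case: q q0 => [r| |]// r0.
  rewrite lte_fin in r0; rewrite !ell_norm_mass// massM//.
  rewrite poweRM ?lee_fin ?powR_ge0 ?mass_ge0// poweR_EFin.
  by rewrite powRKV ?gt_eqF.
have le (b : R) (y : nat -> R) :
    (ell_norm +oo%E (b \*o y) <= `|b|%:E * ell_norm +oo%E y)%E.
  apply/ell_norm_inf_le => k /=; rewrite normrM EFinM.
  by rewrite lee_wpmul2l ?lee_fin//; move: k; apply/ell_norm_inf_le.
apply/eqP; rewrite eq_le le /=.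
have [->|a0] := eqVneq a 0; first by rewrite normr0 mul0e ell_norm_ge0.
have := le a^-1 (a \*o x).
have -> : a^-1 \*o (a \*o x) = x by apply/funext => k /=; rewrite mulKf.
rewrite normfV => h.
have := lee_wpmul2l (_ : 0 <= `|a|%:E)%E h; rewrite lee_fin => /(_ (normr_ge0 _)).
by rewrite muleA -EFinM mulfV ?mul1e// normr_eq0.
Qed.

Lemma ell_norm_le_N : exists2 C : R, 0 < C & forall x, carrier E x ->
  (ell_norm q x <= (C * qnorm E x)%:E)%E.
Proof.
case: EQ => EQc /(_ 0 (E_zero hE) 1 ltr01) [d d0 dP].
exists (2 / d); first by rewrite divr_gt0.
move=> x xE; have [->|/eqP x0] := eqVneq x 0.
  rewrite N_zero// mulr0.
  have := ell_normM 0 0; rewrite normr0 mul0e.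
  have -> : 0 \*o (0 : nat -> R) = 0 by apply/funext => k /=; rewrite mul0r.
  by move=> ->.
have Nx := N_gt0 hE xE x0.
pose b : R := d / 2 / qnorm E x.
have b0 : 0 < b by rewrite !divr_gt0.
have := dP (b \*o x) (E_scale hE _ xE); rewrite subr0 N_scale// gtr0_norm//.
have -> : b * qnorm E x = d / 2 by rewrite /b divfK// gt_eqF.
move=> /(_ ltac:(lra)) /=.
have := EQc _ xE; rewrite ell_normM gtr0_norm// => /ell_norm_fineK <-.
rewrite lee_fin /= => bX.
have -> : 2 / d * qnorm E x = b^-1 by rewrite /b !invf_div; field; rewrite !gt_eqF.
by rewrite -[b^-1]mul1r ler_pdivlMr// mulrC ltW.
Qed.

End included_space.

Section inclusions.
Context {R : realType}.
Implicit Types (r : R) (x y : nat -> R).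

Lemma ell_norm_leP r x (M : R) : 0 < r -> 0 <= M ->
  (ell_norm r%:E x <= M%:E)%E <-> (mass r x <= (M `^ r)%:E)%E.
Proof.
move=> r0 M0; rewrite ell_norm_mass//; have := mass_ge0 r x.
case: (mass r x) => [m| |]//=; last by rewrite invr_eq0 gt_eqF.
rewrite !lee_fin => m0.
by rewrite -[in X in _ <-> X](powRVK (lt0r_neq0 r0) m0) ge0_ler_powRE ?powR_ge0.
Qed.

Lemma powR_normD_le r (a b : R) : 0 <= r ->
  `|a + b| `^ r <= 2 `^ r * (`|a| `^ r + `|b| `^ r).
Proof.
move=> r0; wlog ab : a b / `|a| <= `|b|.
  move=> H; have [/H//|/ltW/H] := leP `|a| `|b|.
  by rewrite addrC [X in 2 `^ r * X]addrC.
apply: (@le_trans _ _ ((2 * `|b|) `^ r)).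
  apply: ge0_ler_powR => //; rewrite ?nnegrE ?mulr_ge0//.
  by rewrite (le_trans (ler_normD _ _))// mulr_natl mulr2n lerD2r.
by rewrite powRM// ler_wpM2l ?powR_ge0// lerDr powR_ge0.
Qed.

Lemma mass_sub_lty r x y : 0 <= r -> (mass r x < +oo)%E -> (mass r y < +oo)%E ->
  (mass r (x - y)%R < +oo)%E.
Proof.
move=> r0 xr yr.
apply: (@le_lt_trans _ _ ((2 `^ r)%:E * (mass r x + mass r y))%E); last first.
  by rewrite -(mass_fineK xr) -(mass_fineK yr) -EFinD -EFinM ltry.
rewrite /mass -nneseriesD; [|by move=> k _ _; rewrite lee_fin phi_ge0..].
rewrite -nneseriesZl; last by move=> k _; rewrite -EFinD lee_fin addr_ge0 ?phi_ge0.
apply: lee_nneseries => k _; first by move=> _; rewrite lee_fin phi_ge0.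
rewrite -EFinD -EFinM lee_fin; move: r0; rewrite le_eqVlt => /orP[/eqP <-|r0].
  rewrite powRr0 mul1r /phi eqxx !fctE; case: (eqVneq (x k) 0) => [->|_].
    by rewrite add0r oppr_eq0 lerDr ler0n.
  rewrite (@le_trans _ _ 1)//; first by rewrite -[leRHS]/(1%:R) ler_nat leq_b1.
  by rewrite lerDl ler0n.
rewrite !phiE// -[`|y k|]normrN.
by have := powR_normD_le (x k) (- y k) (ltW r0); rewrite !fctE.
Qed.

Lemma continuous_inclusion_intro (X Y : seqSpace R) (C : R) :
  (forall x y, carrier X x -> carrier X y -> carrier X (y - x)) ->
  (forall x, carrier X x ->
    [/\ carrier Y x, 0 <= qnorm X x & qnorm Y x <= C * qnorm X x]) ->
  continuous_inclusion X Y.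
Proof.
move=> Xsub XY; split=> [x /XY []//|x xX e e0].
have D0 : 0 < Num.max C 1 by rewrite lt_max ltr01 orbT.
exists (e / Num.max C 1); first exact: divr_gt0.
move=> y yX; rewrite ltr_pdivlMr// => h.
have [_ n0 hY] := XY _ (Xsub _ _ xX yX).
apply: le_lt_trans h.
by rewrite (le_trans hY)// mulrC ler_wpM2l// le_max lexx.
Qed.

End inclusions.

Section series_in_space.
Context {R : realType} (E : seqSpace R) (hE : quasi_banach E).
Context (q : \bar R) (q0 : (0 < q)%E) (EQ : continuous_inclusion E (ell q)).

Lemma coord_le_N : exists2 C : R, 0 < C & forall x k, carrier E x ->
  `|x k| <= C * qnorm E x.
Proof.
have [C C0 CP] := ell_norm_le_N hE q0 EQ; exists C => // x k xE.
have CN0 : 0 <= C * qnorm E x by rewrite mulr_ge0 ?(ltW C0)// N_ge0.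
have := CP x xE; case: q q0 => [r| |]// r0.
  move=> /(ell_norm_leP _ r0 CN0); exact: coord_le_mass.
by move=> /ell_norm_inf_le /(_ k); rewrite lee_fin.
Qed.

Lemma sub_ell_inf : continuous_inclusion E (ell +oo%E).
Proof.
have [C C0 CP] := coord_le_N.
apply: (@continuous_inclusion_intro _ _ _ C).
  by move=> x y xE yE; exact: (E_sub hE).
move=> x xE; have N0 := N_ge0 hE xE.
have xoo : carrier (ell +oo%E) x.
  by apply/carrier_inf; exists (C * qnorm E x); [exact: mulr_ge0 (ltW _) _|move=> k; exact: CP].
split=> //; rewrite -lee_fin /= ell_norm_fineK//.
by apply/ell_norm_inf_le => k; rewrite lee_fin CP.
Qed.

(** Completeness turns the inequality for finite sums into one for series; the
    sum is identified coordinatewise, as E embeds continuously in l^oo. *)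
Lemma N_series_powR (s : R) : aoki_rolewicz_index E s ->
  exists2 K : R, 0 < K & forall (u : nat -> nat -> R) (y : nat -> R) (a : nat -> R) (A : R),
    (forall i, carrier E (u i)) ->
    (forall i, qnorm E (u i) `^ s <= a i) ->
    (forall n, \sum_(0 <= i < n) a i <= A) ->
    (forall k, (fun n => \sum_(0 <= i < n) u i k) @ \oo --> y k) ->
    carrier E y /\ qnorm E y <= K * A `^ s^-1.
Proof.
move=> hs; have s0 : 0 < s by case: hs.
have [K1 K10 K1P] := N_sum_powR hE hs.
have [K2 K21 K2P] := N_add hE.
have K20 : 0 < K2 by lra.
have [C C0 CP] := coord_le_N.
exists (K2 * K1 `^ s^-1); first by rewrite mulr_gt0 ?powR_gt0.
move=> u y a A uE ua aA uy.
have a0 i : 0 <= a i by rewrite (le_trans _ (ua i)) ?powR_ge0.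
have A0 : 0 <= A by have := aA 0%N; rewrite big_geq.
pose S n : nat -> R := \sum_(0 <= i < n) u i.
have SE n : carrier E (S n) by exact: (E_sum hE).
have Nsum m n B : \sum_(m <= i < n) a i <= B ->
    qnorm E (\sum_(m <= i < n) u i) <= (K1 * B) `^ s^-1.
  move=> aB; have sE : carrier E (\sum_(m <= i < n) u i) by exact: (E_sum hE).
  have B0 : 0 <= B by rewrite (le_trans _ aB)// sumr_ge0.
  rewrite -(ge0_ler_powRE s0) ?(N_ge0 hE) ?powR_ge0// powRVK ?gt_eqF ?mulr_ge0 ?(ltW K10)//.
  rewrite (le_trans (K1P _ _ _ uE))// ler_wpM2l ?(ltW K10)//.
  by rewrite (le_trans _ aB)// ler_sum.
have cauchy e : 0 < e -> exists n0 : nat, forall m n : nat,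
    (n0 <= m)%N -> (n0 <= n)%N -> qnorm E (S m - S n) < e.
  move=> e0; have e1 : 0 < (e / 2) `^ s / K1 by rewrite divr_gt0// powR_gt0// divr_gt0.
  have [n0 n0P] := tail_small a0 aA e1; exists n0 => m n.
  wlog mn : m n / (m <= n)%N.
    move=> H n0m n0n; have [/H|/ltnW/H] := leqP m n; first exact.
    rewrite -opprB (N_opp hE); last exact: (E_sub hE).
    by move=> /(_ n0n n0m).
  move=> n0m _; rewrite -opprB (N_opp hE); last exact: (E_sub hE).
  rewrite /S (big_cat_nat _ mn)//= addrAC subrr add0r.
  rewrite (le_lt_trans (Nsum _ _ _ (ltW (n0P m n n0m))))//.
  by rewrite mulrCA mulfV ?gt_eqF// mulr1 powRKV ?gt_eqF ?divr_ge0 ?ltW//; lra.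
case: hE => _ _ /(_ S SE cauchy) [l lE Sl].
have yl : y = l.
  apply/funext => k; apply: (cvg_unique _ (uy k)) => //.
  apply/cvgrPdist_le => e e0.
  move/cvgrPdist_lt : Sl => /(_ (e / C)); rewrite divr_gt0// => /(_ isT) [n0 _ n0P].
  exists n0 => // n /n0P /=; rewrite sub0r normrN.
  rewrite ger0_norm ?(N_ge0 hE)//; last exact: (E_sub hE).
  rewrite ltr_pdivlMr// mulrC => /ltW; apply: le_trans.
  have -> : l k - \sum_(0 <= i < n) u i k = - (S n - l) k.
    by rewrite /S !fctE fct_sumE opprB.
  by rewrite normrN CP//; exact: (E_sub hE).
rewrite yl; split=> //; apply/ler_addgt0Pr => e e0.
move/cvgrPdist_lt : Sl => /(_ (e / K2)); rewrite divr_gt0// => /(_ isT) [n0 _ n0P].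
have := n0P n0 (leqnn _); rewrite /= sub0r normrN ger0_norm ?(N_ge0 hE)//; last exact: (E_sub hE).
move=> Sle.
have -> : l = (l - S n0) + S n0 by rewrite subrK.
rewrite (le_trans (K2P _ _ _ _))//; first exact: (E_sub hE).
rewrite -opprB (N_opp hE); last exact: (E_sub hE).
have h1 := Nsum 0%N n0 A (aA n0).
rewrite -mulrA -powRM// ?(ltW K10)// mulrDr addrC lerD//.
  by rewrite ler_wpM2l// ltW.
by move: Sle; rewrite ltr_pdivlMr// mulrC => /ltW.
Qed.

End series_in_space.

(** * Uniform boundedness of contractions *)

(** For q = +oo the suprema are compared through their upper bounds, and for
    finite q the modulars, so that q = 0 is covered too. *)
Definition size_le (R : realType) (q : \bar R) (x y : nat -> R) : Prop :=
  match q with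
  | r%:E => (mass r x <= mass r y)%E
  | _ => forall M : R, (forall k, `|y k| <= M) -> forall k, `|x k| <= M
  end.

Definition contraction (R : realType) (q : \bar R)
    (T : (nat -> R) -> (nat -> R)) : Prop :=
  [/\ linear_on (carrier (ell q)) T,
      forall x, carrier (ell q) x -> size_le q (T x) x
    & forall x, (mass 0 x < +oo)%E -> (mass 0 (T x) <= mass 0 x)%E].

Section gluing.
Context {R : realType}.
Implicit Types (q : \bar R) (x : nat -> R) (T : (nat -> R) -> (nat -> R)).

(** The n-th row of x, read as a double sequence through Cantor's pairing. *)
Definition slice n x : nat -> R := fun j => x (Cantor.to_nat (n, j)).

Definition coslice n x : nat -> R := fun k =>
  if (Cantor.of_nat k).1 == n then x (Cantor.of_nat k).2 else 0.

Definition glue (T : nat -> (nat -> R) -> (nat -> R)) x : nat -> R :=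
  fun k => T (Cantor.of_nat k).1 (slice (Cantor.of_nat k).1 x) (Cantor.of_nat k).2.

Lemma slice_glue (T : nat -> (nat -> R) -> (nat -> R)) n x : slice n (glue T x) = T n (slice n x).
Proof. by apply/funext => j; rewrite /slice /glue Cantor.cancel_of_to. Qed.

Lemma slice_coslice m n x : slice m (coslice n x) = if m == n then x else 0.
Proof.
by apply/funext => j; rewrite /slice /coslice Cantor.cancel_of_to/=; case: ifP.
Qed.

Lemma slice_inj x y : (forall n, slice n x = slice n y) -> x = y.
Proof.
move=> xy; apply/funext => k; rewrite -(Cantor.cancel_to_of k).
case: (Cantor.of_nat k) => n j; exact: (congr1 (fun f => f j) (xy n)).
Qed.

Lemma mass_slices (r : R) x : mass r x = (\sum_(0 <= n <oo) mass r (slice n x))%E.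
Proof.
have p0 t : (0 <= (phi r t)%:E)%E by rewrite lee_fin phi_ge0.
rewrite /mass nneseries_esumT//.
rewrite [RHS]nneseries_esumT; last by move=> n; exact: nneseries_ge0.
under [RHS]eq_esum do rewrite nneseries_esumT//.
rewrite esum_esum//.
apply: reindex_esum; split.
- by [].
- move=> p p' _ _ /(congr1 Cantor.of_nat); rewrite -!surjective_pairing.
  by rewrite !Cantor.cancel_of_to.
- move=> k _; exists (Cantor.of_nat k) => //.
  by rewrite -surjective_pairing Cantor.cancel_to_of.
Qed.

Lemma mass_slice_le (r : R) n x : (mass r (slice n x) <= mass r x)%E.
Proof.
rewrite [leRHS]mass_slices.
have := @nneseries_lim_ge _ (fun n => mass r (slice n x)) xpredT 0%N n.+1.
move=> /(_ (fun _ _ _ => mass_ge0 _ _)); apply: le_trans.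
by rewrite big_nat_recr//= leeDr// sume_ge0// => i _; exact: mass_ge0.
Qed.

Lemma mass_coslice (r : R) n x : mass r (coslice n x) = mass r x.
Proof.
rewrite mass_slices (nneseriesD1 (n := n))//; last by move=> k _; exact: mass_ge0.
rewrite slice_coslice eqxx eseries0 ?adde0// => k _ /negbTE kn.
by rewrite slice_coslice kn mass0.
Qed.

Lemma carrier_size_le q x y : (0 <= q)%E -> size_le q x y ->
  carrier (ell q) y -> carrier (ell q) x.
Proof.
case: q => [r| |]// r0 xy.
  rewrite lee_fin in r0.
  by move=> /(carrier_mass _ r0) yr; apply/(carrier_mass _ r0); exact: le_lt_trans yr.
by move=> /carrier_inf [M M0 yM]; apply/carrier_inf; exists M => //; exact: xy.
Qed.

Lemma size_le_slice q n x : size_le q (slice n x) x.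
Proof.
case: q => [r| |] /=; first exact: mass_slice_le.
  by move=> M xM k; exact: xM.
by move=> M xM k; exact: xM.
Qed.

Lemma size_le_coslice q n x : size_le q (coslice n x) x.
Proof.
have inf M : (forall k, `|x k| <= M) -> forall k, `|coslice n x k| <= M.
  move=> xM k; rewrite /coslice; case: ifP => _ //.
  by rewrite normr0 (le_trans _ (xM 0%N)).
by case: q => [r| |] //=; rewrite mass_coslice.
Qed.

Lemma contraction_bounded q T : (0 < q)%E -> contraction q T ->
  bounded_operators 0%E q T.
Proof.
move=> q0 [Tlin Tq T00].
have T0 : T 0 = 0 by apply: linear_on0 Tlin; exact/carrier_ell0/ltW.
split=> //; last first.
  apply/(bounded_map_massP (lexx 0) T0); exists 1 => // x x0.
  by rewrite mul1e T00.
move: q0 Tlin Tq; case: q => [r| |]// r0 Tlin Tq.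
  rewrite lte_fin in r0; apply/(bounded_map_massP (ltW r0) T0); exists 1 => // x xr.
  by rewrite mul1e; apply: Tq; apply/carrier_mass => //; exact: ltW.
apply/(bounded_map_infP T0); exists 1 => // x M xM k.
rewrite mul1r; apply: Tq => //; apply/carrier_inf; exists M => //.
exact: le_trans (xM 0%N).
Qed.

Lemma contraction_slice q n : contraction q (slice n).
Proof.
split=> [a x y _ _|x _|x _]; [by []|exact: size_le_slice|exact: mass_slice_le].
Qed.

Lemma contraction_coslice q n : contraction q (coslice n).
Proof.
split=> [a x y _ _|x _|x _]; [|exact: size_le_coslice|by rewrite mass_coslice].
apply/funext => k; rewrite !fctE /= /coslice.
by case: ifP => _; rewrite ?mulr0 ?addr0.
Qed.

Lemma contraction_glue q (T : nat -> (nat -> R) -> (nat -> R)) : (0 < q)%E ->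
  (forall n, contraction q (T n)) -> contraction q (glue T).
Proof.
move=> q0 Tc.
have sq n x : carrier (ell q) x -> carrier (ell q) (slice n x).
  exact/carrier_size_le/size_le_slice/ltW.
have mglue (r : R) x : (forall n, (mass r (T n (slice n x)) <= mass r (slice n x))%E) ->
    (mass r (glue T x) <= mass r x)%E.
  move=> Tx; rewrite [leLHS]mass_slices [leRHS]mass_slices.
  apply: lee_nneseries => n _; first by move=> _; exact: mass_ge0.
  by rewrite slice_glue.
split=> [a x y xq yq|x xq|x x0].
- apply: slice_inj => n; rewrite slice_glue; have [Tlin _ _] := Tc n.
  have -> : slice n (a \*o x + y) = a \*o slice n x + slice n y by [].
  by rewrite (Tlin _ _ _ (sq n x xq) (sq n y yq)) -!(slice_glue T).
- have Tcx n : size_le q (T n (slice n x)) (slice n x).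
    by have [_ + _] := Tc n; apply; exact: sq.
  move: Tcx; case: q q0 {Tc sq xq} => [r| |]//= r0 Tcx; first exact: mglue.
  move=> M xM k; rewrite /glue; apply: Tcx => j; exact: xM.
- apply: mglue => n; have [_ _] := Tc n; apply.
  exact: le_lt_trans (mass_slice_le _ _ _) x0.
Qed.

(** If no constant worked, operators with larger and larger constants could be
    placed as the diagonal blocks of one contraction on l^q = l^q(N x N), which
    would then be unbounded on E. *)
Lemma contractions_uniformly_bounded q (E : seqSpace R) : Int 0%E q E ->
  exists2 C : R, 0 < C & forall T, contraction q T -> forall x, carrier E x ->
    carrier E (T x) /\ qnorm E (T x) <= C * qnorm E x.
Proof.
move=> [/andP[_ q0] hE _ _ Tbd].
have cbd T : contraction q T -> exists C : R, 0 < C /\ forall x, carrier E x ->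
    carrier E (T x) /\ qnorm E (T x) <= C * qnorm E x.
  move=> Tc; have T0 : T 0 = 0.
    by have [Tlin _ _] := Tc; apply: linear_on0 Tlin; exact/carrier_ell0/ltW.
  have [C C0 CP] := bounded_mapE hE T0 (Tbd _ (contraction_bounded q0 Tc)).
  exists (C + 1); split; first by rewrite ltr_wpDl.
  move=> x xE; have [TxE TxN] := CP x xE; split=> //.
  by rewrite (le_trans TxN)// ler_wpM2r ?lerDl// (N_ge0 hE).
have [b bP] := choice (fun n => cbd _ (contraction_slice q n)).
have [a aP] := choice (fun n => cbd _ (contraction_coslice q n)).
apply: contrapT => Cno.
have bad (n : nat) : exists Tx : ((nat -> R) -> (nat -> R)) * (nat -> R),
    [/\ contraction q Tx.1, carrier E Tx.2 &
        n.+1%:R * a n * b n * qnorm E Tx.2 < qnorm E (Tx.1 Tx.2)].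
  apply: contrapT => ok; apply: Cno; exists (n.+1%:R * a n * b n).
    by have [a0 _] := aP n; have [b0 _] := bP n; rewrite !mulr_gt0.
  move=> T Tc x xE; have [C [_ CP]] := cbd _ Tc; have [TxE _] := CP x xE.
  split=> //; rewrite leNgt; apply/negP => Tx; apply: ok.
  by exists (T, x).
have [Tx TxP] := choice bad.
have glc : contraction q (glue (fun n => (Tx n).1)).
  by apply: contraction_glue => // n; have [] := TxP n.
have [C [C0 CP]] := cbd _ glc.
pose n := Num.truncn C.
have Cn : C < n.+1%:R by exact: truncnS_gt.
have [Tc xE] := TxP n; apply/negP; rewrite -leNgt.
have [a0 /(_ _ xE) [zE zN]] := aP n.
have [gE gN] := CP _ zE.
have [b0 /(_ _ gE) [_]] := bP n.
rewrite slice_glue slice_coslice eqxx => sN.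
rewrite (le_trans sN)//.
apply: (@le_trans _ _ (b n * (C * (a n * qnorm E (Tx n).2)))).
  by rewrite ler_wpM2l ?(ltW b0)// (le_trans gN)// ler_wpM2l ?(ltW C0).
rewrite mulrCA -!mulrA ler_pM ?(ltW C0) ?(ltW Cn)//.
  by rewrite !mulr_ge0 ?(ltW a0) ?(ltW b0)// (N_ge0 hE).
by rewrite mulrCA.
Qed.

End gluing.

(** * Sparse operators *)

Section sparse.
Context {R : realType}.
Implicit Types (r : R) (x y z c : nat -> R).

(** Column-sparse kernels: when every input coordinate k feeds at most one
    output coordinate j, summing the rows counts each input at most once. *)
Lemma mass_sparse r (I : nat -> nat -> bool) y z (c : R) : 0 <= c ->
  (forall k j j', I j k -> I j' k -> j = j') ->
  (forall j, ((phi r (y j))%:E <=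
     c%:E * \sum_(0 <= k <oo) (if I j k then phi r (z k) else 0)%:E)%E) ->
  (mass r y <= c%:E * mass r z)%E.
Proof.
move=> c0 Iinj yz.
have i0 j k : (0 <= (if I j k then phi r (z k) else 0)%:E)%E.
  by case: ifP => _; rewrite lee_fin// phi_ge0.
apply: (@le_trans _ _ (\sum_(0 <= j <oo)
    (c%:E * \sum_(0 <= k <oo) (if I j k then phi r (z k) else 0)%:E))%E).
  by apply: lee_nneseries => j _ //; rewrite lee_fin phi_ge0.
rewrite nneseriesZl; last by move=> j _; exact: nneseries_ge0.
rewrite lee_wpmul2l ?lee_fin//.
rewrite nneseries_interchange//.
apply: lee_nneseries => k _; first by move=> _; exact: nneseries_ge0.
have [[j0 Ij0]|noj] := pselect (exists j, I j k).
  rewrite (nneseriesD1 (n := j0))// Ij0 eseries0 ?adde0// => j _ jj0.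
  by case: ifP => // Ij; move/eqP : jj0; rewrite (Iinj _ _ _ Ij Ij0).
rewrite eseries0 ?lee_fin ?phi_ge0// => j _ _.
by case: ifP => // Ij; case: noj; exists j.
Qed.

(** A weighted injection of coordinates, written by pulling sequences back. *)
Definition winj c (f : nat -> nat) z : nat -> R := fun j => c j * z (f j).

Definition inj_where c (f : nat -> nat) : Prop :=
  forall j j', c j != 0 -> c j' != 0 -> f j = f j' -> j = j'.

Lemma mass_winj r c f z : 0 <= r -> (forall j, `|c j| <= 1) -> inj_where c f ->
  (mass r (winj c f z) <= mass r z)%E.
Proof.
move=> r0 c1 finj; rewrite -[leRHS]mul1e.
apply: (@mass_sparse _ (fun j k => (c j != 0) && (f j == k))) => //.
  by move=> k j j' /andP[cj /eqP fj] /andP[cj' /eqP fj']; apply: finj; rewrite ?fj.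
move=> j; rewrite mul1e /winj; have [->|cj] := eqVneq (c j) 0.
  by rewrite mul0r phi00 nneseries_ge0// => k _ _; rewrite lee_fin.
rewrite (nneseriesD1 (n := f j))//; last first.
  by move=> k _; case: ifP => _; rewrite lee_fin// phi_ge0.
rewrite eqxx/=; apply: (@le_trans _ _ (phi r (z (f j)))%:E).
  by rewrite lee_fin phi_mono// normrM ler_piMl.
by rewrite leeDl// nneseries_ge0// => k _ _; case: ifP => _; rewrite lee_fin// phi_ge0.
Qed.

Lemma contraction_winj q c f : (0 < q)%E -> (forall j, `|c j| <= 1) ->
  inj_where c f -> contraction q (winj c f).
Proof.
move=> q0 c1 finj; split=> [a x y _ _|x _|x _]; last exact: mass_winj.
  by apply/funext => j; rewrite /winj !fctE /= mulrDr mulrCA.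
case: q q0 => [r| |]// r0; first by apply: mass_winj => //; rewrite -lee_fin ltW.
by move=> M xM k; rewrite /winj normrM (le_trans _ (xM (f k)))// ler_piMl.
Qed.

Lemma powR_split (p s t b : R) : 0 < p -> p <= s -> 0 <= t -> t <= b ->
  t `^ s <= t `^ p * b `^ (s - p).
Proof.
move=> p0 ps t0 tb; have [->|tn0] := eqVneq t 0.
  by rewrite !powR0 ?gt_eqF// ?mul0r// (lt_le_trans p0).
have -> : t `^ s = t `^ p * t `^ (s - p).
  by rewrite -powRD ?subrKC// ?tn0 ?implybT.
by rewrite ler_wpM2l ?powR_ge0// ge0_ler_powR ?nnegrE ?subr_ge0// (le_trans t0).
Qed.

Definition unit_seq (k : nat) : nat -> R := fun j => (j == k)%:R.

Lemma mass0_unit_seq k : (mass 0 (unit_seq k) < +oo)%E.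
Proof.
rewrite /mass (nneseriesD1 (n := k))//; last by move=> j _; rewrite lee_fin phi_ge0.
rewrite eseries0 ?adde0 ?ltry// => j _ /negbTE jk.
by rewrite /unit_seq jk phi00.
Qed.

End sparse.

Section interpolation_space.
Context {R : realType} (q : \bar R) (E : seqSpace R) (hI : Int 0%E q E).

Let q0 : (0 < q)%E. Proof. by case: hI => /andP[]. Qed.
Let hE : quasi_banach E. Proof. by case: hI. Qed.
Let EQ : continuous_inclusion E (ell q). Proof. by case: hI. Qed.

Lemma unit_seqE k : carrier E (unit_seq k).
Proof.
case: hI => _ _ [+ _] _ _; apply; apply/carrier_mass => //.
exact: mass0_unit_seq.
Qed.

Lemma scaled_contraction_bounded : exists2 C : R, 0 < C &
  forall T (M : R), 0 < M -> contraction q (fun x => M^-1 \*o T x) ->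
  forall x, carrier E x ->
    carrier E (T x) /\ qnorm E (T x) <= C * M * qnorm E x.
Proof.
have [C C0 CP] := contractions_uniformly_bounded hI; exists C => //.
move=> T M M0 Tc x xE; have [TE TN] := CP _ Tc x xE.
have -> : T x = M \*o (M^-1 \*o T x).
  by apply/funext => k /=; rewrite mulVKf// gt_eqF.
split; first exact: E_scale.
by rewrite N_scale// gtr0_norm// [C * M]mulrC -mulrA ler_wpM2l ?(ltW M0).
Qed.

Lemma winj_bounded : exists2 C : R, 0 < C &
  forall c f, (forall j, `|c j| <= 1) -> inj_where c f -> forall x, carrier E x ->
    carrier E (winj c f x) /\ qnorm E (winj c f x) <= C * qnorm E x.
Proof.
have [C C0 CP] := contractions_uniformly_bounded hI; exists C => // c f c1 finj.
exact/CP/contraction_winj.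
Qed.

(** Every unit vector is the image of the first one under a contraction. *)
Lemma unit_seq_bounded : exists2 D : R, 0 < D & forall k, qnorm E (unit_seq k) <= D.
Proof.
have [C C0 CP] := winj_bounded.
exists (C * qnorm E (unit_seq 0)).
  rewrite mulr_gt0// N_gt0//; first exact: unit_seqE.
  move/(congr1 (fun f => f 0%N)); rewrite /unit_seq eqxx => /eqP.
  by rewrite oner_eq0.
move=> k; have [] := CP (fun j => (j == k)%:R) (fun=> 0%N) _ _ _ (unit_seqE 0).
- by move=> j; case: (j == k); rewrite ?normr1 ?normr0.
- by move=> j j'; rewrite !pnatr_eq0 !eqb0 !negbK => /eqP -> /eqP ->.
have <- : winj (fun j => (j == k)%:R) (fun=> 0%N) (unit_seq 0) = unit_seq k :> (nat -> R).
  by apply/funext => j; rewrite /winj /unit_seq eqxx mulr1.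
by [].
Qed.

(** The test sequences are the indicators of {0, ..., n-1}: the index bounds
    their norm by n^(1/s) while l^q sees n^(1/r). *)
Lemma index_le_exponent (s r : R) : q = r%:E -> aoki_rolewicz_index E s -> s <= r.
Proof.
move=> qr hs; have s0 : 0 < s by case: hs.
have r0 : 0 < r by move: q0; rewrite qr lte_fin.
have [K K0 KP] := N_sum_powR hE hs.
have [C C0 CP] := ell_norm_le_N hE q0 EQ.
have [D D0 DP] := unit_seq_bounded.
pose B := C * (K * D `^ s) `^ s^-1.
have B0 : 0 < B by rewrite mulr_gt0// powR_gt0// mulr_gt0// powR_gt0.
have bound n : n%:R <= B `^ r * n%:R `^ (r / s).
  pose x : nat -> R := \sum_(0 <= i < n) unit_seq i.
  have xE : carrier E x by apply: E_sum => // i; exact: unit_seqE.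
  have Nx : qnorm E x <= (K * D `^ s * n%:R) `^ s^-1.
    rewrite -(ge0_ler_powRE s0) ?N_ge0 ?powR_ge0// powRVK ?gt_eqF//; last first.
      by rewrite !mulr_ge0 ?powR_ge0// ltW.
    rewrite (le_trans (KP _ _ _ _))//; first exact: unit_seqE.
    rewrite -mulrA ler_wpM2l ?(ltW K0)//.
    rewrite (@le_trans _ _ (\sum_(0 <= i < n) D `^ s))//.
      apply: ler_sum => i _; rewrite ge0_ler_powRE ?(N_ge0 hE) ?(ltW D0)//.
      exact: unit_seqE.
    by rewrite sumr_const_nat subn0 mulr_natr.
  have := CP x xE; rewrite qr => /ell_norm_leP -/(_ r0).
  rewrite mulr_ge0 ?(ltW C0) ?(N_ge0 hE)// => /(_ isT).
  move/(le_trans (mass_partial r x 0 n)); rewrite lee_fin => h.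
  have xn i : (i < n)%N -> phi r (x i) = 1.
    move=> i_n; rewrite phiE// /x fct_sumE (big_rem i)/=; last first.
      by rewrite mem_index_iota.
    rewrite {1}/unit_seq eqxx big_seq big1 ?addr0 ?normr1 ?powR1// => j.
    rewrite mem_rem_uniq ?iota_uniq// inE eq_sym => /andP[/negbTE ij _].
    by rewrite /unit_seq ij.
  have : n%:R <= (C * qnorm E x) `^ r.
    apply: le_trans h; rewrite big_nat (eq_bigr (fun=> 1)); last first.
      by move=> i /andP[_]; exact: xn.
    by rewrite -big_nat sumr_const_nat subn0 lexx.
  move/le_trans; apply.
  have -> : B `^ r * n%:R `^ (r / s) = (B * n%:R `^ s^-1) `^ r.
    by rewrite powRM ?powR_ge0 ?(ltW B0)// -powRrM [s^-1 * r]mulrC.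
  apply: ge0_ler_powR; rewrite ?nnegrE ?mulr_ge0 ?powR_ge0 ?(ltW B0) ?(ltW C0) ?(N_ge0 hE)//.
    exact: ltW.
  rewrite /B -mulrA ler_wpM2l ?(ltW C0)// -powRM// mulr_ge0 ?(ltW K0) ?powR_ge0//.
rewrite leNgt; apply/negP => rs.
have d0 : 0 < 1 - r / s by rewrite subr_gt0 ltr_pdivrMr// mul1r.
pose n := (Num.truncn ((B `^ r) `^ (1 - r / s)^-1)).+1.
have nB : (B `^ r) `^ (1 - r / s)^-1 < n%:R by exact: truncnS_gt.
have n0 : 0 < n%:R :> R by rewrite ltr0n.
have : B `^ r < n%:R `^ (1 - r / s).
  rewrite -[ltLHS](@powRVK _ (1 - r / s)) ?gt_eqF ?powR_ge0//.
  by apply: gt0_ltr_powR; rewrite ?nnegrE ?powR_ge0 ?ler0n.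
rewrite ltNge => /negP; apply.
rewrite -(ler_pM2r (powR_gt0 (r / s) n0)) -powRD ?subrK ?powRr1 ?ler0n//.
by rewrite gt_eqF// implybT.
Qed.

(** The unit vectors are bounded in E, so the expansion of x along them converges
    in E as soon as x is in l^s, which contains l^p. *)
Lemma ell_sub_interpolation (s p : R) : aoki_rolewicz_index E s -> 0 < p < s ->
  continuous_inclusion (ell p%:E) E.
Proof.
move=> hs /andP[p0 ps]; have s0 : 0 < s := lt_trans p0 ps.
have [K K0 KP] := N_series_powR hE q0 EQ hs.
have [D D0 DP] := unit_seq_bounded.
apply: (@continuous_inclusion_intro _ _ _ (K * D)).
  move=> x y /(carrier_mass _ (ltW p0)) xp /(carrier_mass _ (ltW p0)) yp.
  by apply/(carrier_mass _ (ltW p0)); exact: mass_sub_lty (ltW p0) yp xp.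
move=> x /(carrier_mass _ (ltW p0)) xp.
pose m := fine (mass p x).
have m0 : 0 <= m by rewrite fine_ge0// mass_ge0.
have mE : mass p x = m%:E by rewrite mass_fineK.
have xm k : `|x k| <= m `^ p^-1.
  apply: (coord_le_mass _ p0); rewrite ?powR_ge0// powRVK ?gt_eqF//.
  by rewrite mE.
have [||n|k|xE xN] := KP (fun i => x i \*o unit_seq i) x
    (fun i => D `^ s * `|x i| `^ s) (D `^ s * m `^ (s / p)).
- by move=> i; apply: E_scale => //; exact: unit_seqE.
- move=> i; rewrite N_scale//; last exact: unit_seqE.
  rewrite powRM ?(N_ge0 hE)//; last exact: unit_seqE.
  rewrite mulrC ler_wpM2r ?powR_ge0// ge0_ler_powRE ?(N_ge0 hE) ?(ltW D0)//.
  exact: unit_seqE.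
- rewrite -mulr_sumr ler_wpM2l ?powR_ge0//.
  apply: (@le_trans _ _ (\sum_(0 <= i < n) (phi p (x i) * m `^ ((s - p) / p)))).
    apply: ler_sum => i _; rewrite phiE//.
    rewrite (le_trans (powR_split p0 (ltW ps) _ (xm i)))//.
    by rewrite -powRrM [p^-1 * _]mulrC.
  rewrite -mulr_suml; have := mass_partial p x 0 n; rewrite mE lee_fin => h.
  apply: (le_trans (ler_wpM2r (powR_ge0 _ _) h)).
  have [->|mn0] := eqVneq m 0; first by rewrite mul0r powR_ge0.
  rewrite -[X in X * _](powRr1 m0) -powRD ?mn0 ?implybT//.
  by rewrite mulrBl mulfV ?gt_eqF// subrKC.
- apply: (@cvg_near_cst _ _ _ _ _); near=> n.
  have kn : (k < n)%N by near: n; exists k.+1.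
  rewrite (big_rem k) ?mem_index_iota//= {1}/unit_seq eqxx mulr1.
  rewrite big_seq big1 ?addr0// => j.
  rewrite mem_rem_uniq ?iota_uniq// inE eq_sym => /andP[/negbTE kj _].
  by rewrite /unit_seq kj mulr0.
split=> //; first by rewrite fine_ge0// ell_norm_ge0.
rewrite (le_trans xN)//= ell_norm_mass// fine_poweR -/m -mulrA ler_wpM2l ?(ltW K0)//.
rewrite powRM ?powR_ge0// powRKV ?gt_eqF ?(ltW D0)// ler_wpM2l ?(ltW D0)//.
by rewrite -powRrM mulrAC mulfV ?gt_eqF// mul1r.
Unshelve. all: by end_near. Qed.

End interpolation_space.

(** * Decreasing rearrangements *)

Section rearrangement.
Context {R : realType}.
Implicit Types (x : nat -> R).

Lemma max_outside x (l : seq nat) : x @ \oo --> (0 : R) ->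
  exists k, k \notin l /\ forall j, j \notin l -> `|x j| <= `|x k|.
Proof.
move=> x0; pose j0 := (\max_(i <- l) i).+1.
have j0l : j0 \notin l.
  by apply/negP => /(@leq_bigmax_seq _ l xpredT id) -/(_ isT); rewrite /j0 ltnn.
have [z|] := pselect (forall j, j \notin l -> x j = 0).
  by exists j0; split=> // j jl; rewrite (z j jl) normr0.
move/existsNP => [j1 /not_implyP[j1l /eqP xj1]].
move/cvgrPdist_lt : x0 => /(_ `|x j1|); rewrite normr_gt0 => /(_ xj1) [n0 _ n0P].
have j1n0 : (j1 < n0)%N.
  by rewrite ltnNge; apply/negP => /n0P /=; rewrite sub0r normrN ltxx.
pose i1 := Ordinal j1n0.
case: (@arg_maxP _ _ 'I_n0 i1 (fun i => val i \notin l) (fun i => `|x (val i)|) j1l).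
move=> i il imax; exists (val i); split=> // j jl.
have [jn0|n0j] := ltnP j n0; first exact: (imax (Ordinal jn0)).
have := n0P _ n0j; rewrite /= sub0r normrN => /ltW/le_trans; apply.
exact: (imax i1).
Qed.

(** The rearrangement picks greedily the largest term not yet picked, which exists
    because x tends to 0. Both passages between x and its rearrangement are given
    as operators, since the symmetry of E is known only through operators. *)
Lemma decreasing_rearrangement x : x @ \oo --> (0 : R) ->
  exists f : nat -> nat,
    [/\ injective f, forall n, `|x (f n.+1)| <= `|x (f n)|,
        forall k, x k != 0 -> exists n, f n = k &
        exists c d g, [/\ (forall j, `|c j| <= 1) /\ inj_where c f,
          (forall j, `|d j| <= 1) /\ inj_where d g,
          (fun n => `|x (f n)|) = winj c f x &
          x = winj d g (fun n => `|x (f n)|)]].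
Proof.
move=> x0.
have [g gP] := choice (fun l : seq nat => max_outside l x0).
pose L n := iter n (fun l => rcons l (g l)) [::].
pose f n := g (L n).
have fL i n : (i < n)%N -> f i \in L n.
  elim: n => // n IH; rewrite ltnS leq_eqVlt /= mem_rcons inE => /orP[/eqP ->|/IH ->].
    by rewrite eqxx.
  by rewrite orbT.
have fNL n : f n \notin L n by have [] := gP (L n).
have finj : injective f.
  move=> i j fij; case: (ltngtP i j) => // ij.
    by have := fL _ _ ij; rewrite fij (negbTE (fNL j)).
  by have := fL _ _ ij; rewrite -fij (negbTE (fNL i)).
have fmax n k : k \notin L n -> `|x k| <= `|x (f n)| by have [_] := gP (L n); apply.
have LP n k : k \in L n -> exists i, f i = k.
  elim: n => // n IH; rewrite /= mem_rcons inE => /orP[/eqP ->|/IH//].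
  by exists n.
have fsurj k : x k != 0 -> exists n, f n = k.
  move=> xk; apply: contrapT => nof.
  have kmax n : `|x k| <= `|x (f n)|.
    by apply: fmax; apply/negP => /LP.
  move/cvgrPdist_lt : x0 => /(_ `|x k|); rewrite normr_gt0 => /(_ xk) [n0 _ n0P].
  have fn0 n : (f n < n0)%N.
    rewrite ltnNge; apply/negP => /n0P /=; rewrite sub0r normrN.
    by rewrite ltNge kmax.
  have : (#|'I_n0.+1| <= #|'I_n0|)%N.
    apply: (@leq_card _ _ (fun i : 'I_n0.+1 => Ordinal (fn0 (val i)))).
    by move=> i j /(congr1 val) /= /finj /val_inj.
  by rewrite !card_ord ltnn.
exists f; split=> //.
  move=> n; apply: fmax; have := fNL n.+1.
  by rewrite /= mem_rcons inE negb_or => /andP[].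
have [h hP] : exists h, forall k, x k != 0 -> f (h k) = k.
  have [|h hP] := @choice _ _ (fun k n => x k != 0 -> f n = k).
    move=> k; have [xk|xk] := eqVneq (x k) 0; first by exists 0%N.
    by have [n fn] := fsurj _ xk; exists n.
  by exists h.
have sg1 t : `|Num.sg t| <= 1 :> R by rewrite normr_sg; case: (t != 0).
exists (fun n => Num.sg (x (f n))), (fun k => Num.sg (x k)), h; split.
- by split=> // i j _ _; exact: finj.
- split=> // i j; rewrite !sgr_eq0 => xi xj /(congr1 f).
  by rewrite !hP.
- by apply/funext => n; rewrite /winj -normrEsg.
- apply/funext => k; rewrite /winj; have [->|xk] := eqVneq (x k) 0.
    by rewrite sgr0 mul0r.
  by rewrite hP// mulr_sg_norm.
Qed.

End rearrangement.

(** * A majorant of the running averages *)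

Section powers_sum.
Context {R : realType}.

Lemma powR_le_tangent (a t : R) : 0 < a < 1 -> 0 <= t -> t `^ a <= a * t + (1 - a).
Proof.
move=> /andP[a0 a1] t0.
have a10 : 0 < 1 - a by rewrite subr_gt0.
have := @conjugate_powR _ (t `^ a) 1 a^-1 (1 - a)^-1 (powR_ge0 _ _) ler01.
rewrite !invr_gt0 => /(_ a0 a10); rewrite !invrK subrKC => /(_ erefl).
by rewrite mulr1 powR1 mul1r powRKV ?gt_eqF// [t * a]mulrC.
Qed.

Lemma sum_powRN_le (th : R) (n : nat) : 0 < th < 1 ->
  \sum_(0 <= k < n) k.+1%:R `^ (- th) <= n%:R `^ (1 - th) / (1 - th).
Proof.
move=> /andP[t0 t1]; set a := 1 - th; have a0 : 0 < a by rewrite subr_gt0.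
have a1 : a < 1 by rewrite /a; lra.
have -> : - th = a - 1 by rewrite /a; lra.
clearbody a; rewrite ler_pdivlMr//; elim: n => [|n IH].
  by rewrite big_geq// mul0r powR_ge0.
rewrite big_nat_recr//= mulrDl (le_trans (lerD IH (lexx _)))//.
have n0 : 0 < n.+1%:R :> R by [].
have -> : n%:R = n.+1%:R * (n%:R / n.+1%:R) :> R by rewrite mulrC divfK// gt_eqF.
rewrite powRM ?divr_ge0// [X in _ + X * a]powRD; last by rewrite (gt_eqF n0) implybT.
rewrite powR_inv1// -mulrA -mulrDr.
rewrite -[leRHS]mulr1 ler_wpM2l ?powR_ge0//.
rewrite (le_trans (lerD (@powR_le_tangent a _ _ _) (lexx _)))//.
  by rewrite a0.
have -> : n%:R / n.+1%:R = 1 - n.+1%:R^-1 :> R.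
  by rewrite -[in LHS](addrK 1 n%:R) natr1 mulrBl divff ?gt_eqF// mul1r.
by set v := n.+1%:R^-1; lra.
Qed.

Lemma powR_lt1 (a r : R) : 0 <= a < 1 -> 0 < r -> a `^ r < 1.
Proof.
move=> /andP[a0 a1] r0; rewrite -[ltRHS](_ : 1 `^ r = 1); last by rewrite powR1.
by apply: gt0_ltr_powR; rewrite ?nnegrE.
Qed.

Lemma sum_geometric_le (t : R) (n : nat) : 0 <= t -> t < 1 ->
  \sum_(0 <= k < n) t ^+ k <= (1 - t)^-1.
Proof.
move=> t0 t1; have t10 : 0 < 1 - t by rewrite subr_gt0.
rewrite -[leRHS]mul1r ler_pdivlMr//.
have -> : (\sum_(0 <= k < n) t ^+ k) * (1 - t) = 1 - t ^+ n.
  elim: n => [|n IH]; first by rewrite big_geq// mul0r expr0 subrr.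
  by rewrite big_nat_recr//= mulrDl IH exprS; ring.
by rewrite gerBl exprn_ge0.
Qed.

End powers_sum.

Lemma dyadic_between (k n j : nat) : (k < n)%N -> (n <= j)%N -> (j < n.*2)%N ->
  exists m, (j < 2 ^ m * k.+1)%N /\ (2 ^ m * k.+1 <= 4 * n)%N.
Proof.
move=> kn nj jn.
have ex : exists m, (j < 2 ^ m * k.+1)%N.
  by exists j; rewrite (leq_trans (ltn_expl j (ltnSn 1)))// leq_pmulr.
exists (ex_minn ex); case: ex_minnP => -[|m] jm mmin; split=> //.
  by rewrite expn0 mul1n; lia.
have : ~~ (j < 2 ^ m * k.+1)%N by apply/negP => /mmin; rewrite ltnn.
by rewrite expnS; lia.
Qed.

Section averages.
Context {R : realType} (q : \bar R) (E : seqSpace R) (hI : Int 0%E q E).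
Context (s : R) (hs : aoki_rolewicz_index E s).

Let q0 : (0 < q)%E. Proof. by case: hI => /andP[]. Qed.
Let hE : quasi_banach E. Proof. by case: hI. Qed.
Let EQ : continuous_inclusion E (ell q). Proof. by case: hI. Qed.
Let s0 : 0 < s. Proof. by case: hs. Qed.

Definition dilate (N : nat) (x : nat -> R) : nat -> R := fun j => x (j %/ N)%N.

(** A dilation by N is a sum of N disjoint copies. *)
Lemma dilate_bounded : exists2 D : R, 0 < D & forall (N : nat) x, (0 < N)%N ->
  carrier E x -> carrier E (dilate N x) /\
    qnorm E (dilate N x) `^ s <= D * N%:R * qnorm E x `^ s.
Proof.
have [K K0 KP] := N_sum_powR hE hs.
have [C C0 CP] := winj_bounded hI.
exists (K * C `^ s); first by rewrite mulr_gt0// powR_gt0.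
move=> N x N0 xE.
pose u i := winj (fun j => ((j %% N)%N == i)%:R) (fun j => j %/ N)%N x.
have uP i : carrier E (u i) /\ qnorm E (u i) <= C * qnorm E x.
  apply: CP => //.
    by move=> j; case: (_ == _); rewrite ?normr1 ?normr0.
  move=> j j'; rewrite !pnatr_eq0 !eqb0 !negbK => /eqP ji /eqP ji' jj'.
  by rewrite (divn_eq j N) ji jj' -ji' -divn_eq.
have -> : dilate N x = \sum_(0 <= i < N) u i.
  apply/funext => j; rewrite fct_sumE (big_rem (j %% N)%N)/=; last first.
    by rewrite mem_index_iota ltn_pmod.
  rewrite {1}/u /winj eqxx mul1r big_seq big1 ?addr0// => i.
  rewrite mem_rem_uniq ?iota_uniq// inE eq_sym => /andP[/negbTE ij _].
  by rewrite /u /winj ij mul0r.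
split; first by apply: E_sum => // i; have [] := uP i.
rewrite (le_trans (KP _ _ _ _))//; first by move=> i; have [] := uP i.
rewrite -!mulrA ler_wpM2l ?(ltW K0)//.
rewrite (@le_trans _ _ (\sum_(0 <= i < N) (C * qnorm E x) `^ s))//.
  apply: ler_sum => i _; have [uE uN] := uP i.
  by rewrite ge0_ler_powR ?(ltW s0)// ?nnegrE ?mulr_ge0 ?(N_ge0 hE) ?(ltW C0).
rewrite sumr_const_nat subn0 powRM ?(N_ge0 hE) ?(ltW C0)//.
by rewrite -mulrnAr mulr_natl.
Qed.

(** The majorant w is the sum of the dilations of x by 2^m with weights
    2^(-m/p'), for some p' between p and s. Since N copies of x cost only N^(1/s)
    and p' < s, the series converges in E. For k < n <= j < 2n, a dilation by some
    2^m of order n / (k + 1) has at rank j a term that is at least x k, so that x k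
    is at most (4 n / (k + 1))^(1/p') w j; as p < p', the p-th powers of these
    bounds add up to O(n) times that of w j. *)
Lemma averaging_majorant (p : R) : 0 < p < s ->
  exists C B : R, [/\ 0 < C, 0 < B & forall x, carrier E x -> (forall n, 0 <= x n) ->
    (forall n, x n.+1 <= x n) ->
    exists w, [/\ carrier E w, qnorm E w <= C * qnorm E x,
      (forall n, x n <= w n), (forall n, w n.+1 <= w n) &
      forall n j, (n <= j < n.*2)%N ->
        \sum_(0 <= k < n) x k `^ p <= B * n%:R * w j `^ p]].
Proof.
move=> /andP[p0 ps].
pose p' := (p + s) / 2; have p'0 : 0 < p' by rewrite divr_gt0// addr_gt0.
have pp' : p < p' by rewrite /p'; lra.
have p's : p' < s by rewrite /p'; lra.
pose c : R := 2^-1 `^ p'^-1.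
have c0 : 0 < c by rewrite powR_gt0// invr_gt0.
have h2 : 0 <= (2^-1 : R) < 1 by lra.
have c1 : c < 1.
  by apply: powR_lt1 h2 _; rewrite invr_gt0.
pose t := c `^ s * 2.
have t0 : 0 <= t by rewrite mulr_ge0 ?powR_ge0.
have t1 : t < 1.
  have a0 : 0 < 2^-1 :> R by rewrite invr_gt0.
  have sp : 0 < s / p' - 1 by rewrite subr_gt0 ltr_pdivlMr// mul1r.
  rewrite /t /c -powRrM mulrC [_ * s]mulrC -(subrKC 1 (s / p')).
  rewrite powRD; last by rewrite (gt_eqF a0) implybT.
  rewrite powRr1 ?(ltW a0)// mulVKf ?gt_eqF//.
  exact: powR_lt1 h2 sp.
have t10 : 0 < 1 - t by rewrite subr_gt0.
have cm0 m : 0 <= c ^+ m by rewrite exprn_ge0// ltW.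
have [K K0 KP] := N_series_powR hE q0 EQ hs.
have [D D0 DP] := dilate_bounded.
pose th := p / p'.
have th0 : 0 < th by rewrite divr_gt0.
have th1 : th < 1 by rewrite ltr_pdivrMr// mul1r.
have th01 : 0 < th < 1 by rewrite th0 th1.
exists (K * (D / (1 - t)) `^ s^-1), (4 `^ th / (1 - th)).
split.
- by rewrite mulr_gt0// powR_gt0// divr_gt0.
- by rewrite divr_gt0 ?powR_gt0 ?subr_gt0.
move=> x xE x0 /nonincreasing_seqP xS.
pose u m := c ^+ m \*o dilate (2 ^ m) x.
have u0 m j : 0 <= u m j by rewrite /u /= mulr_ge0// /dilate.
pose S j n := \sum_(0 <= m < n) u m j.
have Snd j : nondecreasing_seq (S j).
  by apply/nondecreasing_seqP => n; rewrite /S big_nat_recr//= lerDl.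
have Scv j : cvgn (S j).
  apply: nondecreasing_is_cvgn => //; exists ((1 - c)^-1 * x 0%N) => _ [n _ <-].
  apply: (@le_trans _ _ ((\sum_(0 <= m < n) c ^+ m) * x 0%N)).
    by rewrite /S mulr_suml ler_sum// => m _; rewrite ler_wpM2l// xS.
  by rewrite ler_wpM2r// sum_geometric_le// ltW.
pose w j := limn (S j).
have wle j m : u m j <= w j.
  apply: (le_trans _ (nondecreasing_cvgn_le (Snd j) (Scv j) m.+1)).
  by rewrite /S big_nat_recr//= lerDr sumr_ge0.
have uE m : carrier E (u m).
  apply: E_scale => //.
  by have [] := DP (2 ^ m)%N x _ xE; rewrite ?expn_gt0.
have [|n||wE wN] := KP u w (fun m => D * qnorm E x `^ s * t ^+ m)
    (D * qnorm E x `^ s * (1 - t)^-1) uE.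
- move=> m; have [dE dN] := DP (2 ^ m)%N x ltac:(by rewrite expn_gt0) xE.
  rewrite N_scale// (ger0_norm (cm0 m)) powRM ?(N_ge0 hE)//.
  have -> : (c ^+ m) `^ s = (c `^ s) ^+ m.
    by rewrite -(powR_mulrn m (ltW c0)) powRAC powR_mulrn ?powR_ge0.
  rewrite /t exprMn [leRHS]mulrCA ler_wpM2l ?exprn_ge0 ?powR_ge0//.
  by rewrite (le_trans dN)// natrX mulrAC.
- rewrite -mulr_sumr ler_wpM2l ?mulr_ge0 ?powR_ge0 ?(ltW D0)//.
  exact: sum_geometric_le.
- by move=> k; exact: Scv.
exists w; split=> //.
- rewrite (le_trans wN)// -[leRHS]mulrA ler_wpM2l ?(ltW K0)//.
  rewrite mulrAC [leLHS]powRM ?powR_ge0 ?divr_ge0 ?(ltW D0) ?(ltW t10)//.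
  by rewrite powRKV ?gt_eqF// (N_ge0 hE).
- by move=> n; have := wle n 0%N; rewrite /u /= expr0 mul1r /dilate divn1.
- move=> j; apply: ler_lim => //; apply: nearW => n.
  by apply: ler_sum => m _; rewrite /u /= ler_wpM2l// xS// leq_div2r.
move=> n j /andP[nj jn].
have w0 : 0 <= w j by rewrite (le_trans _ (wle j 0%N)).
have n0 : 0 < n%:R :> R by rewrite ltr0n; case: n nj jn.
have step k : (k < n)%N -> k.+1%:R * x k `^ p' <= 4 * n%:R * w j `^ p'.
  move=> kn.
  have [m [jm mmin]] := dyadic_between kn nj jn.
  have xk : c ^+ m * x k <= w j.
    apply: le_trans (wle j m); rewrite /u /= ler_wpM2l// xS//.
    by rewrite -ltnS ltn_divLR ?expn_gt0// mulnC.
  have h : (c ^+ m * x k) `^ p' <= w j `^ p'.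
    by apply: ge0_ler_powR; rewrite ?(ltW p'0) ?nnegrE ?mulr_ge0.
  have cE : (c ^+ m) `^ p' = (2 ^+ m)^-1.
    rewrite -powR_mulrn ?(ltW c0)// powRAC /c powRVK ?gt_eqF ?invr_ge0//.
    by rewrite powR_mulrn ?invr_ge0// exprVn.
  move: h; rewrite powRM// cE ler_pdivrMl ?exprn_gt0// => h.
  rewrite (le_trans (ler_wpM2l _ h))// mulrA ler_wpM2r ?powR_ge0//.
  by rewrite -natrX -!natrM ler_nat mulnC.
have xkp k : (k < n)%N -> x k `^ p <= (4 * n%:R) `^ th * w j `^ p * k.+1%:R `^ (- th).
  move=> kn; have pE (b : R) : b `^ p = (b `^ p') `^ th.
    by rewrite -powRrM /th mulrC divfK// gt_eqF.
  rewrite !pE powRN ler_pdivlMr ?powR_gt0// -!powRM ?powR_ge0 ?mulr_ge0//.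
  apply: ge0_ler_powR; rewrite ?(ltW th0) ?nnegrE ?mulr_ge0 ?powR_ge0//.
  by rewrite mulrC step.
rewrite big_nat (le_trans (ler_sum _ (fun k h => xkp k (andP h).2)))//.
rewrite -big_nat -mulr_sumr.
rewrite (le_trans (ler_wpM2l _ (sum_powRN_le n th01)))//.
  by rewrite mulr_ge0 ?powR_ge0.
have nE : n%:R `^ th * n%:R `^ (1 - th) = n%:R.
  by rewrite -powRD ?subrKC ?powRr1// (gt_eqF n0) implybT.
by rewrite powRM// -[in leRHS]nE le_eqVlt; apply/orP; left; apply/eqP; ring.
Qed.

End averages.

(** * Transport of tails *)

Section tails.
Context {R : realType}.
Implicit Types (r : R) (x y w z : nat -> R).

Definition tail r x (n : nat) : R := fine (\sum_(n <= k <oo) (phi r (x k))%:E)%E.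

Let etail_ge0 r x n : (0 <= \sum_(n <= k <oo) (phi r (x k))%:E)%E.
Proof. by apply: nneseries_ge0 => k _ _; rewrite lee_fin phi_ge0. Qed.

Let mass_etail r x n :
  mass r x = ((\sum_(0 <= k < n) phi r (x k))%:E +
              \sum_(n <= k <oo) (phi r (x k))%:E)%E.
Proof.
by rewrite /mass (nneseries_split 0 n) ?add0n ?sumEFin// => k _; rewrite lee_fin phi_ge0.
Qed.

Let etail_fin r x n : (mass r x < +oo)%E ->
  (\sum_(n <= k <oo) (phi r (x k))%:E = (tail r x n)%:E)%E.
Proof.
move=> xr; rewrite fineK// ge0_fin_numE//; apply: le_lt_trans xr.
by rewrite (mass_etail r x n) leeDr// lee_fin sumr_ge0// => k _; exact: phi_ge0.
Qed.

Lemma mass_tail r x n : (mass r x < +oo)%E ->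
  mass r x = (\sum_(0 <= k < n) phi r (x k) + tail r x n)%:E.
Proof. by move=> xr; rewrite (mass_etail r x n) etail_fin. Qed.

Lemma tail_ge0 r x n : 0 <= tail r x n.
Proof. exact: fine_ge0. Qed.

Lemma sum_tail r x m n : (mass r x < +oo)%E -> (m <= n)%N ->
  \sum_(m <= k < n) phi r (x k) = tail r x m - tail r x n.
Proof.
move=> xr mn; have := mass_tail n xr; rewrite (mass_tail m xr) => -[].
rewrite [X in _ = X + _](big_cat_nat _ mn)//=.
by set s := bigop _ _ _; set t := bigop _ _ _; lra.
Qed.

Lemma tailS r x n : (mass r x < +oo)%E -> tail r x n = phi r (x n) + tail r x n.+1.
Proof. by move=> xr; have := sum_tail xr (leqnSn n); rewrite big_nat1 => ->; lra. Qed.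

Lemma tail_mono r x m n : (mass r x < +oo)%E -> (m <= n)%N -> tail r x n <= tail r x m.
Proof.
move=> xr mn; rewrite -subr_ge0 -sum_tail//.
by rewrite sumr_ge0// => k _; exact: phi_ge0.
Qed.

Lemma tail_partial r x m n : (mass r x < +oo)%E ->
  \sum_(m <= k < n) phi r (x k) <= tail r x m.
Proof.
move=> xr; have [mn|nm] := leqP m n; last by rewrite big_geq ?tail_ge0// ltnW.
by rewrite sum_tail// gerBl tail_ge0.
Qed.

Lemma tail_le r x n (B : R) : (mass r x < +oo)%E ->
  (forall m, \sum_(n <= k < m) phi r (x k) <= B) -> tail r x n <= B.
Proof.
move=> xr xB; rewrite -lee_fin -etail_fin//; apply: lime_le.
  by apply: is_cvg_nneseries => k _ _; rewrite lee_fin phi_ge0.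
by apply: nearW => m; rewrite sumEFin lee_fin.
Qed.

Lemma tail_small_lt r x (e : R) : (mass r x < +oo)%E -> 0 < e ->
  exists n0, forall n, (n0 <= n)%N -> tail r x n < e.
Proof.
move=> xr e0.
have px n : \sum_(0 <= k < n) phi r (x k) <= fine (mass r x).
  by rewrite -lee_fin mass_fineK// mass_partial.
have e2 : 0 < e / 2 by rewrite divr_gt0.
have [n0 n0P] := tail_small (fun k => phi_ge0 r (x k)) px e2.
exists n0 => n n0n; apply: (@le_lt_trans _ _ (e / 2)); last by lra.
by apply: tail_le => // m; exact/ltW/n0P.
Qed.

Lemma young_powR r (u b : R) : 1 <= r -> 0 <= u -> 0 <= b ->
  r * (u `^ (r - 1) * b) <= (r - 1) * u `^ r + b `^ r.
Proof.
move=> r1 u0 b0; have r0 : 0 < r by lra.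
have [re|rn] := eqVneq r 1.
  by rewrite re subrr powRr0 mul0r add0r !mul1r powRr1.
have r10 : 0 < r - 1 by rewrite subr_gt0 lt_neqAle eq_sym rn.
have := @conjugate_powR _ b (u `^ (r - 1)) r (r / (r - 1)) b0 (powR_ge0 _ _) r0.
rewrite divr_gt0// => /(_ isT); rewrite invf_div -[X in X + _]mul1r -mulrDl subrKC.
rewrite divff ?gt_eqF// => /(_ erefl); rewrite -powRrM [(r - 1) * _]mulrC divfK ?gt_eqF//.
rewrite -(ler_pM2l r0) => h.
apply: le_trans (_ : r * (b * u `^ (r - 1)) <= _); first by rewrite [b * _]mulrC.
apply: (le_trans h); rewrite le_eqVlt; apply/orP; left; apply/eqP.
by field; rewrite gt_eqF.
Qed.

(** Young's inequality at the point u = (Q / A) a makes the two sides match. *)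
Lemma hoelder_sum r (a b : nat -> R) m n (A : R) : 1 <= r ->
  (forall k, 0 <= a k) -> (forall k, 0 <= b k) ->
  \sum_(m <= k < n) a k `^ r = A -> 0 < A ->
  (\sum_(m <= k < n) a k `^ (r - 1) * b k) `^ r <=
    A `^ (r - 1) * \sum_(m <= k < n) b k `^ r.
Proof.
move=> r1 a0 b0 AE A0; have r0 : 0 < r by lra.
set Q := \sum_(m <= k < n) a k `^ (r - 1) * b k; set B := \sum_(m <= k < n) b k `^ r.
have Q0 : 0 <= Q by rewrite sumr_ge0// => k _; rewrite mulr_ge0 ?powR_ge0.
pose l := Q / A; have l0 : 0 <= l by rewrite divr_ge0// ltW.
have H : r * (l `^ (r - 1) * Q) <= (r - 1) * (l `^ r * A) + B.
  rewrite -AE /Q /B !mulr_sumr -big_split/= ler_sum// => k _.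
  have := young_powR r1 (mulr_ge0 l0 (a0 k)) (b0 k).
  by rewrite !(powRM _ l0 (a0 k)) -!mulrA.
have llr : l `^ (r - 1) * Q = l `^ r * A.
  rewrite -(mulr_powRB1 l0 r0) [l * _]mulrC -mulrA; congr (_ * _).
  by rewrite /l divfK// gt_eqF.
have lAB : l `^ r * A <= B by move: H; rewrite llr; set t := _ * A; lra.
have -> : Q `^ r = A `^ (r - 1) * (l `^ r * A).
  have -> : Q = l * A by rewrite /l divfK// gt_eqF.
  rewrite powRM ?(ltW A0)// -(mulr_powRB1 (ltW A0) r0); ring.
by rewrite ler_wpM2l ?powR_ge0.
Qed.

End tails.

(** The terms of W from rank j on are small grains compared with Y j. The interval
    starts at the first rank where the tail t has fallen to u j, a level missed by
    less than one grain, and stops as soon as half of Y j is collected, before t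
    falls to u j.+1. Confining t between two consecutive values of u makes the
    intervals found for different j disjoint. *)
Lemma grain_interval (R : realType) (W Y t u : nat -> R) (j : nat) :
  (forall k, 0 <= W k) -> (forall k, W k.+1 <= W k) ->
  (forall k, t k = W k + t k.+1) ->
  (forall e, 0 < e -> exists n, forall k, (n <= k)%N -> t k < e) ->
  0 <= u j.+1 -> u j = Y j + u j.+1 -> u j <= t j / 2 -> W j < Y j / 4 ->
  exists st : nat * nat,
    (forall k, (st.1 <= k < st.2)%N -> u j.+1 < t k <= u j) /\
    Y j / 2 <= t st.1 - t st.2 /\ (st.1 <= st.2)%N.
Proof.
move=> W0 /nonincreasing_seqP WS tS t0 u0 uS ut WY.
have tmono : nonincreasing_seq t.
  by apply/nonincreasing_seqP => k; rewrite (tS k) lerDr.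
have Wj := W0 j.
have uj : 0 < u j by lra.
have exs : exists k, t k <= u j by have [n nP] := t0 _ uj; exists n; exact/ltW/nP.
have [s [su smin]] : exists s, t s <= u j /\ forall k, (k < s)%N -> u j < t k.
  exists (ex_minn exs); case: ex_minnP => m my mmin; split=> // k.
  by rewrite ltnNge => /negP km; rewrite ltNge; apply/negP => /mmin.
have s_gt : u j - Y j / 4 < t s.
  have js : (j < s)%N by rewrite ltnNge; apply/negP => /tmono; lra.
  case: s js su smin => // s js su smin.
  have := smin s (ltnSn s); have := WS j s js; have := tS s; lra.
have exr : exists r, Y j / 2 <= t s - t r.
  have Y4 : 0 < Y j / 4 by lra.
  by have [n nP] := t0 _ Y4; exists n; have := nP n (leqnn _); lra.
have [r [ry rmin]] : exists r, Y j / 2 <= t s - t r /\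
    forall k, (k < r)%N -> t s - t k < Y j / 2.
  exists (ex_minn exr); case: ex_minnP => m my mmin; split=> // k.
  by rewrite ltnNge => /negP km; rewrite ltNge; apply/negP => /mmin.
exists (s, r); split=> /=; last first.
  split=> //; rewrite leqNgt; apply/negP => /ltnW/tmono; lra.
move=> k /andP[/tmono sk /rmin kr]; apply/andP; split; lra.
Qed.

Section transport.
Context {R : realType} (r : R) (r1 : 1 <= r) (w y : nat -> R).
Context (w0 : forall n, 0 <= w n) (wS : forall n, w n.+1 <= w n).
Context (y0 : forall n, 0 <= y n).
Context (wr : (mass r w < +oo)%E) (yr : (mass r y < +oo)%E).
Context (yw : forall n, tail r y n <= tail r w n / 2).

Let r0 : 0 < r. Proof. by move: r1; lra. Qed.

Let bad j := phi r (w j) < phi r (y j) / 4.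

(** A diagonal operator produces y at the ranks where w is not much smaller. At a
    bad rank j it is produced by a functional carried by the interval of
    [grain_interval], namely the multiple of z -> sum of w^(r-1) z that takes the
    value y j at w; by Hoelder's inequality its norm is at most a constant and,
    as the intervals are disjoint, so is the norm of the sum. *)
Lemma tail_transport : exists d S,
  [/\ forall j, `|d j| <= 1, contraction r%:E (fun z => 2^-1 \*o S z) &
      y = 4 \*o winj d id w + S w].
Proof.
have [|st stP] := @choice _ _ (fun j (st : nat * nat) => bad j ->
    (forall k, (st.1 <= k < st.2)%N -> tail r y j.+1 < tail r w k <= tail r y j) /\
    phi r (y j) / 2 <= tail r w st.1 - tail r w st.2 /\ (st.1 <= st.2)%N).
  move=> j; have [bj|/negP nbj] := boolP (bad j); last by exists (0%N, 0%N).
  have [||||||||st stP] :=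
    @grain_interval R (fun k => phi r (w k)) (fun k => phi r (y k)) (tail r w) (tail r y) j.
  - by move=> k; exact: phi_ge0.
  - by move=> k; apply: phi_mono; rewrite ?(ltW r0)// !ger0_norm.
  - by move=> k; exact: tailS.
  - by move=> e; exact: tail_small_lt.
  - exact: tail_ge0.
  - exact: tailS.
  - exact: yw.
  - exact: bj.
  by exists st.
pose D j := tail r w (st j).1 - tail r w (st j).2.
pose I j k := bad j && ((st j).1 <= k < (st j).2)%N.
pose S z j := if bad j then
  y j / D j * \sum_((st j).1 <= k < (st j).2) w k `^ (r - 1) * z k else 0.
have Yp j : bad j -> 0 < phi r (y j).
  by rewrite /bad; have := phi_ge0 r (w j); lra.
have DY j : bad j -> phi r (y j) / 2 <= D j.
  by move=> /stP[_ []].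
have Dp j : bad j -> 0 < D j.
  by move=> bj; have := Yp j bj; have := DY j bj; lra.
have DE j : bad j -> \sum_((st j).1 <= k < (st j).2) w k `^ r = D j.
  move=> bj; have [_ [_ sle]] := stP j bj; rewrite /D -sum_tail//.
  by apply: eq_bigr => k _; rewrite phiE// ger0_norm.
have Iinj k j j' : I j k -> I j' k -> j = j'.
  move=> /andP[bj jk] /andP[bj' jk']; have [/(_ k jk) h _] := stP j bj.
  have [/(_ k jk') h' _] := stP j' bj'; move: h h' => /andP[h1 h2] /andP[h3 h4].
  apply/eqP; rewrite eqn_leq; apply/andP; split; rewrite leqNgt; apply/negP => lt.
    by have := lt_le_trans h3 h2; rewrite ltNge (tail_mono yr lt).
  by have := lt_le_trans h1 h4; rewrite ltNge (tail_mono yr lt).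
have rowsum j (z : nat -> R) r' : bad j ->
    ((\sum_((st j).1 <= k < (st j).2) phi r' (z k))%:E <=
    \sum_(0 <= k <oo) (if I j k then phi r' (z k) else 0)%:E)%E.
  move=> bj; have i0 k : (0 <= (if I j k then phi r' (z k) else 0)%:E)%E.
    by case: ifP => _; rewrite lee_fin// phi_ge0.
  apply: (@le_trans _ _ (\sum_(0 <= k < (st j).2) (if I j k then phi r' (z k) else 0)%:E)%E).
    have [_ [_ sle]] := stP j bj; rewrite [leRHS](big_cat_nat _ sle)//=.
    rewrite -[leLHS]add0e leeD//; first exact: sume_ge0.
    rewrite sumEFin lee_fin [leLHS]big_nat [leRHS]big_nat ler_sum// => k jk.
    by rewrite /I bj jk.
  exact: nneseries_lim_ge.
have S2 z : (mass r (S z) <= 2%:E * mass r z)%E.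
  apply: (mass_sparse (I := I)) => // j; rewrite /S.
  have [bj|nbj] := ifPn (bad j); last first.
    rewrite phi00 mule_ge0// nneseries_ge0// => k _ _.
    by case: ifP => _; rewrite lee_fin// phi_ge0.
  apply: (@le_trans _ _ (2%:E * (\sum_((st j).1 <= k < (st j).2) phi r (z k))%:E)%E);
    last by rewrite lee_wpmul2l ?lee_fin// rowsum.
  rewrite -EFinM lee_fin phiE// normrM powRM//.
  rewrite (ger0_norm (divr_ge0 (y0 j) (ltW (Dp j bj)))).
  set Z := \sum_(_ <= k < _) phi r (z k).
  have Z0 : 0 <= Z by rewrite sumr_ge0// => k _; exact: phi_ge0.
  have hZ : `|\sum_((st j).1 <= k < (st j).2) w k `^ (r - 1) * z k| `^ r <=
      D j `^ (r - 1) * Z.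
    have := hoelder_sum r1 w0 (fun k => normr_ge0 (z k)) (DE j bj) (Dp j bj).
    rewrite (_ : \sum_(_ <= k < _) `|z k| `^ r = Z); last first.
      by apply: eq_bigr => k _; rewrite phiE.
    apply: le_trans; apply: ge0_ler_powR; rewrite ?(ltW r0) ?nnegrE//.
      by rewrite sumr_ge0// => k _; rewrite mulr_ge0 ?powR_ge0.
    rewrite (le_trans (ler_norm_sum _ _ _))// ler_sum// => k _.
    by rewrite normrM ger0_norm ?powR_ge0.
  rewrite (le_trans (ler_wpM2l (powR_ge0 _ _) hZ))// mulrA ler_wpM2r//.
  rewrite powRM ?invr_ge0 ?(ltW (Dp j bj))// -mulrA -powR_inv1 ?(ltW (Dp j bj))//.
  rewrite -powRrM -powRD; last by rewrite (gt_eqF (Dp j bj)) implybT.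
  rewrite (_ : -1 * r + (r - 1) = -1) ?powR_inv1 ?(ltW (Dp j bj))//; last by ring.
  rewrite ler_pdivrMr ?Dp// -ler_pdivrMl// mulrC.
  by have := DY j bj; rewrite phiE// ger0_norm.
have S0 z : (mass 0 (S z) <= mass 0 z)%E.
  rewrite -[leRHS]mul1e; apply: (mass_sparse (I := I)) => // j; rewrite mul1e /S.
  have [bj|nbj] := ifPn (bad j); last first.
    rewrite phi00 nneseries_ge0// => k _ _.
    by case: ifP => _; rewrite lee_fin// phi_ge0.
  apply: le_trans (rowsum j z 0 bj); rewrite lee_fin.
  have [z0|] := pselect (forall k, ((st j).1 <= k < (st j).2)%N -> z k = 0).
    rewrite big_nat big1 ?mulr0 ?phi00 ?sumr_ge0// => k; first by move=> _; exact: phi_ge0.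
    by move=> jk; rewrite z0// mulr0.
  move=> /existsNP[k0 /not_implyP[jk0 /eqP zk0]].
  rewrite (le_trans (phi0_le1 _))// (big_rem k0)/= ?mem_index_iota//.
  by rewrite {1}/phi eqxx zk0 lerDl sumr_ge0// => k _; exact: phi_ge0.
exists (fun j => if bad j then 0 else y j / (4 * w j)), S; split.
- move=> j; have [bj|] := ifPn (bad j); first by rewrite normr0.
  rewrite /bad -leNgt !phiE// (ger0_norm (w0 j)) (ger0_norm (y0 j)) => h.
  have yw4 : y j <= 4 * w j.
    rewrite -(ge0_ler_powRE r0)// ?mulr_ge0// powRM//.
    have : 4 <= (4 : R) `^ r by apply: le1r_powR => //; lra.
    have := powR_ge0 (w j) r; move: h; set a := y j `^ r; set b := w j `^ r => h b0 h4.
    apply: le_trans (_ : 4 * b <= _); first by lra.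
    by rewrite ler_wpM2r.
  have w40 : 0 <= 4 * w j by rewrite mulr_ge0.
  rewrite (ger0_norm (divr_ge0 (y0 j) w40)).
  have [->|wn] := eqVneq (4 * w j) 0; first by rewrite invr0 mulr0.
  by rewrite ler_pdivrMr ?mul1r// lt_neqAle eq_sym wn.
- split=> [a z z' _ _|z zr|z z0].
  + apply/funext => j; rewrite !fctE /= /S; case: ifP => _; last by rewrite !mulr0 addr0.
    rewrite [in LHS](eq_bigr (fun k => a * (w k `^ (r - 1) * z k) + w k `^ (r - 1) * z' k));
      last by move=> k _; rewrite mulrDr mulrCA.
    by rewrite big_split/= -mulr_sumr; ring.
  + rewrite /size_le massM// (le_trans (lee_wpmul2l _ (S2 z))) ?lee_fin ?powR_ge0//.
    rewrite muleA -EFinM -[leRHS]mul1e lee_wpmul2r ?mass_ge0// lee_fin.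
    rewrite ger0_norm ?invr_ge0// -ler_pdivlMr// mul1r.
    rewrite -[leRHS]powRr1 ?invr_ge0//; apply: ger_powR => //.
    by rewrite invr_gt0 ltr0n invf_le1 ?ler1n.
  + by rewrite (le_trans (mass0M _ _)).
apply/funext => j; rewrite !fctE /= /winj /S.
have [bj|nbj] := ifPn (bad j).
  rewrite mul0r mulr0 add0r (eq_bigr (fun k => w k `^ r)); last first.
    by move=> k _; rewrite mulrC mulr_powRB1.
  by rewrite DE// divfK// gt_eqF// Dp.
rewrite addr0; have [w00|wn0] := eqVneq (w j) 0.
  move: nbj; rewrite /bad -leNgt w00 phi00 => h.
  have : phi r (y j) = 0 by apply/eqP; rewrite eq_le phi_ge0 andbT; lra.
  by move/phi_eq0 => ->; rewrite !mulr0.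
by rewrite /= mulrCA mulrA [4 * w j]mulrC; field.
Qed.

End transport.

(** * The interpolation theorem for q >= 1 *)

Section best_approximation.
Context {R : realType}.
Implicit Types (x y u : nat -> R).

(** The induction compares the sum over M with the sum of as many of the last
    terms, which are the smallest ones. *)
Lemma sum_discard_le (Y : nat -> R) (M : pred nat) (n N : nat) :
  (forall k, 0 <= Y k) -> (forall k, Y k.+1 <= Y k) ->
  (\sum_(0 <= m < N) (~~ M m) <= n)%N ->
  \sum_(n <= k < N) Y k <= \sum_(0 <= m < N | M m) Y m.
Proof.
move=> Y0 /nonincreasing_seqP YS Mn.
have H K : (\sum_(0 <= m < K) (~~ M m) <= K)%N /\
    \sum_(\sum_(0 <= m < K) (~~ M m) <= k < K) Y k <= \sum_(0 <= m < K | M m) Y m.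
  elim: K => [|K [cK IH]]; first by rewrite !big_geq.
  have -> : \sum_(0 <= m < K.+1 | M m) Y m =
      \sum_(0 <= m < K | M m) Y m + (if M K then Y K else 0).
    by rewrite big_mkcond big_nat_recr//= -big_mkcond.
  rewrite big_nat_recr//=.
  set c := (\sum_(0 <= m < K) _)%N in cK IH *.
  case: (M K) => /=.
     rewrite addn0; split; first exact: leqW.
    by rewrite big_nat_recr//= lerD2r.
  rewrite addn1 ltnS; split=> //; rewrite addr0 (le_trans _ IH)//.
  move: cK; rewrite leq_eqVlt => /orP[/eqP ->|cK]; first by rewrite !big_geq.
  rewrite big_nat_recr//= [leRHS]big_ltn// addrC lerD2r.
  exact: YS (ltnW cK).
have [_ HN] := H N; apply: le_trans HN.
have [nN|Nn] := leqP n N; last first.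
  by rewrite (big_geq (ltnW Nn)); apply: sumr_ge0 => k _; exact: Y0.
rewrite [leRHS](big_cat_nat _ nN)//= lerDr.
by apply: sumr_ge0 => k _; exact: Y0.
Qed.

Lemma sum_inj_le_mass (r : R) u (f : nat -> nat) N : 0 <= r -> injective f ->
  ((\sum_(0 <= m < N) phi r (u (f m)))%:E <= mass r u)%E.
Proof.
move=> r0 finj.
rewrite (eq_bigr (fun m => phi r (winj (fun=> 1) f u m))); last first.
  by move=> m _; rewrite /winj mul1r.
apply: (le_trans (mass_partial _ _ _ _)); apply: mass_winj => //.
  by move=> j; rewrite normr1.
by move=> j j' _ _; exact: finj.
Qed.

(** Chebyshev's inequality at the height where n terms exhaust the mass a. *)
Lemma count_large_le (p : R) u (a : R) (f : nat -> nat) n N : 0 < p -> 0 <= a ->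
  (0 < n)%N -> injective f -> (mass p u <= a%:E)%E ->
  (\sum_(0 <= m < N) ~~ (`|u (f m)| <= (a / n%:R) `^ p^-1)%R <= n)%N.
Proof.
move=> p0 a0 n0 finj ua; have nR : 0 < n%:R :> R by rewrite ltr0n.
have [a00|an0] := eqVneq a 0.
  rewrite big1// => m _; suff -> : u (f m) = 0 by rewrite normr0 powR_ge0.
  apply: (@phi_eq0 _ p); apply/eqP; rewrite eq_le phi_ge0 andbT -lee_fin.
  by rewrite (le_trans (phi_le_mass _ _ _))// -a00.
have ap : 0 < a by rewrite lt_neqAle eq_sym an0.
have anp : 0 < a / n%:R by rewrite divr_gt0.
rewrite -(ler_nat R) -(ler_pM2l anp) divfK ?gt_eqF// natr_sum mulr_sumr.
rewrite -lee_fin (le_trans _ ua)// (le_trans _ (sum_inj_le_mass _ N (ltW p0) finj))//.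
rewrite lee_fin ler_sum// => m _.
have [_|] := leP `|u (f m)| ((a / n%:R) `^ p^-1); first by rewrite /= mulr0n mulr0 phi_ge0.
move=> h /=; rewrite mulr1n mulr1 phiE// -[leLHS](@powRVK _ p) ?gt_eqF ?(ltW anp)//.
by apply: ge0_ler_powR; rewrite ?(ltW p0) ?nnegrE ?powR_ge0// ltW.
Qed.

Definition cut n x : nat -> R := fun k => if (k < n)%N then x k else 0.

Definition uncut n x : nat -> R := fun k => if (k < n)%N then 0 else x k.

Lemma cut_uncut n x : x = 1 \*o cut n x + uncut n x.
Proof.
apply/funext => k; rewrite !fctE /= mul1r /cut /uncut.
by case: ifP => _; rewrite ?addr0 ?add0r.
Qed.

Lemma mass_cut r n x : mass r (cut n x) = (\sum_(0 <= k < n) phi r (x k))%:E.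
Proof.
rewrite /mass (nneseries_split 0 n); last by move=> k _; rewrite lee_fin phi_ge0.
rewrite add0n sumEFin [X in (_ + X)%E]eseries0 ?adde0.
  congr (_%:E); rewrite [LHS]big_nat [RHS]big_nat; apply: eq_bigr => k kn.
  by rewrite /cut (andP kn).2.
by move=> k nk _; rewrite /cut ltnNge nk phi00.
Qed.

Lemma mass_uncut r n x : (mass r x < +oo)%E -> mass r (uncut n x) = (tail r x n)%:E.
Proof.
move=> xr; have ur : (mass r (uncut n x) < +oo)%E.
  apply: le_lt_trans xr; apply: lee_nneseries => k _.
    by move=> _; rewrite lee_fin phi_ge0.
  by rewrite lee_fin /uncut; case: ifP; rewrite ?phi00 ?phi_ge0.
rewrite (mass_tail n ur) big_nat big1 ?add0r.
  congr (fine _)%:E; rewrite eseries_cond [RHS]eseries_cond.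
  by apply: eq_eseriesr => k /andP[_ nk]; rewrite /uncut ltnNge nk.
by move=> k /andP[_ kn]; rewrite /uncut kn phi00.
Qed.

End best_approximation.

Section interpolation_sorted.
Context {R : realType} (r : R) (r1 : 1 <= r) (E : seqSpace R) (hI : Int 0%E r%:E E).
Context (s p : R) (hs : aoki_rolewicz_index E s) (ps : 0 < p < s).
Context (A B : R) (A0 : 0 <= A) (B0 : 0 <= B).

Let r0 : 0 < r. Proof. by move: r1; lra. Qed.
Let p0 : 0 < p. Proof. by case/andP: ps. Qed.
Let pr : p < r.
Proof. by case/andP: ps => _ /lt_le_trans; apply; exact: index_le_exponent hI _ _ _ _. Qed.

(** Holmstedt's estimate of the K-functional, in terms of best approximation: up
    to rank n the image of x is controlled through l^p and beyond it through
    l^r; both parts are tails of the majorant w of the running averages. *)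
Lemma tail_image_le (T : (nat -> R) -> (nat -> R)) (C : R) (x w : nat -> R) (f : nat -> nat) :
  0 <= C ->
  linear_on (carrier (ell r%:E)) T ->
  (forall z, (mass r z < +oo)%E -> (mass r (T z) <= B%:E * mass r z)%E) ->
  (forall z, (mass p z < +oo)%E -> (mass p (T z) <= A%:E * mass p z)%E) ->
  (mass r w < +oo)%E ->
  (forall k, 0 <= x k) -> (forall k, x k <= w k) ->
  (forall n j, (n <= j < n.*2)%N ->
    \sum_(0 <= k < n) x k `^ p <= C * n%:R * w j `^ p) ->
  injective f -> (forall n, `|T x (f n.+1)| <= `|T x (f n)|) ->
  forall n, tail r (fun n => `|T x (f n)|) n <=
    2 `^ r * ((A * C) `^ (r / p) + B) * tail r w n.
Proof.
move=> C0 Tlin Tr Tp wr x0 xw xC finj yS n.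
have w0 k : 0 <= w k by rewrite (le_trans (x0 k)).
have xwm : (mass r x <= mass r w)%E.
  by apply: mass_mono => [|k]; rewrite ?(ltW r0)// !ger0_norm.
have xr : (mass r x < +oo)%E := le_lt_trans xwm wr.
have txw k : tail r x k <= tail r w k.
  apply: tail_le => // m; apply: (le_trans _ (tail_partial k m wr)).
  by apply: ler_sum => i _; apply: phi_mono; rewrite ?(ltW r0)// !ger0_norm.
have yr : (mass r (T x) < +oo)%E.
  by rewrite (le_lt_trans (Tr x xr))// -(mass_fineK xr) -EFinM ltry.
pose Y m := phi r (T x (f m)).
have yf N : ((\sum_(0 <= k < N) Y k)%:E <= mass r (T x))%E.
  exact: sum_inj_le_mass (ltW r0) finj.
have ysr : (mass r (fun n => `|T x (f n)|%R) < +oo)%E.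
  apply: (le_lt_trans _ yr); rewrite -(mass_fineK yr) mass_le// => N.
  rewrite -lee_fin mass_fineK// (le_trans _ (yf N))// lee_fin.
  by apply: ler_sum => k _; rewrite phi_norm.
apply: tail_le => // N.
under eq_bigr do rewrite phi_norm.
rewrite -/Y.
have D0 : 0 <= 2 `^ r :> R by exact: powR_ge0.
have D1 : 1 <= 2 `^ r :> R by rewrite (@le_trans _ _ (2 : R))// ?le1r_powR// ler1n.
have [->|n0] := posnP n.
  apply: (@le_trans _ _ (B * tail r w 0)); last first.
    rewrite ler_wpM2r ?tail_ge0// -[leLHS]mul1r ler_pM// lerDr powR_ge0//.
  rewrite -lee_fin (le_trans (yf N))// (le_trans (Tr x xr))// EFinM lee_wpmul2l//.
  by rewrite (le_trans xwm)// (mass_tail 0 wr) big_geq// add0r.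
have nR : 0 < n%:R :> R by rewrite ltr0n.
pose u := T (cut n x); pose v := T (uncut n x).
have cr : (mass r (cut n x) < +oo)%E by rewrite mass_cut ltry.
have ur : (mass r (uncut n x) < +oo)%E by rewrite mass_uncut ?ltry.
have yuv : T x = u + v.
  rewrite [in LHS](cut_uncut n x) Tlin; last 2 first.
  - by apply/carrier_mass; rewrite ?(ltW r0).
  - by apply/carrier_mass; rewrite ?(ltW r0).
  by rewrite mull1.
pose a := A * \sum_(0 <= k < n) x k `^ p.
have a0 : 0 <= a by rewrite mulr_ge0// sumr_ge0// => k _; exact: powR_ge0.
have ua : (mass p u <= a%:E)%E.
  rewrite (le_trans (Tp _ _)) ?mass_cut ?ltry// -EFinM lee_fin.
  by rewrite ler_wpM2l// ler_sum// => k _; rewrite phiE// ger0_norm.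
pose l := (a / n%:R) `^ p^-1.
pose M m := `|u (f m)| <= l.
have cM : (\sum_(0 <= m < N) ~~ M m <= n)%N by exact: count_large_le.
have Y0 k : 0 <= Y k by exact: phi_ge0.
have YS k : Y k.+1 <= Y k.
  by apply: phi_mono; rewrite ?(ltW r0).
rewrite (le_trans (sum_discard_le Y0 YS cM))//.
have anl (j : nat) : (n <= j < n.*2)%N -> a / n%:R <= A * C * w j `^ p.
  by move=> nj; rewrite ler_pdivrMr// /a -!mulrA ler_wpM2l// [X in C * X]mulrC mulrA xC.
have uM : \sum_(0 <= m < N | M m) phi r (u (f m)) <= (A * C) `^ (r / p) * tail r w n.
  apply: (@le_trans _ _ (n%:R * (a / n%:R) `^ (r / p))).
    apply: (@le_trans _ _ (a * l `^ (r - p))).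
      apply: (@le_trans _ _ (\sum_(0 <= m < N) phi p (u (f m)) * l `^ (r - p))).
        rewrite [leLHS]big_mkcond ler_sum// => m _; case: ifP => Mm.
          by rewrite !phiE//; exact: powR_split (ltW pr) _ Mm.
        by rewrite mulr_ge0 ?phi_ge0 ?powR_ge0.
      rewrite -mulr_suml ler_wpM2r ?powR_ge0// -lee_fin.
      exact: le_trans (sum_inj_le_mass _ _ (ltW p0) finj) ua.
    have an0 : 0 <= a / n%:R by rewrite divr_ge0// ltW.
    rewrite /l -powRrM mulrBr mulVf ?gt_eqF// [p^-1 * r]mulrC.
    have [aE|aN] := eqVneq (a / n%:R) 0.
      have -> : a = 0 by move/eqP: aE; rewrite mulf_eq0 invr_eq0 (gt_eqF nR) orbF => /eqP.
      by rewrite mul0r mulr_ge0 ?powR_ge0 ?ltW.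
    have -> : a * (a / n%:R) `^ (r / p - 1) = n%:R * (a / n%:R * (a / n%:R) `^ (r / p - 1)).
      by rewrite mulrA [n%:R * _]mulrC divfK ?gt_eqF.
    by rewrite mulr_powRB1// divr_gt0.
  rewrite [leLHS](_ : _ = \sum_(n <= j < n.*2) (a / n%:R) `^ (r / p)); last first.
    by rewrite sumr_const_nat -addnn addnK mulr_natl.
  apply: (@le_trans _ _ ((A * C) `^ (r / p) * \sum_(n <= j < n.*2) phi r (w j))); last first.
    by rewrite ler_wpM2l ?powR_ge0// tail_partial.
  rewrite mulr_sumr big_nat [leRHS]big_nat ler_sum// => j nj.
  have -> : phi r (w j) = (w j `^ p) `^ (r / p).
    by rewrite phiE// ger0_norm// -powRrM [p * _]mulrC divfK// gt_eqF.
  rewrite -powRM ?powR_ge0 ?mulr_ge0//; apply: ge0_ler_powR.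
  - by rewrite divr_ge0 ?(ltW r0) ?(ltW p0).
  - by rewrite nnegrE divr_ge0// ltW.
  - by rewrite nnegrE !mulr_ge0 ?powR_ge0.
  - exact: anl.
have vM : \sum_(0 <= m < N) phi r (v (f m)) <= B * tail r w n.
  rewrite -lee_fin (le_trans (sum_inj_le_mass _ _ (ltW r0) finj))//.
  rewrite (le_trans (Tr _ ur))// mass_uncut// -EFinM lee_fin.
  by rewrite ler_wpM2l.
apply: (@le_trans _ _ (\sum_(0 <= m < N | M m)
    (2 `^ r * (phi r (u (f m)) + phi r (v (f m)))))).
  apply: ler_sum => m _; rewrite /Y yuv fctE !phiE//.
  exact: powR_normD_le (ltW r0).
rewrite -mulr_sumr -mulrA ler_wpM2l// big_split/= mulrDl lerD//.
rewrite (le_trans _ vM)// [leLHS]big_mkcond ler_sum// => m _.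
by case: ifP => // _; exact: phi_ge0.
Qed.

End interpolation_sorted.

Section interpolation_finite.
Context {R : realType}.
Implicit Types (x y : nat -> R) (T : (nat -> R) -> (nat -> R)).

Lemma mass_null (r : R) x : 0 < r -> (mass r x < +oo)%E -> x @ \oo --> (0 : R).
Proof.
move=> r0 xr; apply/cvgrPdist_lt => e e0.
have [n0 n0P] := tail_small_lt xr (powR_gt0 r e0).
exists n0 => // n n0n /=; rewrite sub0r normrN ltNge.
apply/negP => en; have := n0P n n0n; rewrite ltNge => /negP; apply.
rewrite (tailS n xr) (@le_trans _ _ (phi r (x n)))// ?lerDl ?tail_ge0//.
by rewrite phiE// ge0_ler_powRE// ltW.
Qed.

Lemma tailZ (r a : R) x n : 0 < r -> 0 < a -> (mass r x < +oo)%E ->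
  tail r (a \*o x) n = a `^ r * tail r x n.
Proof.
move=> r0 a0 xr.
have axr : (mass r (a \*o x) < +oo)%E.
  by rewrite massM// -(mass_fineK xr) -EFinM ltry.
have := mass_tail n axr; rewrite massM// (mass_tail n xr) -EFinM gtr0_norm// => -[].
have -> : \sum_(0 <= k < n) phi r ((a \*o x) k) = a `^ r * \sum_(0 <= k < n) phi r (x k).
  by rewrite mulr_sumr; apply: eq_bigr => k _; rewrite /= phiM// gtr0_norm.
by rewrite mulrDr => /addrI.
Qed.

(** Rearranging the argument decreasingly is absorbed in the operator. *)
Lemma reduce_to_sorted (q : \bar R) (E : seqSpace R) (hI : Int 0%E q E)
    (P : ((nat -> R) -> (nat -> R)) -> Prop) (C : R) : 0 <= C ->
  (forall T d g, (forall j, `|d j| <= 1) -> inj_where d g -> P T ->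
     P (T \o winj d g)) ->
  (forall x T, carrier E x -> (forall n, 0 <= x n) -> (forall n, x n.+1 <= x n) ->
     P T -> carrier E (T x) /\ qnorm E (T x) <= C * qnorm E x) ->
  exists C' : R, forall x T, carrier E x -> x @ \oo --> (0 : R) -> P T ->
     carrier E (T x) /\ qnorm E (T x) <= C' * qnorm E x.
Proof.
move=> C0 Pw CP; have [D D0 DP] := winj_bounded hI.
exists (C * D) => x T xE xnull PT.
have [f [finj xS _ [c [d [g [[c1 cf] [d1 dg] xsE xE']]]]]] := decreasing_rearrangement xnull.
have [sE sN] := DP c f c1 cf x xE; rewrite -xsE in sE sN.
have := CP _ _ sE (fun n => normr_ge0 _) xS (Pw T d g d1 dg PT).
rewrite /comp -xE' => -[TE TN]; split=> //.
by rewrite (le_trans TN)// -mulrA ler_wpM2l.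
Qed.

(** By [tail_image_le] and [tail_transport], the rearrangement of T x is the image
    of a multiple of the averaging majorant, which lies in E. *)
Lemma bounded_interpolation_ge1 (r s p : R) (E : seqSpace R) T : 1 <= r ->
  Int 0%E r%:E E -> aoki_rolewicz_index E s -> 0 < p < s ->
  bounded_operators p%:E r%:E T -> bounded_map E T.
Proof.
move=> r1 hI hs ps [Tlin Tbr Tbp].
have r0 : 0 < r by lra.
have p0 : 0 < p by case/andP: ps.
have [/andP[_ q0] hE _ EQ _] := hI.
have T0 : T 0 = 0 by apply: linear_on0 Tlin; exact/carrier_ell0/ltW.
have [B B0 Tr] := (bounded_map_massP (ltW r0) T0).1 Tbr.
have [A A0 Tp] := (bounded_map_massP (ltW p0) T0).1 Tbp.
have [Cm [Bm [Cm0 Bm0 majP]]] := averaging_majorant hI hs ps.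
have [D D0 DP] := winj_bounded hI.
have [F F0 FP] := scaled_contraction_bounded hI.
have [K K1 KP] := N_add hE.
have K0 : 0 <= K by lra.
have sub_mass x : carrier E x -> (mass r x < +oo)%E.
  by case: EQ => + _ => /[apply] /(carrier_mass _ (ltW r0)).
pose C1 := 2 `^ r * ((A * Bm) `^ (r / p) + B) + 1.
have C10 : 0 < C1.
  by rewrite ltr_wpDl// mulr_ge0 ?powR_ge0// addr_ge0 ?powR_ge0.
(* The multiple of w whose tails are twice those that the estimate requires. *)
pose mu := (2 * C1) `^ r^-1.
have mu0 : 0 < mu by rewrite powR_gt0// mulr_gt0.
have muE : mu `^ r = 2 * C1 by rewrite powRVK ?gt_eqF// mulr_ge0// ltW.
pose P T' := [/\ linear_on (carrier (ell r%:E)) T',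
  (forall z, (mass r z < +oo)%E -> (mass r (T' z) <= B%:E * mass r z)%E) &
  (forall z, (mass p z < +oo)%E -> (mass p (T' z) <= A%:E * mass p z)%E)].
pose C2 := D * (K * (4 * D + F * 2) * (mu * Cm)).
have C20 : 0 <= C2.
  by rewrite /C2 !mulr_ge0 ?addr_ge0 ?mulr_ge0 ?(ltW D0) ?(ltW F0) ?(ltW mu0) ?(ltW Cm0).
have [||C' C'P] := @reduce_to_sorted _ E hI P C2 C20.
- move=> T' d g d1 dg [Tlin' Tr' Tp']; split.
  + move=> a x y xr yr; rewrite /= -Tlin'.
    * by congr T'; apply/funext => j; rewrite !fctE /= /winj mulrDr mulrCA.
    * have [_ + _] := contraction_winj q0 d1 dg.
      by move=> /(_ x xr) /carrier_size_le; apply=> //; exact: ltW.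
    * have [_ + _] := contraction_winj q0 d1 dg.
      by move=> /(_ y yr) /carrier_size_le; apply=> //; exact: ltW.
  + move=> z zr; have wz := mass_winj z (ltW r0) d1 dg.
    apply: (le_trans (Tr' _ (le_lt_trans wz zr))).
    by apply: lee_wpmul2l; rewrite ?lee_fin.
  + move=> z zr; have wz := mass_winj z (ltW p0) d1 dg.
    apply: (le_trans (Tp' _ (le_lt_trans wz zr))).
    by apply: lee_wpmul2l; rewrite ?lee_fin.
- move=> x T' xE x0 xS [Tlin' Tr' Tp'].
  have [w [wE wN xw wS wavg]] := majP x xE x0 xS.
  have xr := sub_mass x xE; have wr := sub_mass w wE.
  have yr : (mass r (T' x) < +oo)%E.
    by rewrite (le_lt_trans (Tr' x xr))// -(mass_fineK xr) -EFinM ltry.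
  have [f [finj yS _ [c [d [g [[c1 cf] [d1 dg] ysE yE]]]]]] :=
    decreasing_rearrangement (mass_null r0 yr).
  have tl := tail_image_le r1 hI hs ps A0 B0 (ltW Bm0) Tlin' Tr' Tp' wr x0 xw wavg finj yS.
  have w0 n : 0 <= w n by rewrite (le_trans (x0 n)).
  have mwE : carrier E (mu \*o w) by exact: E_scale.
  have [||||||d' [S [d'1 Sc ySE]]] := @tail_transport R r r1 (mu \*o w) (fun n => `|T' x (f n)|).
  + by move=> n /=; rewrite mulr_ge0// ltW.
  + by move=> n /=; rewrite ler_wpM2l// ltW.
  + by [].
  + exact: sub_mass.
  + rewrite ysE; have [_ /(_ (T' x)) + _] := contraction_winj q0 c1 cf.
    move=> h; apply: (le_lt_trans _ yr); apply: h.
    by apply/(carrier_mass _ (ltW r0)).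
  + move=> n; rewrite (le_trans (tl n))// tailZ// muE.
    have -> : 2 * C1 * tail r w n / 2 = C1 * tail r w n by field.
    by rewrite ler_wpM2r ?tail_ge0// lerDl.
  have [uE uN] := DP d' id d'1 (fun _ _ _ _ => id) _ mwE.
  have [SE SN] := FP S 2 (ltr0Sn _ _) Sc _ mwE.
  have ysinE : carrier E (fun n => `|T' x (f n)|).
    by rewrite ySE; apply: E_add => //; exact: E_scale.
  have [TE TN] := DP d g d1 dg _ ysinE; rewrite -yE in TE TN.
  split=> //; rewrite (le_trans TN)// /C2 -[leRHS]mulrA ler_wpM2l ?(ltW D0)//.
  have muN : qnorm E (mu \*o w) <= mu * Cm * qnorm E x.
    by rewrite N_scale// gtr0_norm// -mulrA ler_wpM2l// ltW.
  apply: (@le_trans _ _ (K * (4 * D + F * 2) * qnorm E (mu \*o w))); last first.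
    rewrite -[leRHS]mulrA ler_wpM2l//.
    by rewrite mulr_ge0// addr_ge0// mulr_ge0// ltW.
  rewrite ySE (le_trans (KP _ _ _ _))//; first exact: E_scale.
  rewrite -mulrA ler_wpM2l// mulrDl lerD//.
  by rewrite N_scale// ger0_norm// -mulrA ler_wpM2l.
apply: (bounded_map_intro hE (C := C')) => x xE; apply: C'P => //.
exact: mass_null r0 (sub_mass x xE).
Qed.

End interpolation_finite.

(** * The interpolation theorem for q <= 1 *)

Section subadditive_powers.
Context {R : realType}.

Lemma powR_normD_le1 (r a b : R) : 0 < r <= 1 ->
  `|a + b| `^ r <= `|a| `^ r + `|b| `^ r.
Proof.
move=> /andP[r0 r1]; have ab := ler_normD a b.
set c := `|a| + `|b| in ab; have c0 : 0 <= c by rewrite addr_ge0.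
apply: (@le_trans _ _ (c `^ r)).
  by apply: ge0_ler_powR; rewrite ?(ltW r0) ?nnegrE.
have [->|cn0] := eqVneq c 0; first by rewrite powR0 ?gt_eqF// addr_ge0 ?powR_ge0.
have cp : 0 < c by rewrite lt_neqAle eq_sym cn0.
have H t : 0 <= t -> t <= c -> t / c * c `^ r <= t `^ r.
  move=> t0 tc; have [->|tn0] := eqVneq t 0; first by rewrite !mul0r powR_ge0.
  have tp : 0 < t by rewrite lt_neqAle eq_sym tn0.
  have -> : t `^ r = (t / c) `^ r * c `^ r.
    by rewrite -powRM ?divr_ge0 ?divfK.
  rewrite ler_wpM2r ?powR_ge0// ger1_powR//.
  by rewrite divr_gt0//= ler_pdivrMr// mul1r.
have -> : c `^ r = `|a| / c * c `^ r + `|b| / c * c `^ r.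
  by rewrite -mulrDl -mulrDl divff// mul1r.
by rewrite lerD// H// /c ?lerDl ?lerDr.
Qed.

Lemma powR_norm_sum_le1 (r : R) (t : nat -> R) m n : 0 < r <= 1 ->
  `|\sum_(m <= k < n) t k| `^ r <= \sum_(m <= k < n) `|t k| `^ r.
Proof.
move=> r01; have r0 : 0 < r by case/andP: r01.
elim/big_ind2: _ => [|x1 x2 y1 y2 h1 h2|k _]//.
  by rewrite normr0 powR0// gt_eqF.
by rewrite (le_trans (powR_normD_le1 _ _ r01))// lerD.
Qed.

Lemma series_powR_le1 (r : R) (t : nat -> R) (M : R) : 0 < r <= 1 ->
  (forall n, \sum_(0 <= k < n) `|t k| `^ r <= M) ->
  cvgn (fun n => \sum_(0 <= k < n) t k) /\
  `|limn (fun n => \sum_(0 <= k < n) t k)| `^ r <= M.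
Proof.
move=> r01 tM; have r0 : 0 < r by case/andP: r01.
have M0 : 0 <= M by have := tM 0%N; rewrite big_geq.
have absM n : \sum_(0 <= k < n) `|t k| <= M `^ r^-1.
  rewrite -(ge0_ler_powRE r0) ?powR_ge0 ?sumr_ge0// powRVK ?gt_eqF//.
  apply: le_trans (tM n).
  have := powR_norm_sum_le1 (fun k => `|t k|) 0 n r01.
  rewrite ger0_norm ?sumr_ge0// => h; apply: (le_trans h).
  by apply: ler_sum => k _; rewrite normr_id.
have cn : cvgn [normed series t].
  have nd : nondecreasing_seq (fun n => \sum_(0 <= k < n) `|t k|).
    by apply/nondecreasing_seqP => n; rewrite big_nat_recr//= lerDl.
  by apply: (nondecreasing_is_cvgn nd); exists (M `^ r^-1) => _ [n _ <-].
have ct : cvgn (series t) := normed_cvg cn.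
split; first exact: ct.
rewrite -[leRHS](@powRVK _ r) ?gt_eqF// ge0_ler_powRE ?powR_ge0//.
apply: (le_trans (lim_series_norm cn)); apply: limr_le => //.
by apply: nearW => n; exact: absM.
Qed.

Lemma sum_powRN_gt1 (b : R) : 0 < b -> exists2 M : R, 0 <= M & forall n,
  \sum_(0 <= k < n) k.+1%:R `^ (- (1 + b)) <= M.
Proof.
move=> b0; exists (1 + b^-1); first by rewrite addr_ge0// invr_ge0 ltW.
have step (k : nat) : k.+2%:R `^ (- (1 + b)) <=
    (k.+1%:R `^ (- b) - k.+2%:R `^ (- b)) / b :> R.
  have k1 : 0 < k.+1%:R :> R by [].
  have k2 : 0 < k.+2%:R :> R by [].
  rewrite ler_pdivlMr//.
  have -> : - (1 + b) = - 1 + - b by ring.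
  rewrite powRD; last by rewrite (gt_eqF k2) implybT.
  rewrite powR_inv1//.
  have -> : k.+1%:R `^ (- b) = k.+2%:R `^ (- b) * (k.+1%:R / k.+2%:R) `^ (- b) :> R.
    by rewrite -powRM ?divr_ge0// mulrC divfK// gt_eqF.
  have tE : k.+1%:R / k.+2%:R = 1 + - k.+2%:R^-1 :> R.
    by rewrite -[in LHS](addrK 1 k.+1%:R) natr1 mulrBl divff ?gt_eqF// mul1r.
  have tp : 0 < k.+1%:R / k.+2%:R :> R by rewrite divr_gt0.
  have lnt : ln (k.+1%:R / k.+2%:R) <= - k.+2%:R^-1 :> R.
    by rewrite tE le_ln1Dx// ltrNl opprK invf_lt1// ltr1n.
  have h : 1 + b * k.+2%:R^-1 <= (k.+1%:R / k.+2%:R) `^ (- b) :> R.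
    rewrite /powR gt_eqF//; apply: le_trans (expR_ge1Dx _).
    by rewrite lerD2l mulNr lerNr -mulrN ler_wpM2l// ltW.
  rewrite -[X in _ - X]mulr1 -mulrBr mulrAC mulrC ler_wpM2l ?powR_ge0//.
  by rewrite lerBrDl mulrC.
move=> [|n]; first by rewrite big_geq// addr_ge0// invr_ge0 ltW.
rewrite big_ltn// powR1 lerD2l big_add1/=.
apply: (@le_trans _ _ ((1 - n.+1%:R `^ (- b)) / b)); last first.
  by rewrite ler_pdivrMr// mulVf ?gt_eqF// gerBl powR_ge0.
elim: n => [|n IH]; first by rewrite big_geq// powR1 subrr mul0r.
rewrite big_nat_recr//= (le_trans (lerD IH (step n)))// -mulrDl.
by rewrite addrA subrK.
Qed.

End subadditive_powers.

Section column_operators.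
Context {R : realType} (r : R) (r01 : 0 < r <= 1).
Context (f : nat -> nat) (c : nat -> R) (c1 : forall k, `|c k| <= 1).

Let r0 : 0 < r. Proof. by case/andP: r01. Qed.

(** The matrix whose k-th column is c k at row f k. *)
Definition colop (z : nat -> R) : nat -> R := fun i =>
  limn (fun n => \sum_(0 <= k < n) (if f k == i then c k * z k else 0)).

Let entry z i k := if f k == i then c k * z k else 0.

Let entry_le z i n : (mass r z < +oo)%E ->
  \sum_(0 <= k < n) `|entry z i k| `^ r <= fine (mass r z).
Proof.
move=> zr; rewrite -lee_fin mass_fineK// (le_trans _ (mass_partial r z 0 n))//.
rewrite lee_fin ler_sum// => k _; rewrite -phiE// phi_mono ?(ltW r0)//.
by rewrite /entry; case: ifP; rewrite ?normr0// normrM ler_piMl.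
Qed.

Lemma colop_cvg z i : (mass r z < +oo)%E ->
  (fun n => \sum_(0 <= k < n) (if f k == i then c k * z k else 0)) @ \oo --> colop z i.
Proof. by move=> zr; have [] := series_powR_le1 r01 (fun n => entry_le i n zr). Qed.

Lemma contraction_colop : contraction r%:E colop.
Proof.
have uniq k i i' : f k == i -> f k == i' -> i = i' by move=> /eqP <- /eqP.
have p0 (r' : R) z i k : (0 <= (if f k == i then phi r' (z k) else 0)%:E)%E.
  by case: ifP => _; rewrite lee_fin// phi_ge0.
split.
- move=> a x y /(carrier_mass _ (ltW r0)) xr /(carrier_mass _ (ltW r0)) yr.
  apply/funext => i; rewrite !fctE /=; apply/cvg_lim => //.
  have -> : (fun n => \sum_(0 <= k < n) (if f k == i then c k * (a * x k + y k) else 0))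
      = (fun n => a * \sum_(0 <= k < n) entry x i k + \sum_(0 <= k < n) entry y i k).
    apply/funext => n; rewrite mulr_sumr -big_split/=; apply: eq_bigr => k _.
    by rewrite /entry; case: ifP => _; rewrite ?mulr0 ?addr0//; ring.
  by apply: cvgD; [apply: cvgMr|]; exact: colop_cvg.
- move=> z /(carrier_mass _ (ltW r0)) zr; rewrite /size_le -[leRHS]mul1e.
  apply: (mass_sparse (I := fun i k => f k == i)) => // i; rewrite mul1e.
  set S := (\sum_(0 <= k <oo) _)%E.
  have S0 : (0 <= S)%E by exact: nneseries_ge0.
  have Sz : (S <= mass r z)%E.
    apply: lee_nneseries => k _ //.
    by rewrite lee_fin; case: ifP => _ //; exact: phi_ge0.
  have Sfin : (fine S)%:E = S by rewrite fineK// ge0_fin_numE// (le_lt_trans Sz).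
  rewrite -Sfin lee_fin phiE//.
  have [] // := @series_powR_le1 _ r (entry z i) (fine S) r01 _ => n.
  rewrite -lee_fin Sfin; apply: le_trans (nneseries_lim_ge n (fun k _ _ => p0 r z i k)).
  rewrite sumEFin lee_fin ler_sum// => k _; rewrite /entry; case: ifP => _.
    by rewrite -phiE// phi_mono ?(ltW r0)// normrM ler_piMl.
  by rewrite normr0 powR0// gt_eqF.
- move=> z _; rewrite -[leRHS]mul1e.
  apply: (mass_sparse (I := fun i k => f k == i)) => // i; rewrite mul1e.
  have [z0|] := pselect (forall k, f k == i -> z k = 0).
    have -> : colop z i = 0.
      apply/cvg_lim => //.
      have -> : (fun n => \sum_(0 <= k < n) (if f k == i then c k * z k else 0)) = fun=> 0.
        apply/funext => n; rewrite big1// => k _.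
        by case: ifP => // fk; rewrite z0// mulr0.
      exact: cvg_cst.
    by rewrite phi00 nneseries_ge0.
  move=> /existsNP[k0 /not_implyP[fk0 /eqP zk0]].
  apply: (@le_trans _ _ (1 : R)%:E); first by rewrite lee_fin phi0_le1.
  rewrite (nneseriesD1 (n := k0))// fk0.
  by rewrite {1}/phi eqxx zk0 leeDl// nneseries_ge0.
Qed.

End column_operators.

Section interpolation_le1.
Context {R : realType}.
Implicit Types (x : nat -> R) (T : (nat -> R) -> (nat -> R)) (q : \bar R).

Lemma cvg_sum_nat (g : nat -> nat -> R) (l : nat -> R) n :
  (forall m, g m @ \oo --> l m) ->
  (fun N => \sum_(0 <= m < n) g m N) @ \oo --> \sum_(0 <= m < n) l m.
Proof.
move=> gl; elim: n => [|n IH].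
  by under eq_fun do rewrite big_geq//; rewrite big_geq//; exact: cvg_cst.
under eq_fun do rewrite big_nat_recr//=.
by rewrite big_nat_recr//=; apply: cvgD.
Qed.

Lemma mass_unit_seq (r : R) k : mass r (unit_seq k) = 1%E.
Proof.
rewrite /mass (nneseriesD1 (n := k))//; last by move=> j _; rewrite lee_fin phi_ge0.
rewrite eseries0 ?adde0.
  by rewrite /unit_seq eqxx /phi oner_eq0 normr1 powR1; case: ifP.
by move=> j _ /negbTE jk; rewrite /unit_seq jk phi00.
Qed.

Lemma carrier_unit_seq q k : (0 <= q)%E -> carrier (ell q) (unit_seq k).
Proof.
case: q => [r| |]// r0.
  by apply/carrier_mass => //; rewrite mass_unit_seq ltry.
apply/carrier_inf; exists 1 => // j; rewrite /unit_seq.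
by case: eqP => _; rewrite ?normr1 ?normr0.
Qed.

(** The matrix of T determines T x only if T does not see the far terms of x; on
    l^oo this excludes, for instance, Banach limits. *)
Lemma coord_series q T x : (0 <= q)%E -> linear_on (carrier (ell q)) T ->
  (forall n, carrier (ell q) (cut n x)) -> (forall n, carrier (ell q) (uncut n x)) ->
  (forall i, (fun n => T (uncut n x) i) @ \oo --> (0 : R)) ->
  forall i, (fun n => \sum_(0 <= k < n) x k * T (unit_seq k) i) @ \oo --> T x i.
Proof.
move=> q0 Tlin cx ux ux0 i.
have T0 : T 0 = 0 := linear_on0 (carrier_ell0 q0) Tlin.
have Tcut n : T (cut n x) i = \sum_(0 <= k < n) x k * T (unit_seq k) i.
  elim: n => [|n IH].
    rewrite big_geq//; have -> : cut 0 x = 0 by apply/funext => k; rewrite /cut ltn0.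
    by rewrite T0.
  rewrite big_nat_recr//= -IH.
  have -> : cut n.+1 x = x n \*o unit_seq n + cut n x.
    apply/funext => k; rewrite !fctE /= /cut /unit_seq ltnS.
    by have [kn|kn|->] := ltngtP k n; rewrite ?mulr0 ?mulr1 ?addr0 ?add0r.
  by rewrite (Tlin _ _ _ (carrier_unit_seq n q0) (cx n)) addrC.
have -> : (fun n => \sum_(0 <= k < n) x k * T (unit_seq k) i) =
    (fun n => T x i - T (uncut n x) i).
  apply/funext => n; have TE : T x = T (cut n x) + T (uncut n x).
    by rewrite {1}(cut_uncut n x) (Tlin _ _ _ (cx n) (ux n)) mull1.
  by rewrite -Tcut TE fctE addrK.
by rewrite -[X in _ --> X]subr0; apply: cvgB; [exact: cvg_cst|exact: ux0].
Qed.

Lemma coord_series_mass (r B : R) T x : 0 < r -> 0 <= B ->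
  linear_on (carrier (ell r%:E)) T ->
  (forall z, (mass r z < +oo)%E -> (mass r (T z) <= B%:E * mass r z)%E) ->
  (mass r x < +oo)%E ->
  forall i, (fun n => \sum_(0 <= k < n) x k * T (unit_seq k) i) @ \oo --> T x i.
Proof.
move=> r0 B0 Tlin Tr xr.
have cr n : (mass r (cut n x) < +oo)%E by rewrite mass_cut ltry.
have ur n : (mass r (uncut n x) < +oo)%E by rewrite mass_uncut ?ltry.
apply: (coord_series _ Tlin).
- by rewrite lee_fin ltW.
- by move=> n; apply/(carrier_mass _ (ltW r0)).
- by move=> n; apply/(carrier_mass _ (ltW r0)).
move=> i; apply/cvgrPdist_lt => e e0.
have B1 : 0 < B + 1 by rewrite ltr_wpDl.
have e1 : 0 < e `^ r / (B + 1) by rewrite divr_gt0// powR_gt0.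
have [n0 n0P] := tail_small_lt xr e1.
exists n0 => // n n0n /=; rewrite sub0r normrN.
have := n0P n n0n; rewrite ltr_pdivlMr// => h.
have : phi r (T (uncut n x) i) <= B * tail r x n.
  rewrite -lee_fin (le_trans (phi_le_mass _ _ _))// (le_trans (Tr _ (ur n)))//.
  by rewrite mass_uncut.
rewrite phiE// => h2; rewrite ltNge -(ge0_ler_powRE r0) ?(ltW e0)// -ltNge.
apply: le_lt_trans h; rewrite (le_trans h2)// mulrC ler_wpM2l ?tail_ge0//.
by rewrite lerDl.
Qed.

(** For q <= 1 a single operator works for all x: the m-th summand keeps, in
    each column of the matrix of T, only its m-th largest entry. *)
Lemma bounded_interpolation_le1 (r s p : R) (E : seqSpace R) T : r <= 1 ->
  Int 0%E r%:E E -> aoki_rolewicz_index E s -> 0 < p < s ->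
  bounded_operators p%:E r%:E T -> bounded_map E T.
Proof.
move=> r1 hI hs ps [Tlin Tbr Tbp].
have p0 : 0 < p by case/andP: ps.
have [/andP[_ q0] hE _ EQ _] := hI.
have r0 : 0 < r by rewrite -lte_fin.
have r01 : 0 < r <= 1 by rewrite r0.
have s0 : 0 < s by case: hs.
have T0 : T 0 = 0 by apply: linear_on0 Tlin; exact/carrier_ell0/ltW.
have [B B0 Tr] := (bounded_map_massP (ltW r0) T0).1 Tbr.
have [A A0 Tp] := (bounded_map_massP (ltW p0) T0).1 Tbp.
pose A1 := A + 1; have A10 : 0 < A1 by rewrite /A1 ltr_wpDl.
pose a k := T (unit_seq k).
have am k : (mass p (a k) <= A%:E)%E.
  by rewrite (le_trans (Tp _ _)) ?mass_unit_seq ?mule1 ?ltry.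
have anull k : a k @ \oo --> (0 : R).
  by apply: (mass_null p0); rewrite (le_lt_trans (am k))// ltry.
have [f fP] := choice (fun k => decreasing_rearrangement (anull k)).
(* The bound for the m-th largest of terms whose p-th powers add up to A1. *)
pose h m := (A1 / m.+1%:R) `^ p^-1.
have h0 m : 0 < h m by rewrite powR_gt0// divr_gt0.
have hmono m n : (m <= n)%N -> h n <= h m.
  move=> mn; apply: ge0_ler_powR; rewrite ?invr_ge0 ?nnegrE ?divr_ge0 ?(ltW p0) ?(ltW A10)//.
  by rewrite ler_wpM2l ?(ltW A10)// lef_pV2 ?posrE// ler_nat.
have af k m : `|a k (f k m)| <= h m.
  have [finj /nonincreasing_seqP fS _ _] := fP k.
  rewrite -(ge0_ler_powRE p0) ?(ltW (h0 m))// powRVK ?gt_eqF ?divr_ge0 ?(ltW A10)//.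
  rewrite ler_pdivlMr// (@le_trans _ _ A)//; last by rewrite lerDl.
  rewrite -lee_fin (le_trans _ (am k))//.
  apply: le_trans (sum_inj_le_mass (a k) m.+1 (ltW p0) finj); rewrite lee_fin.
  rewrite mulr_natr -[m.+1 in leLHS]subn0 -sumr_const_nat big_nat [leRHS]big_nat.
  apply: ler_sum => i im; rewrite phiE// ge0_ler_powRE//.
  by apply: fS; move: im; rewrite ltnS.
pose cc m k := a k (f k m) / h m.
have cc1 m k : `|cc m k| <= 1.
  by rewrite normrM normfV (gtr0_norm (h0 m)) ler_pdivrMr// mul1r.
have [C C0 CP] := contractions_uniformly_bounded hI.
have [K K0 KP] := N_series_powR hE q0 EQ hs.
have b0 : 0 < s / p - 1.
  by rewrite subr_gt0 ltr_pdivlMr// mul1r; case/andP: ps.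
have [M M0 MP] := sum_powRN_gt1 b0.
pose D := K * (C `^ s * A1 `^ (s / p) * M) `^ s^-1.
apply: (bounded_map_intro hE (C := D)) => x xE.
have xr : (mass r x < +oo)%E.
  by case: EQ => /(_ x xE) /(carrier_mass _ (ltW r0)).
pose u m := h m \*o colop (f ^~ m) (cc m) x.
have uP m : carrier E (u m) /\ qnorm E (u m) <= h m * (C * qnorm E x).
  have [vE vN] := CP _ (contraction_colop r01 (f ^~ m) (cc1 m)) x xE.
  split; first exact: E_scale.
  by rewrite N_scale// gtr0_norm// ler_wpM2l// ltW.
have CN0 : 0 <= C * qnorm E x by rewrite mulr_ge0 ?(N_ge0 hE)// ltW.
have [|||i|TE TN] := KP u (T x)
    (fun m => (C * qnorm E x) `^ s * A1 `^ (s / p) * m.+1%:R `^ (- (1 + (s / p - 1))))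
    ((C * qnorm E x) `^ s * A1 `^ (s / p) * M).
- by move=> m; have [] := uP m.
- move=> m; have [uE uN] := uP m.
  apply: (@le_trans _ _ ((h m * (C * qnorm E x)) `^ s)).
    by rewrite ge0_ler_powRE ?(N_ge0 hE uE)// mulr_ge0 ?(ltW (h0 m)).
  rewrite powRM ?(ltW (h0 m))// mulrC -mulrA ler_wpM2l ?powR_ge0//.
  rewrite subrKC /h -powRrM [p^-1 * s]mulrC powRM ?invr_ge0 ?(ltW A10)//.
  have -> : (m.+1%:R^-1 : R) `^ (s / p) = m.+1%:R `^ (- (s / p)).
    by rewrite -powR_inv1// -powRrM mulN1r.
  by [].
- by move=> n; rewrite -mulr_sumr ler_wpM2l ?mulr_ge0 ?powR_ge0.
- pose G := fine (mass r x) `^ r^-1.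
  have G0 : 0 <= G by exact: powR_ge0.
  (* What is left after n summands has entries of size at most h n. *)
  have diff n : `|T x i - \sum_(0 <= m < n) u m i| <= h n * G.
    pose d k := x k * a k i -
      \sum_(0 <= m < n) h m * (if f k m == i then cc m k * x k else 0).
    have dle k : `|d k| <= h n * `|x k|.
      have [finj _ fsurj _] := fP k.
      have off m : f k m != i -> h m * (if f k m == i then cc m k * x k else 0) = 0.
        by move=> /negbTE ->; rewrite mulr0.
      have [[m mn fkm]|nom] := pselect (exists2 m, (m < n)%N & f k m = i).
        rewrite /d (big_rem m)/= ?mem_index_iota// big_seq big1 ?addr0; last first.
          move=> j; rewrite mem_rem_uniq ?iota_uniq// inE => /andP[jm _].
          by apply: off; apply: contraNN jm => /eqP; rewrite -fkm => /finj ->.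
        rewrite fkm eqxx /cc fkm mulrA mulrCA mulfV ?gt_eqF// mulr1 mulrC subrr.
        by rewrite normr0 mulr_ge0// ltW.
      rewrite /d big_nat big1 ?subr0; last first.
        by move=> m mn; apply: off; apply/eqP => fkm; apply: nom; exists m.
      rewrite normrM mulrC ler_wpM2r//.
      have [->|aki] := eqVneq (a k i) 0; first by rewrite normr0 ltW.
      have [m fkm] := fsurj i aki; rewrite -fkm (le_trans (af k m))// hmono//.
      by rewrite leqNgt; apply/negP => mn; apply: nom; exists m.
    have dlim : (fun N => \sum_(0 <= k < N) d k) @ \oo --> T x i - \sum_(0 <= m < n) u m i.
      have -> : (fun N => \sum_(0 <= k < N) d k) =
          (fun N => \sum_(0 <= k < N) x k * a k i - \sum_(0 <= m < n) h m *
             (\sum_(0 <= k < N) (if f k m == i then cc m k * x k else 0))).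
        apply/funext => N; rewrite sumrB; congr (_ - _); rewrite exchange_big/=.
        by apply: eq_bigr => m _; rewrite mulr_sumr.
      apply: cvgB; first exact: (coord_series_mass r0 B0 Tlin Tr xr).
      apply: (@cvg_sum_nat (fun m N => h m *
        \sum_(0 <= k < N) (if f k m == i then cc m k * x k else 0))
        (fun m => h m * colop (f ^~ m) (cc m) x i)) => m.
      apply: cvgMr; have := @colop_cvg _ r r01 (f ^~ m) (cc m) (cc1 m) x i xr.
      exact.
    have [|_] := @series_powR_le1 _ r d ((h n) `^ r * fine (mass r x)) r01.
    + move=> N; apply: (@le_trans _ _ ((h n) `^ r * \sum_(0 <= k < N) phi r (x k))).
        rewrite mulr_sumr ler_sum// => k _; rewrite phiE// -powRM ?(ltW (h0 n))//.
        by rewrite ge0_ler_powRE ?mulr_ge0 ?(ltW (h0 n)).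
      rewrite ler_wpM2l ?powR_ge0// -lee_fin mass_fineK//.
      exact: mass_partial.
    rewrite (cvg_lim _ dlim)// => hle.
    rewrite -(ge0_ler_powRE r0) ?mulr_ge0 ?(ltW (h0 n))// powRM ?(ltW (h0 n))//.
    by rewrite powRVK ?gt_eqF// fine_ge0// mass_ge0.
  apply/cvgrPdist_le => e e0.
  have G1 : 0 < G + 1 by rewrite ltr_wpDl.
  have eG : 0 < (e / (G + 1)) `^ p by rewrite powR_gt0// divr_gt0.
  exists (Num.truncn (A1 / (e / (G + 1)) `^ p)) => // n nN /=.
  rewrite (le_trans (diff n))//.
  have hn : h n <= e / (G + 1).
    rewrite -(ge0_ler_powRE p0) ?divr_ge0 ?(ltW e0) ?(ltW G1) ?(ltW (h0 n))//.
    rewrite powRVK ?gt_eqF ?divr_ge0 ?(ltW A10)// ler_pdivrMr// mulrC -ler_pdivrMr//.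
    by rewrite (le_trans (ltW (truncnS_gt _)))// ler_nat ltnS.
  rewrite (le_trans (ler_wpM2r G0 hn))// mulrAC ler_pdivrMr// ler_wpM2l ?(ltW e0)//.
  by rewrite lerDl.
split=> //; rewrite (le_trans TN)// /D -[leRHS]mulrA ler_wpM2l ?(ltW K0)//.
rewrite (powRM _ (ltW C0) (N_ge0 hE xE)).
have -> : C `^ s * qnorm E x `^ s * A1 `^ (s / p) * M =
   C `^ s * A1 `^ (s / p) * M * qnorm E x `^ s by ring.
rewrite [leLHS]powRM ?mulr_ge0 ?powR_ge0//.
by rewrite powRKV ?gt_eqF// (N_ge0 hE xE).
Qed.

End interpolation_le1.

(** * The interpolation theorem for q = +oo *)

Section interpolation_infinite.
Context {R : realType} (E : seqSpace R) (hI : Int 0%E +oo%E E).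
Context (s p : R) (hs : aoki_rolewicz_index E s) (ps : 0 < p < s).
Context (T : (nat -> R) -> (nat -> R)) (Tb : bounded_operators p%:E +oo%E T).

Let q0 : (0 < +oo :> \bar R)%E. Proof. by case: hI => /andP[]. Qed.
Let hE : quasi_banach E. Proof. by case: hI. Qed.
Let EQ : continuous_inclusion E (ell +oo%E). Proof. by case: hI. Qed.
Let p0 : 0 < p. Proof. by case/andP: ps. Qed.
Let Tlin : linear_on (carrier (ell +oo%E)) T. Proof. by case: Tb. Qed.
Let T0 : T 0 = 0. Proof. exact: linear_on0 (carrier_ell0 (ltW q0)) Tlin. Qed.

(** If E is not contained in c_0, every bounded sequence is a weighted injective
    image of one element of E, so that E is l^oo with an equivalent norm. *)
Lemma bounded_not_null x0 : carrier E x0 -> ~ (x0 @ \oo --> (0 : R)) -> bounded_map E T.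
Proof.
move=> x0E nx0.
have [d d0 far] : exists2 d : R, 0 < d & forall N, exists k, (N <= k)%N /\ d <= `|x0 k|.
  apply: contrapT => H; apply: nx0; apply/cvgrPdist_lt => e e0.
  apply: contrapT => Hn; apply: H; exists e => // N.
  apply: contrapT => HN; apply: Hn; exists N => // n Nn /=.
  by rewrite sub0r normrN ltNge; apply/negP => en; apply: HN; exists n.
have [g gP] := choice far.
pose f n := iter n (fun k => g k.+1) (g 0%N).
have fS n : (f n < f n.+1)%N by have [] := gP (f n).+1.
have fd n : d <= `|x0 (f n)| by case: n => [|n]; [have [] := gP 0%N|have [] := gP (f n).+1].
have flt : {homo f : i j / (i < j)%N} by apply: homo_ltn => //; exact: ltn_trans.
have finj : injective f.
  by move=> i j fij; case: (ltngtP i j) => // /flt; rewrite fij ltnn.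
have [D D0 DP] := winj_bounded hI.
pose G := D * qnorm E x0 / d.
have big (y : nat -> R) (M : R) : 0 < M -> (forall k, `|y k| <= M) ->
    carrier E y /\ qnorm E y <= G * M.
  move=> M0 yM; pose c j := d / M * (y j / x0 (f j)).
  have x0f j : 0 < `|x0 (f j)| := lt_le_trans d0 (fd j).
  have c1 j : `|c j| <= 1.
    rewrite /c !normrM !normfV (gtr0_norm d0) (gtr0_norm M0) mulrACA.
    by rewrite -invfM ler_pdivrMr ?mulr_gt0// mul1r mulrC ler_pM// ltW.
  have [wE wN] := DP c f c1 (fun j j' _ _ => finj j j') x0 x0E.
  have yE : y = (M / d) \*o winj c f x0.
    apply/funext => j; rewrite /= /winj /c; field.
    by rewrite -normr_gt0 x0f !gt_eqF.
  split; first by rewrite yE; exact: E_scale.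
  rewrite {1}yE N_scale// gtr0_norm ?divr_gt0//.
  apply: (le_trans (ler_wpM2l _ wN)); first by rewrite divr_ge0 ?ltW.
  by rewrite le_eqVlt; apply/orP; left; apply/eqP; rewrite /G; ring.
have [_ Tq _] := Tb; have [B B0 TB] := (bounded_map_infP T0).1 Tq.
have [C C0 CP] := coord_le_N hE q0 EQ.
apply: (bounded_map_intro hE (C := G * ((B + 1) * C))) => x xE.
have [->|/eqP xn0] := eqVneq x 0.
  by rewrite T0 N_zero// mulr0; split=> //; exact: E_zero.
have Nx := N_gt0 hE xE xn0.
rewrite -mulrA; apply: big; first by rewrite !mulr_gt0// ltr_wpDl.
move=> k; rewrite (le_trans (TB x _ (fun k => CP x k xE) k))// -mulrA.
by rewrite ler_wpM2r ?lerDl// mulr_ge0 ?ltW.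
Qed.

(** Cutting a nonincreasing x at rank n, the image of the first part exceeds a
    multiple of w n at no more than n places, and the image of the rest exceeds
    B x n nowhere: the rearrangement of T x is pointwise dominated by w. *)
Lemma bounded_all_null : (forall x, carrier E x -> x @ \oo --> (0 : R)) -> bounded_map E T.
Proof.
move=> Enull.
have [_ Tq Tbp] := Tb; have [B B0 TB] := (bounded_map_infP T0).1 Tq.
have [A A0 TA] := (bounded_map_massP (ltW p0) T0).1 Tbp.
have [Cm [Bm [Cm0 Bm0 majP]]] := averaging_majorant hI hs ps.
have [D D0 DP] := winj_bounded hI.
pose P T' := [/\ linear_on (carrier (ell +oo%E)) T',
  (forall z (M : R), (forall k, `|z k| <= M) -> forall k, `|T' z k| <= B * M) &
  (forall z, (mass p z < +oo)%E -> (mass p (T' z) <= A%:E * mass p z)%E)].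
pose C1 := (A * Bm) `^ p^-1 + B + 1.
have C10 : 0 < C1 by rewrite /C1 ltr_wpDl// addr_ge0// powR_ge0.
pose C2 := D * (C1 * (D * Cm)).
have C20 : 0 <= C2 by rewrite !mulr_ge0 ?(ltW D0) ?(ltW C10) ?(ltW Cm0).
have [||C' C'P] := @reduce_to_sorted _ +oo%E E hI P C2 C20.
- move=> T' d g d1 dg [Tlin' TB' TA']; split.
  + move=> a x y xr yr; rewrite /= -Tlin'.
    * by congr T'; apply/funext => j; rewrite !fctE /= /winj mulrDr mulrCA.
    * have [_ + _] := contraction_winj q0 d1 dg.
      by move=> /(_ x xr) /carrier_size_le; apply.
    * have [_ + _] := contraction_winj q0 d1 dg.
      by move=> /(_ y yr) /carrier_size_le; apply.
  + move=> z M zM k; apply: TB' => j; rewrite /winj normrM (le_trans _ (zM (g j)))//.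
    by rewrite ler_piMl.
  + move=> z zr; have wz := mass_winj z (ltW p0) d1 dg.
    apply: (le_trans (TA' _ (le_lt_trans wz zr))).
    by apply: lee_wpmul2l; rewrite ?lee_fin.
- move=> x T' xE x0 xS [Tlin' TB' TA'].
  have [w [wE wN xw wS wavg]] := majP x xE x0 xS.
  have w0 n : 0 <= w n by rewrite (le_trans (x0 n)).
  move/nonincreasing_seqP : (xS) => xmono.
  have cinf n : carrier (ell +oo%E) (cut n x).
    apply/carrier_inf; exists (x 0%N) => // k; rewrite /cut; case: ifP => _.
      by rewrite ger0_norm// xmono.
    by rewrite normr0.
  have unle n k : `|uncut n x k| <= x n.
    rewrite /uncut; case: ltnP => nk; first by rewrite normr0.
    by rewrite ger0_norm// xmono.
  have uinf n : carrier (ell +oo%E) (uncut n x).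
    by apply/carrier_inf; exists (x n).
  have split n : T' x = T' (cut n x) + T' (uncut n x).
    by rewrite {1}(cut_uncut n x) Tlin' ?mull1.
  have vle n k : `|T' (uncut n x) k| <= B * x n by exact: TB'.
  pose a n := A * \sum_(0 <= k < n) x k `^ p.
  have a0 n : 0 <= a n by rewrite mulr_ge0// sumr_ge0// => k _; exact: powR_ge0.
  have ua n : (mass p (T' (cut n x)) <= (a n)%:E)%E.
    rewrite (le_trans (TA' _ _)) ?mass_cut ?ltry// -EFinM lee_fin.
    by rewrite ler_wpM2l// ler_sum// => k _; rewrite phiE// ger0_norm.
  have ynull : T' x @ \oo --> (0 : R).
    apply/cvgrPdist_lt => e e0.
    have e2 : 0 < e / 2 / (B + 1) by rewrite !divr_gt0// ltr_wpDl.
    move/cvgrPdist_lt : (Enull x xE) => /(_ _ e2) [n _ nP].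
    have := nP n (leqnn n); rewrite /= sub0r normrN ger0_norm// ltr_pdivlMr ?ltr_wpDl// => xn.
    have un : T' (cut n x) @ \oo --> (0 : R).
      by apply: (mass_null p0); rewrite (le_lt_trans (ua n))// ltry.
    move/cvgrPdist_lt : un => /(_ (e / 2)); rewrite divr_gt0// => /(_ isT) [N _ NP].
    exists N => // k Nk /=; have := NP k Nk; rewrite /= !sub0r !normrN => uk.
    rewrite (split n) fctE (le_lt_trans (ler_normD _ _))// [ltRHS](splitr e).
    rewrite ltr_leD// (le_trans (vle n k))// (le_trans _ (ltW xn))// mulrC.
    by rewrite ler_wpM2l// lerDl.
  have [f [finj yS _ [c [d [g [[c1 cf] [d1 dg] ysE yE]]]]]] := decreasing_rearrangement ynull.
  move/nonincreasing_seqP : (yS) => ymono.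
  have yw n : `|T' x (f n)| <= C1 * w n.
    have [->|n0] := posnP n.
      apply: (@le_trans _ _ (B * x 0%N)).
        by apply: TB' => k; rewrite ger0_norm// xmono.
      rewrite ler_pM// /C1; have := powR_ge0 (A * Bm) p^-1; move: B0; lra.
    have nR : 0 < n%:R :> R by rewrite ltr0n.
    pose l := (a n / n%:R) `^ p^-1.
    have [m mn ml] : exists2 m, (m <= n)%N & `|T' (cut n x) (f m)| <= l.
      apply: contrapT => Hn.
      have := count_large_le n.+1 p0 (a0 n) n0 finj (ua n).
      rewrite big_nat (eq_bigr (fun=> 1%N)); last first.
        move=> m mn; case: leP => // ml; case: Hn; exists m => //.
      by rewrite -big_nat sum_nat_const_nat subn0 muln1 ltnn.
    have lw : l <= (A * Bm) `^ p^-1 * w n.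
      have -> : (A * Bm) `^ p^-1 * w n = (A * Bm * w n `^ p) `^ p^-1.
        by rewrite [RHS]powRM ?mulr_ge0 ?powR_ge0 ?(ltW Bm0)// powRKV ?gt_eqF.
      apply: ge0_ler_powR.
      - by rewrite invr_ge0 ltW.
      - by rewrite nnegrE divr_ge0// ltW.
      - by rewrite nnegrE !mulr_ge0 ?powR_ge0// ltW.
      rewrite ler_pdivrMr// /a -!mulrA ler_wpM2l// [X in Bm * X]mulrC mulrA wavg//.
      by rewrite leqnn -addnn -[ltnLHS]addn0 ltn_add2l.
    rewrite (le_trans (ymono _ _ mn))// (split n) fctE (le_trans (ler_normD _ _))//.
    apply: (@le_trans _ _ ((A * Bm) `^ p^-1 * w n + B * w n)).
      rewrite lerD ?(le_trans ml)// (le_trans (vle _ _))// ler_wpM2l//.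
    by rewrite -mulrDl ler_wpM2r// /C1 lerDl.
  pose e j := `|T' x (f j)| / (C1 * w j).
  have e1 j : `|e j| <= 1.
    have Cw : 0 <= C1 * w j by rewrite mulr_ge0// ltW.
    rewrite /e ger0_norm ?divr_ge0//.
    have [->|wn] := eqVneq (C1 * w j) 0; first by rewrite invr0 mulr0.
    by rewrite ler_pdivrMr ?mul1r// lt_neqAle eq_sym wn.
  have [uE uN] := DP e id e1 (fun _ _ _ _ => id) w wE.
  have ysE' : (fun n => `|T' x (f n)|) = C1 \*o winj e id w.
    apply/funext => n; rewrite /= /winj /e.
    have [wn|wn] := eqVneq (w n) 0.
      have := yw n; rewrite wn mulr0 normr_le0 => /eqP ->.
      by rewrite normr0 !mulr0.
    by field; rewrite wn gt_eqF.
  have ysinE : carrier E (fun n => `|T' x (f n)|) by rewrite ysE'; exact: E_scale.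
  have [TE TN] := DP d g d1 dg _ ysinE; rewrite -yE in TE TN.
  split=> //; rewrite (le_trans TN)// /C2 -[leRHS]mulrA ler_wpM2l ?(ltW D0)//.
  rewrite ysE' N_scale// gtr0_norm// -mulrA ler_wpM2l ?(ltW C10)//.
  by rewrite (le_trans uN)// -mulrA ler_wpM2l ?(ltW D0).
by apply: (bounded_map_intro hE (C := C')) => x xE; apply: C'P => //; exact: Enull.
Qed.

Lemma bounded_interpolation_infinite : bounded_map E T.
Proof.
have [all0|] := pselect (forall x, carrier E x -> x @ \oo --> (0 : R)).
  exact: bounded_all_null.
by move=> /existsNP[x /not_implyP[xE xn]]; exact: bounded_not_null xE xn.
Qed.

End interpolation_infinite.

(** * Operators bounded on the endpoint spaces *)

Section endpoint_operators.
Context {R : realType}.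
Implicit Types (x : nat -> R) (T : (nat -> R) -> (nat -> R)).

Lemma mass0_finite x : (mass 0 x < +oo)%E -> exists n, x = cut n x.
Proof.
move=> x0; have [n nP] := tail_small_lt x0 (ltr01 : 0 < 1 :> R); exists n.
apply/funext => k; rewrite /cut; case: ltnP => // nk.
have h : phi 0 (x k) < 1.
  by apply: le_lt_trans (nP k nk); rewrite (tailS k x0) lerDl tail_ge0.
by move: h; rewrite /phi eqxx; have [//|_] := eqVneq (x k) 0; rewrite ltxx.
Qed.

Lemma mass_lty_incr (p r : R) x : 0 < p -> p <= r -> (mass p x < +oo)%E ->
  (mass r x < +oo)%E.
Proof.
move=> p0 pr xp; have r0 : 0 < r := lt_le_trans p0 pr.
pose M := fine (mass p x) `^ p^-1.
have xM k : `|x k| <= M.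
  by apply: (coord_le_mass _ p0); rewrite ?powR_ge0// powRVK ?gt_eqF ?fine_ge0
    ?mass_ge0// mass_fineK.
apply: (@le_lt_trans _ _ ((M `^ (r - p))%:E * mass p x)%E); last first.
  by rewrite -(mass_fineK xp) -EFinM ltry.
rewrite /mass -nneseriesZl; last by move=> k _; rewrite lee_fin phi_ge0.
apply: lee_nneseries => k _; first by move=> _; rewrite lee_fin phi_ge0.
by rewrite -EFinM lee_fin !phiE// mulrC powR_split.
Qed.

Lemma ell_sub_inf (q : \bar R) x : (0 < q)%E -> carrier (ell q) x -> carrier (ell +oo%E) x.
Proof.
case: q => [r| |]// r0 /carrier_mass; rewrite lte_fin in r0 => /(_ (ltW r0)) xr.
apply/carrier_inf; exists (fine (mass r x) `^ r^-1); first exact: powR_ge0.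
move=> k; apply: (coord_le_mass _ r0); rewrite ?powR_ge0// powRVK ?gt_eqF ?fine_ge0 ?mass_ge0//.
by rewrite mass_fineK.
Qed.

(** Since t^p is subadditive for p <= 1, the rows give a double series, which is
    then summed by columns. *)
Lemma mass_columns_le (p A : R) T x : 0 < p <= 1 -> 0 <= A ->
  (forall k, (mass p (T (unit_seq k)) <= A%:E)%E) ->
  (forall i, (fun n => \sum_(0 <= k < n) x k * T (unit_seq k) i) @ \oo --> T x i) ->
  (mass p x < +oo)%E -> (mass p (T x) <= A%:E * mass p x)%E.
Proof.
move=> p01 A0 cA Tx xp; have p0 : 0 < p by case/andP: p01.
pose b i k : \bar R := (phi p (x k) * phi p (T (unit_seq k) i))%:E.
have b0 i k : (0 <= b i k)%E by rewrite lee_fin mulr_ge0 ?phi_ge0.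
have cols : (\sum_(0 <= i <oo) \sum_(0 <= k <oo) b i k <= A%:E * mass p x)%E.
  rewrite nneseries_interchange// /mass -nneseriesZl; last first.
    by move=> k _; rewrite lee_fin phi_ge0.
  apply: lee_nneseries => k _; first by move=> _; exact: nneseries_ge0.
  under eq_eseriesr do rewrite /b EFinM.
  rewrite nneseriesZl; last by move=> i _; rewrite lee_fin phi_ge0.
  by rewrite [leRHS]muleC; apply: lee_wpmul2l; [rewrite lee_fin phi_ge0|exact: cA].
apply: le_trans cols; apply: lee_nneseries => i _.
  by move=> _; rewrite lee_fin phi_ge0.
set S := (\sum_(0 <= k <oo) b i k)%E.
have S0 : (0 <= S)%E by exact: nneseries_ge0.
case E : S S0 => [v| |]// v0; last by rewrite leey.
rewrite lee_fin phiE//.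
have [|_] := @series_powR_le1 _ p (fun k => x k * T (unit_seq k) i) v p01.
  move=> n; rewrite -lee_fin -E.
  apply: le_trans (nneseries_lim_ge n (fun k _ _ => b0 i k)).
  rewrite sumEFin lee_fin ler_sum// => k _.
  by rewrite normrM powRM// !phiE.
by rewrite (cvg_lim _ (Tx i)).
Qed.

(** The columns of T are images of unit vectors: they have boundedly many nonzero
    entries because T is bounded on l^0, and these are bounded because T is
    bounded on l^q. *)
Lemma bounded_operators_zero_p (p : R) (q : \bar R) T : 0 < p <= 1 -> (p%:E < q)%E ->
  bounded_operators 0%E q T -> bounded_operators p%:E q T.
Proof.
move=> p01 pq [Tlin Tq Tz]; have /andP[p0 p1] := p01.
have q0 : (0 < q)%E by apply: lt_trans pq; rewrite lte_fin.
have T0 : T 0 = 0 := linear_on0 (carrier_ell0 (ltW q0)) Tlin.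
split=> //; have [N N0 TN] := (bounded_map_massP (lexx 0) T0).1 Tz.
have [B B0 [TB Tx]] : exists2 B : R, 0 <= B &
    (forall k i, `|T (unit_seq k) i| <= B) /\
    forall x, (mass p x < +oo)%E -> forall i,
      (fun n => \sum_(0 <= k < n) x k * T (unit_seq k) i) @ \oo --> T x i.
  case: q pq q0 Tlin Tq => [r| |]// pr r0 Tlin Tq.
    rewrite lte_fin in r0; rewrite lte_fin in pr.
    have [B B0 TB] := (bounded_map_massP (ltW r0) T0).1 Tq.
    exists (B `^ r^-1); first exact: powR_ge0.
    split=> [k i|x xp i].
      apply: (coord_le_mass _ r0); rewrite ?powR_ge0// powRVK ?gt_eqF//.
      by rewrite (le_trans (TB _ _)) ?mass_unit_seq ?ltry// mule1.
    apply: (coord_series_mass r0 B0 Tlin TB).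
    exact: mass_lty_incr p0 (ltW pr) xp.
  have [B B0 TB] := (bounded_map_infP T0).1 Tq.
  have ek k j : `|unit_seq k j| <= 1 :> R.
    by rewrite /unit_seq; case: eqP => _; rewrite ?normr1 ?normr0.
  exists B => //; split=> [k i|x xp i]; first by rewrite (le_trans (TB _ 1 (ek k) i))// mulr1.
  have [M M0 xM] : exists2 M : R, 0 <= M & forall k, `|x k| <= M.
    by apply/carrier_inf; apply: (@ell_sub_inf p%:E); rewrite ?lte_fin//; apply/carrier_mass => //; exact: ltW.
  apply: (coord_series _ Tlin) => //.
  - move=> n; apply/carrier_inf; exists M => // k.
    by rewrite /cut; case: ifP => _; rewrite ?normr0.
  - move=> n; apply/carrier_inf; exists M => // k.
    by rewrite /uncut; case: ifP => _; rewrite ?normr0.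
  move=> j; apply/cvgrPdist_lt => e e0.
  have B1 : 0 < B + 1 by rewrite ltr_wpDl.
  have e1 : 0 < e / (B + 1) by rewrite divr_gt0.
  move/cvgrPdist_lt : (mass_null p0 xp) => /(_ _ e1) [n0 _ n0P].
  exists n0 => // n n0n /=; rewrite sub0r normrN.
  apply: (@le_lt_trans _ _ (B * (e / (B + 1)))).
    apply: TB => k; rewrite /uncut; case: ltnP => nk; first by rewrite normr0 ltW.
    by have := n0P k (leq_trans n0n nk); rewrite /= sub0r normrN => /ltW.
  by rewrite mulrA ltr_pdivrMr// mulrC ltr_pM2l// ltrDl.
apply/(bounded_map_massP (ltW p0) T0); exists (B `^ p * N).
  by rewrite mulr_ge0 ?powR_ge0.
move=> x xp; apply: mass_columns_le => //.
- by rewrite mulr_ge0 ?powR_ge0.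
- move=> k; have := TN _ (mass0_unit_seq k); rewrite mass_unit_seq mule1 => h.
  rewrite EFinM (le_trans _ (lee_wpmul2l _ h)) ?lee_fin ?powR_ge0//.
  rewrite /mass -nneseriesZl; last by move=> i _; rewrite lee_fin phi_ge0.
  apply: lee_nneseries => i _; first by move=> _; rewrite lee_fin phi_ge0.
  rewrite -EFinM lee_fin; have [->|tn] := eqVneq (T (unit_seq k) i) 0.
    by rewrite !phi00 mulr0.
  rewrite [X in _ * X]/phi eqxx tn mulr1 phiE//.
  by apply: ge0_ler_powR; rewrite ?(ltW p0) ?nnegrE.
- by move=> i; exact: Tx.
Qed.

(** The heights below t form a geometric progression whose first term is at most
    t; the induction drops the heights above t one by one. *)
Lemma sum_levels_le (d t : R) n : 0 < d -> 0 <= t -> forall M, 0 <= M ->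
  \sum_(0 <= i < n) (if M / 2 ^+ i < t then (M / 2 ^+ i) `^ d else 0) <=
    t `^ d / (1 - 2^-1 `^ d).
Proof.
move=> d0 t0.
have h2 : 0 <= (2^-1 : R) < 1 by lra.
have c1 := powR_lt1 h2 d0; have c0 : 0 <= (2^-1 : R) `^ d by exact: powR_ge0.
have c10 : 0 < 1 - (2^-1 : R) `^ d by rewrite subr_gt0.
elim: n => [|n IH] M M0; first by rewrite big_geq// divr_ge0 ?powR_ge0// ltW.
have [Mt|tM] := ltP M t.
  apply: (@le_trans _ _ (M `^ d * \sum_(0 <= i < n.+1) (2^-1 `^ d) ^+ i)).
    rewrite mulr_sumr ler_sum// => i _.
    rewrite -powR_mulrn// powRAC powR_mulrn ?invr_ge0// exprVn -powRM ?invr_ge0 ?exprn_ge0//.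
    by case: ifP; rewrite ?powR_ge0.
  apply: ler_pM; rewrite ?powR_ge0//.
  - by rewrite sumr_ge0// => i _; exact: exprn_ge0.
  - by apply: ge0_ler_powR; rewrite ?(ltW d0) ?nnegrE// ltW.
  - exact: sum_geometric_le.
rewrite big_nat_recl// expr0 divr1 ltNge tM/= add0r.
apply: le_trans (IH (M / 2) (divr_ge0 M0 _))=> //.
by rewrite le_eqVlt; apply/orP; left; apply/eqP; apply: eq_bigr => i _;
  rewrite exprS invfM mulrA.
Qed.

(** Marcinkiewicz interpolation: x is cut at the dyadic heights M / 2^i, and the
    part above height M / 2^i is measured in l^p. *)
Lemma bounded_operators_p_inf (p r : R) T : 0 < p < r ->
  bounded_operators p%:E +oo%E T -> bounded_operators p%:E r%:E T.
Proof.
move=> /andP[p0 pr] [Tlin Tinf Tp]; have r0 : 0 < r := lt_trans p0 pr.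
have T0 : T 0 = 0 by apply: linear_on0 Tlin; exact: carrier_ell0.
have sub x : carrier (ell r%:E) x -> carrier (ell +oo%E) x by apply: ell_sub_inf; rewrite lte_fin.
split=> //; first by move=> a x y /sub xi /sub yi; exact: Tlin.
have [B' B'0 TB'] := (bounded_map_infP T0).1 Tinf.
have [A A0 TA] := (bounded_map_massP (ltW p0) T0).1 Tp.
pose B := B' + 1; have B0 : 0 < B by rewrite ltr_wpDl.
have TB z (M : R) : (forall k, `|z k| <= M) -> forall k, `|T z k| <= B * M.
  move=> zM k; rewrite (le_trans (TB' z M zM k))// ler_wpM2r ?lerDl//.
  exact: le_trans (zM 0%N).
have d0 : 0 < r - p by rewrite subr_gt0.
pose W := 4 `^ r * B `^ (r - p); have W0 : 0 <= W by rewrite mulr_ge0 ?powR_ge0.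
have h2 : 0 <= (2^-1 : R) < 1 by lra.
have c10 : 0 < 1 - (2^-1 : R) `^ (r - p) by rewrite subr_gt0 powR_lt1.
pose C := W * A / (1 - 2^-1 `^ (r - p)).
have C0 : 0 <= C by exact: divr_ge0 (mulr_ge0 W0 A0) (ltW c10).
apply/(bounded_map_massP (ltW r0) T0); exists C => // x xr.
have [->|/eqP x0] := eqVneq x 0; first by rewrite T0 mass0 mule0.
pose M := fine (mass r x) `^ r^-1.
have M0 : 0 < M by rewrite powR_gt0// fine_gt0// xr mass_gt0.
have xM k : `|x k| <= M.
  by apply: (coord_le_mass _ r0); rewrite ?powR_ge0// powRVK ?gt_eqF ?fine_ge0
    ?mass_ge0// mass_fineK.
pose l i := M / 2 ^+ i.
have l0 i : 0 < l i by rewrite divr_gt0// exprn_gt0.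
pose up i : nat -> R := fun k => if l i < `|x k| then x k else 0.
pose lo i : nat -> R := fun k => if l i < `|x k| then 0 else x k.
have upp i : (mass p (up i) < +oo)%E.
  apply: (@le_lt_trans _ _ ((l i `^ (r - p))^-1%:E * mass r x)%E); last first.
    by rewrite -(mass_fineK xr) -EFinM ltry.
  rewrite /mass -nneseriesZl; last by move=> k _; rewrite lee_fin phi_ge0.
  apply: lee_nneseries => k _; first by move=> _; rewrite lee_fin phi_ge0.
  rewrite -EFinM lee_fin /up; case: ifP => [lx|_]; last first.
    by rewrite phi00 mulr_ge0 ?phi_ge0// invr_ge0 powR_ge0.
  rewrite ler_pdivlMl ?powR_gt0// !phiE//.
  have xk0 : 0 < `|x k| := lt_trans (l0 i) lx.
  rewrite -[X in _ <= _ `^ X](subrK p) [leRHS]powRD; last by rewrite (gt_eqF xk0) implybT.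
  rewrite ler_wpM2r ?powR_ge0//; apply: ge0_ler_powR; rewrite ?nnegrE ?(ltW d0) ?(ltW (l0 i))//.
  exact: ltW.
have xinf (z : nat -> R) : (forall k, `|z k| <= `|x k|) -> carrier (ell +oo%E) z.
  by move=> zx; apply/carrier_inf; exists M; [exact: ltW|move=> k; exact: le_trans (xM k)].
have Tsplit i : T x = T (up i) + T (lo i).
  have {1}-> : x = 1 \*o up i + lo i.
    by apply/funext => k; rewrite !fctE /= mul1r /up /lo; case: ifP => _; rewrite ?addr0 ?add0r.
  by rewrite Tlin ?mull1//; apply: xinf => k; rewrite /up /lo; case: ifP; rewrite ?normr0.
have Tlo i j : `|T (lo i) j| <= B * l i.
  by apply: TB => k; rewrite /lo; case: ltP => // _; rewrite normr0 ltW.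
pose w i := W * l i `^ (r - p).
have w0 i : 0 <= w i by rewrite mulr_ge0 ?powR_ge0.
have t0 i j : (0 <= (w i * phi p (T (up i) j))%:E)%E by rewrite lee_fin mulr_ge0 ?phi_ge0.
have pointwise j : ((phi r (T x j))%:E <=
    \sum_(0 <= i <oo) (w i * phi p (T (up i) j))%:E)%E.
  have [->|yj] := eqVneq (T x j) 0; first by rewrite phi00 nneseries_ge0.
  have yj0 : 0 < `|T x j| by rewrite normr_gt0.
  (* At such a height the part of x below it, whose image is at most B (l i),
     leaves half of T x j to the part above it. *)
  have ex : exists i, 2 * B * l i < `|T x j|.
    exists (Num.truncn (2 * B * M / `|T x j|)).+1.
    rewrite /l mulrA ltr_pdivrMr ?exprn_gt0// [ltRHS]mulrC -ltr_pdivrMr//.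
    apply: (lt_trans (truncnS_gt _)); rewrite -natrX ltr_nat.
    exact: ltn_expl.
  have [i il ig] : exists2 i, 2 * B * l i < `|T x j| & `|T x j| <= 4 * B * l i.
    exists (ex_minn ex); case: ex_minnP => -[|i] il imin //.
      rewrite (le_trans (TB x M xM j))// /l expr0 divr1 ler_wpM2r ?(ltW M0)//.
      by rewrite ler_peMl ?(ltW B0)// ler1n.
    have : ~~ (2 * B * l i < `|T x j|) by apply/negP => /imin; rewrite ltnn.
    rewrite -leNgt => h; apply: (le_trans h); rewrite /l exprS.
    by rewrite le_eqVlt; apply/orP; left; apply/eqP; field; rewrite expf_neq0.
  have big : B * l i <= `|T (up i) j|.
    have := ler_normD (T (up i) j) (T (lo i) j); have := Tlo i j.
    by move: il; rewrite (Tsplit i) fctE; lra.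
  have Bl : 0 < B * l i by rewrite mulr_gt0.
  apply: (@le_trans _ _ (w i * phi p (T (up i) j))%:E); last first.
    rewrite (nneseriesD1 (n := i))//.
    by rewrite leeDl// nneseries_ge0.
  rewrite lee_fin !phiE//.
  apply: (@le_trans _ _ ((4 * (B * l i)) `^ r)).
    rewrite mulrA; apply: ge0_ler_powR => //; first exact: ltW.
    by rewrite nnegrE -mulrA mulr_ge0// ltW.
  apply: (@le_trans _ _ (w i * (B * l i) `^ p)); last first.
    by rewrite ler_wpM2l// ge0_ler_powRE ?(ltW Bl).
  rewrite powRM ?(ltW Bl)// -[X in _ * (_ `^ X) <= _](subrK p).
  rewrite powRD; last by rewrite (gt_eqF Bl) implybT.
  by rewrite (powRM (r - p) (ltW B0) (ltW (l0 i))) /w /W !mulrA.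
apply: (@le_trans _ _ (\sum_(0 <= j <oo) \sum_(0 <= i <oo) (w i * phi p (T (up i) j))%:E)%E).
  by apply: lee_nneseries => j _ //; rewrite lee_fin phi_ge0.
rewrite nneseries_interchange; last by move=> j i; exact: t0.
apply: (@le_trans _ _ (\sum_(0 <= i <oo) \sum_(0 <= k <oo)
    (A * (w i * phi p (up i k)))%:E)%E).
  apply: lee_nneseries => i _; first by move=> _; exact: nneseries_ge0.
  under eq_eseriesr do rewrite EFinM.
  rewrite nneseriesZl; last by move=> k _; rewrite lee_fin phi_ge0.
  under [leRHS]eq_eseriesr do rewrite mulrA EFinM.
  rewrite nneseriesZl; last by move=> k _; rewrite lee_fin phi_ge0.
  rewrite [A * _]mulrC [(w i * A)%:E]EFinM -muleA lee_wpmul2l ?lee_fin//.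
  exact: TA (upp i).
have u0 i k : (0 <= (A * (w i * phi p (up i k)))%:E)%E.
  exact: mulr_ge0 A0 (mulr_ge0 (w0 i) (phi_ge0 _ _)).
rewrite nneseries_interchange//.
rewrite /mass -nneseriesZl; last by move=> k _; rewrite lee_fin phi_ge0.
apply: lee_nneseries => k _.
  by move=> _; exact: nneseries_ge0.
rewrite -EFinM; apply: lime_le.
  by apply: is_cvg_nneseries => i _ _; exact: u0.
apply: nearW => n; rewrite sumEFin lee_fin.
have := sum_levels_le n d0 (normr_ge0 (x k)) (ltW M0).
have [xk0|xk0] := eqVneq (x k) 0.
  move=> _; rewrite big1 ?xk0 ?phi00 ?mulr0// => i _.
  by rewrite /up xk0; case: ifP => _; rewrite phi00 !mulr0.
move=> h; apply: (@le_trans _ _ (A * W * `|x k| `^ p *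
    \sum_(0 <= i < n) (if M / 2 ^+ i < `|x k| then (M / 2 ^+ i) `^ (r - p) else 0))).
  rewrite mulr_sumr ler_sum// => i _; rewrite /up /w -/(l i); case: ifP => _.
    by rewrite phiE// le_eqVlt; apply/orP; left; apply/eqP; ring.
  by rewrite phi00 !mulr0.
apply: (le_trans (ler_wpM2l _ h)); first by rewrite !mulr_ge0 ?powR_ge0.
have -> : phi r (x k) = `|x k| `^ (r - p) * `|x k| `^ p.
  by rewrite -powRD ?subrK ?phiE// normr_eq0 xk0 implybT.
by rewrite /C le_eqVlt; apply/orP; left; apply/eqP; ring.
Qed.

Lemma ell0_sub_space (p : R) (E : seqSpace R) : 0 < p -> quasi_banach E ->
  continuous_inclusion (ell p%:E) E -> continuous_inclusion (ell 0%E) E.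
Proof.
move=> p0 hE [pE _]; split.
  move=> x /(carrier_mass _ (lexx 0)) x0; apply: pE.
  apply/(carrier_mass _ (ltW p0)); have [n ->] := mass0_finite x0.
  by rewrite mass_cut ltry.
move=> x /(carrier_mass _ (lexx 0)) x0 e e0; exists 1 => // y /(carrier_mass _ (lexx 0)) y0.
have yx0 := mass_sub_lty (lexx 0) y0 x0.
rewrite /= ell_norm_mass0 => h.
suff -> : y - x = 0 by rewrite N_zero.
apply/funext => k; apply/eqP/negPn/negP => yxk.
move: h; rewrite ltNge => /negP; apply; rewrite -lee_fin mass_fineK//.
by apply: le_trans (phi_le_mass 0 (y - x) k); rewrite lee_fin /phi eqxx yxk.
Qed.

End endpoint_operators.

(** * The equivalence *)

Section interpolation_theorem.
Context {R : realType} (q : \bar R) (E : seqSpace R) (s : R).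
Context (hs : aoki_rolewicz_index E s).

Lemma Int_zero_Int_p : Int 0%E q E -> forall p : R, 0 < p < s -> Int p%:E q E.
Proof.
move=> hI p ps; have /andP[p0 p_s] := ps.
have [/andP[_ q0] hE _ EQ _] := hI.
have pq : (p%:E < q)%E.
  case: q hI q0 {EQ} => [r| |]//= hI' _; last exact: ltry.
  by rewrite lte_fin (lt_le_trans p_s)// (index_le_exponent hI' erefl hs).
split=> //; first by rewrite lee_fin (ltW p0).
  exact: (ell_sub_interpolation hI hs ps).
move=> T; case: q hI {q0 EQ pq} => [r| |] hI Tb; last by case: hI => /andP[].
- have [r1|/ltW r1] := leP 1 r; first exact: (bounded_interpolation_ge1 r1 hI hs ps Tb).
  exact: (bounded_interpolation_le1 r1 hI hs ps Tb).
- exact: (bounded_interpolation_infinite hI hs ps Tb).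
Qed.

Lemma Int_p_Int_zero : (forall p : R, 0 < p < s -> Int p%:E q E) -> Int 0%E q E.
Proof.
move=> hp; have s0 : 0 < s by case: hs.
pose p := Num.min s 1 / 2.
have m0 : 0 < Num.min s 1 by rewrite lt_min s0 ltr01.
have p0 : 0 < p by rewrite divr_gt0.
have pm : p < Num.min s 1 by rewrite ltr_pdivrMr// ltr_pMr// ltr1n.
have [ps p1] : p < s /\ p < 1 by apply/andP; rewrite -lt_min.
have psP : 0 < p < s by rewrite p0.
have [/andP[_ pq] hE pE EQ Tb] := hp p psP.
split=> //.
- by rewrite lexx/=; apply: lt_trans pq; rewrite lte_fin.
- exact: (ell0_sub_space p0 hE pE).
- by move=> T /(@bounded_operators_zero_p _ p); move/(_ _ pq) => H; apply/Tb/H; rewrite p0 ltW.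
Qed.

Lemma Int_p_Int_infinite (p : R) : 0 < p -> Int p%:E q E -> Int p%:E +oo%E E.
Proof.
move=> p0 [/andP[_ pq] hE pE EQ Tb].
have q0 : (0 < q)%E by apply: lt_trans pq; rewrite lte_fin.
split=> //; first by rewrite lee_fin (ltW p0) ltry.
  exact: (sub_ell_inf hE q0 EQ).
move=> T Tinf; apply: Tb; case: q pq {q0 EQ} => [r| |]// pr.
by apply: bounded_operators_p_inf Tinf; rewrite p0 -lte_fin.
Qed.

End interpolation_theorem.

Theorem theorem4p11 (R : realType) (q : \bar R) (E : seqSpace R) (sigma : R)
    (hq : (0 < q)%E) (hE : quasi_banach E)
    (hsigma : aoki_rolewicz_index E sigma) :
  [<-> Int 0%E q E;
       forall p : R, 0 < p < sigma -> Int p%:E q E;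
       Int 0%E q E /\ (forall p : R, 0 < p < sigma -> Int p%:E +oo%E E)].
Proof.
tfae=> [hI p ps|hp|[]//]; first exact: (Int_zero_Int_p hsigma hI ps).
split; first exact: (Int_p_Int_zero hsigma hp).
by move=> p ps; apply: Int_p_Int_infinite _ (hp p ps); case/andP: ps.
Qed.
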